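(* Let $\mathcal{K}\hookrightarrow\mathcal{L}$ be simplicial complexes, where $\mathcal{L}$ is $q$-non-branching. By iterating $k$ steps, the Golub–Kahan–Lanczos (GKL) algorithm applied to the matrix $M=(W_q^{\mathcal{K}})^{-1/2}B_{q+1}^{\mathcal{L},\mathcal{K}}(W_{q+1}^{\mathcal{L},\mathcal{K}})^{1/2}$ computes approximations to $k$ eigenvalues of the up persistent Laplacian $\Delta_{q,\mathrm{up}}^{\mathcal{K},\mathcal{L}}$ (namely the squares of the singular values of the resulting $k\times k$ bidiagonal matrix), and the whole computation, including the construction of $M$, takes $$O\left((n_q^{\mathcal{L}}-n_q^{\mathcal{K}})\cdot\alpha(n_{q+1}^{\mathcal{L}})+k\cdot(n_{q+1}^{\mathcal{L}}+n_q^{\mathcal{K}})+k^2\right)$$ arithmetic operations, where $\alpha(\cdot)$ is the inverse Ackermann function.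
   Context: Simplicial complexes are finite; $n_q^X$ is the number of $q$-simplices of $X$. $\mathcal{L}$ is $q$-non-branching if every $q$-simplex of $\mathcal{L}$ is a face of at most two $(q+1)$-simplices. Simplices are oriented and ordered; complexes carry positive weights on simplices; $W_p^X$ is the diagonal matrix of weights of $p$-simplices of $X$; the chain space $C_p^X$ (over $\mathbb{R}$) has the inner product with distinct oriented simplices orthogonal and $\langle[\sigma],[\sigma]\rangle=w^X(\sigma)^{-1}$. $C_{q+1}^{\mathcal{L},\mathcal{K}}=\{c\in C_{q+1}^{\mathcal{L}}:\partial_{q+1}^{\mathcal{L}}c\in C_q^{\mathcal{K}}\}$, $\partial_{q+1}^{\mathcal{L},\mathcal{K}}$ is the restriction of $\partial_{q+1}^{\mathcal{L}}$ to it, with values in $C_q^{\mathcal{K}}$, and $\Delta_{q,\mathrm{up}}^{\mathcal{K},\mathcal{L}}$ is the matrix of $\partial_{q+1}^{\mathcal{L},\mathcal{K}}\circ(\partial_{q+1}^{\mathcal{L},\mathcal{K}})^*$ in the basis of oriented $q$-simplices of $\mathcal{K}$. Let $B_{q+1}^{\mathcal{L}}$ be the matrix of $\partial_{q+1}^{\mathcal{L}}$, $I_q^{\mathcal{K}}$ the row indices of $q$-simplices of $\mathcal{K}$, and $D$ the submatrix of $B_{q+1}^{\mathcal{L}}$ formed by the rows not in $I_q^{\mathcal{K}}$. Let $C_0$ be the set of indices of zero columns of $D$ (all columns if $D$ has no rows). On the remaining column indices form the graph in which two columns are adjacent if some row of $D$ is non-zero in both. A connected component $C$ is regulable if every non-zero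 row of $D(:,C)$ has exactly two non-zero entries and the columns of $D(:,C)$ can be multiplied by signs $\pm1$ so that every non-zero row has one entry $1$ and one entry $-1$. Let $C_1,\dots,C_r$ be the regulable components, $\varepsilon_j\in\{\pm1\}^{C_j}$ such signs, $b_j=B_{q+1}^{\mathcal{L}}(I_q^{\mathcal{K}},C_j)\varepsilon_j$, $s_j=\sum_{k\in C_j}1/W_{q+1}^{\mathcal{L}}(k,k)$. $B_{q+1}^{\mathcal{L},\mathcal{K}}$ is the concatenation of $B_{q+1}^{\mathcal{L}}(I_q^{\mathcal{K}},C_0)$ with $b_1,\dots,b_r$, and $W_{q+1}^{\mathcal{L},\mathcal{K}}=W_{q+1}^{\mathcal{L}}(C_0,C_0)\oplus\mathrm{diag}(s_1^{-1},\dots,s_r^{-1})$. GKL algorithm with $k$ iterations on a matrix $A$ (replaced by $A^T$ if it has fewer rows than columns; $k$ at most the number of columns): choose a random unit vector $v_1$, set $\beta_0=0$; for $j=1,\dots,k$: $u_j\leftarrow Av_j-\beta_{j-1}u_{j-1}$, $\alpha_j\leftarrow\|u_j\|_2$, $u_j\leftarrow u_j/\alpha_j$, $v_{j+1}\leftarrow A^Tu_j-\alpha_jv_j$, $\beta_j\leftarrow\|v_{j+1}\|_2$, $v_{j+1}\leftarrow v_{j+1}/\beta_j$. The output is the $k\times k$ upper bidiagonal matrix with diagonal $\alpha_1,\dots,\alpha_k$ and superdiagonal $\beta_1,\dots,\beta_{k-1}$, whose singular values are taken as approximations to singular values of $A$. Computing the singular values of a $k\times k$ bidiagonal matrix is counted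 as $O(k^2)$ operations. Matrices are given and stored in sparse (compressed sparse row) format; a square root counts as one operation. *)

(* Defs.v *)
From HB Require Import structures.
From mathcomp Require Import all_boot all_order all_algebra.
From mathcomp Require Import reals.
From mathcomp Require classical_sets.

Set Implicit Arguments.
Unset Strict Implicit.
Unset Printing Implicit Defensive.

Import Order.TTheory GRing.Theory Num.Theory.
Local Open Scope ring_scope.

(* Simplicial complexes on a finite vertex set V; a simplex is the set of its
   vertices, a q-simplex has q.+1 of them. *)

Section Complexes.
Variable V : finType.
Implicit Types (X : {set {set V}}) (s t : {set V}).

Definition simplicial_complex X : bool :=
  (set0 \notin X) &&
  [forall s : {set V}, forall t : {set V},
     [&& s \in X, t != set0 & t \subset s] ==> (t \in X)].

Definition simplices X q : {set {set V}} := [set s in X | #|s| == q.+1].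

Definition nb_simplices X q : nat := #|simplices X q|.

Definition non_branching X q : bool :=
  [forall t in simplices X q,
     (#|[set s in simplices X q.+1 | t \subset s]| <= 2)%N].

(* The list [ord] of all simplices of a complex fixes the numbering of its
   q-simplices, for every q. *)
Definition ordered_simplices (ord : seq {set V}) q : seq {set V} :=
  [seq s : {set V} <- ord | #|s| == q.+1].

Definition simplex (ord : seq {set V}) q
    (i : 'I_(size (ordered_simplices ord q))) : {set V} :=
  tnth (in_tuple (ordered_simplices ord q)) i.

(* Every orientation of a simplex is the one given by the enumeration of V,
   reversed when [flip] is true.  The sum below is the coefficient of [t] in
   the boundary  \sum_i (-1)^i [v_0 .. v_(i-1) v_(i+1) .. v_p]  of [s]. *)
Definition incidence (R : pzRingType) (flip : {set V} -> bool) t s : R :=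
  (-1) ^+ flip t * (-1) ^+ flip s *
  \sum_(v in s | s :\ v == t)
     (-1) ^+ #|[set u in s | (enum_rank u < enum_rank v)%N]|.

Definition boundary_mx (R : pzRingType) (flip : {set V} -> bool)
    (ord : seq {set V}) q :
    'M[R]_(size (ordered_simplices ord q), size (ordered_simplices ord q.+1)) :=
  \matrix_(i, j) incidence R flip (simplex i) (simplex j).

Definition row_indices (ord : seq {set V}) X q :
    {set 'I_(size (ordered_simplices ord q))} :=
  [set i | simplex i \in X].

End Complexes.

Section Adjoint.
Variables (R : realType) (U W : vectType R).
Variables (ipU : U -> U -> R) (ipW : W -> W -> R).

Definition adjoint (f : 'Hom(U, W)) : 'Hom(W, U) :=
  classical_sets.xget 0
    (fun g : 'Hom(W, U) => forall x y, ipW (f x) y = ipU x (g y)).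

End Adjoint.

(* Inner product for which the basis simplices are orthogonal, the i-th one
   having squared norm (w i)^-1. *)
Definition chain_ip (R : realType) n (w : 'I_n -> R) (x y : 'cV[R]_n) : R :=
  \sum_i (w i)^-1 * x i 0 * y i 0.

(* [B] is the boundary matrix of L in degree q+1, [I] the set of row indices of
   the q-simplices of K, [wq] the weights of the q-simplices of K and [w] those
   of the (q+1)-simplices of L. *)

Section Persistent.
Variables (R : realType) (m n : nat) (B : 'M[R]_(m, n)) (I : {set 'I_m}).
Variables (wq : 'I_#|I| -> R) (w : 'I_n -> R).

Definition inner_rows : 'M[R]_(#|I|, n) :=
  rowsub (fun i : 'I_#|I| => enum_val i) B.

Definition outer_rows : 'M[R]_(#|~: I|, n) :=
  rowsub (fun i : 'I_#|~: I| => enum_val i) B.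

Definition pers_chains : {vspace 'cV[R]_n} :=
  (linfun (fun c : 'cV[R]_n => B *m c) @^-1:
     <<[seq (delta_mx i 0%R : 'cV[R]_m) | i <- enum I]>>)%VS.

Definition pers_boundary : 'Hom(subvs_of pers_chains, 'cV[R]_#|I|) :=
  linfun (fun c : subvs_of pers_chains =>
            rowsub (fun i : 'I_#|I| => enum_val i) (B *m vsval c)).

Definition pers_coboundary : 'Hom('cV[R]_#|I|, subvs_of pers_chains) :=
  adjoint (fun x y => chain_ip w (vsval x) (vsval y)) (chain_ip wq) pers_boundary.

Definition up_pers_laplacian : 'M[R]_#|I| :=
  \matrix_(i, j) (pers_boundary (pers_coboundary (delta_mx j 0))) i 0.

Local Notation D := outer_rows.

Definition zero_cols : {set 'I_n} := [set j | [forall i, D i j == 0]].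

Definition col_adj : rel 'I_n :=
  fun j k => [exists i, (D i j != 0) && (D i k != 0)].

Definition components : {set {set 'I_n}} :=
  [set [set k | connect col_adj j k] | j in ~: zero_cols].

(* The sign of column k is (-1) ^+ eps k. *)
Definition regulates (C : {set 'I_n}) (eps : {ffun 'I_n -> bool}) : bool :=
  [forall i, [exists k in C, D i k != 0] ==>
     [&& #|[set k in C | D i k != 0]| == 2%N,
         [exists k in C, D i k * (-1) ^+ eps k == 1] &
         [exists k in C, D i k * (-1) ^+ eps k == -1]]].

Definition regulable (C : {set 'I_n}) : bool := [exists eps, regulates C eps].

Definition regulable_components : {set {set 'I_n}} :=
  [set C in components | regulable C].

(* A numbering of the regulable components, with signs for all of them. *)
Definition regulation (Cs : seq {set 'I_n}) (eps : {ffun 'I_n -> bool}) : Prop :=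
  perm_eq Cs (enum regulable_components) /\ (forall C, C \in Cs -> regulates C eps).

Variables (Cs : seq {set 'I_n}) (eps : {ffun 'I_n -> bool}).

Definition component (j : 'I_(size Cs)) : {set 'I_n} := tnth (in_tuple Cs) j.

Definition pers_boundary_mx : 'M[R]_(#|I|, #|zero_cols| + size Cs) :=
  row_mx (colsub (fun k : 'I_#|zero_cols| => enum_val k) inner_rows)
         (\matrix_(i, j) \sum_(k in component j) inner_rows i k * (-1) ^+ eps k).

Definition pers_weights : 'rV[R]_(#|zero_cols| + size Cs) :=
  row_mx (\row_(k < #|zero_cols|) w (enum_val k))
         (\row_j (\sum_(k in component j) (w k)^-1)^-1).

Definition pers_mx : 'M[R]_(#|I|, #|zero_cols| + size Cs) :=
  diag_mx (\row_i (Num.sqrt (wq i))^-1) *m pers_boundary_mx *m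
  diag_mx (map_mx Num.sqrt pers_weights).

End Persistent.

Section SingularValues.
Variable R : realType.

(* The nonincreasing list of the square roots of the minn m n largest
   eigenvalues of A^T A (the n - minn m n others vanish). *)
Definition singular_values m n (A : 'M[R]_(m, n)) (s : seq R) : Prop :=
  [/\ size s = minn m n,
      sorted >=%R s,
      all (fun x => 0 <= x) s
    & char_poly (A^T *m A) =
        'X^(n - minn m n) * \prod_(x <- s) ('X - (x ^+ 2)%:P)].

Definition bidiag_mx k (d e : nat -> R) : 'M[R]_k :=
  \matrix_(i, j) if j == i :> nat then d i else if j == i.+1 :> nat then e i else 0.

Definition krylov_mx n (H : 'M[R]_n) (x : 'cV[R]_n) k : 'M[R]_(k, n) :=
  \matrix_(i, j) (iter i (mulmx H) x) j 0.

(* [ls] lists the Rayleigh-Ritz approximations of size [ls] eigenvalues of the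
   symmetric matrix H from the Krylov space of x: the eigenvalues of the
   compression of H to span(x, H x, .., H^(k-1) x), k = size ls. *)
Definition ritz_values n (H : 'M[R]_n) (x : 'cV[R]_n) (ls : seq R) : Prop :=
  exists Q : 'M[R]_(n, size ls),
    [/\ Q^T *m Q = 1%:M,
        (Q^T == krylov_mx H x (size ls))%MS
      & char_poly (Q^T *m H *m Q) = \prod_(l <- ls) ('X - l%:P)].

Definition norm2 n (x : 'cV[R]_n) : R := Num.sqrt (\sum_i x i 0 ^+ 2).

Record gkl_state m n := GklState {
  gkl_u : 'cV[R]_m; (* u_j *)
  gkl_v : 'cV[R]_n; (* v_(j+1) *)
  gkl_a : R;        (* alpha_j *)
  gkl_b : R         (* beta_j *)
}.

(* Division by zero gives zero, as everywhere in the library. *)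
Definition gkl_step m n (A : 'M[R]_(m, n)) (st : gkl_state m n) : gkl_state m n :=
  let u := A *m gkl_v st - gkl_b st *: gkl_u st in
  let a := norm2 u in
  let u := a^-1 *: u in
  let v := A^T *m u - a *: gkl_v st in
  let b := norm2 v in
  GklState u (b^-1 *: v) a b.

Definition gkl m n (A : 'M[R]_(m, n)) (v1 : 'cV[R]_n) j : gkl_state m n :=
  iter j (gkl_step A) (GklState 0 v1 0 0).

(* [f] applied to A, or to its transpose if A has fewer rows than columns. *)
Definition on_tall T (f : forall m n, 'M[R]_(m, n) -> T) m n (A : 'M[R]_(m, n)) : T :=
  if (m < n)%N then f n m A^T else f m n A.

Variable v1 : nat -> R.

(* The starting vector is an array, of which as many entries are used as the
   matrix has columns. *)
Definition start_vec n : 'cV[R]_n := \col_i v1 i.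

Definition gkl_alpha m n (A : 'M[R]_(m, n)) j : R :=
  on_tall (fun _ n' A' => gkl_a (gkl A' (start_vec n') j)) A.

Definition gkl_beta m n (A : 'M[R]_(m, n)) j : R :=
  on_tall (fun _ n' A' => gkl_b (gkl A' (start_vec n') j)) A.

Definition gkl_bidiag m n (A : 'M[R]_(m, n)) k : 'M[R]_k :=
  bidiag_mx k (fun i => gkl_alpha A i.+1) (fun i => gkl_beta A i.+1).

(* No vanishing divisor occurs before alpha_k is computed. *)
Definition gkl_no_breakdown m n (A : 'M[R]_(m, n)) k : Prop :=
  forall j, (0 < j < k)%N -> gkl_alpha A j != 0 /\ gkl_beta A j != 0.

(* The squares of the singular values [theta] of the k-step bidiagonal matrix
   approximate eigenvalues of L, as Ritz values of the Gram matrix of A; up to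
   zeros, the spectrum of L consists of the squares of the singular values of A. *)
Definition gkl_approximates_eigenvalues m n (A : 'M[R]_(m, n)) (L : 'M[R]_m) k : Prop :=
  exists sigma theta : seq R,
    [/\ singular_values A sigma,
        char_poly L =
          'X^(m - minn m n) * \prod_(x <- sigma) ('X - (x ^+ 2)%:P),
        singular_values (gkl_bidiag A k) theta
      & gkl_no_breakdown A k ->
        on_tall (fun _ n' A' =>
          ritz_values (A'^T *m A') (start_vec n') [seq x ^+ 2 | x <- theta]) A].

End SingularValues.

Section CompressedSparseRow.
Variables (R : realType) (m n : nat) (A : 'M[R]_(m, n)).

Definition row_support (i : 'I_m) : seq 'I_n := [seq j <- enum 'I_n | A i j != 0].

Definition csr_rowptr (i : nat) : nat :=
  (\sum_(r < m | (r < i)%N) size (row_support r))%N.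

Definition csr_colidx : seq nat :=
  flatten [seq [seq val j | j <- row_support i] | i <- enum 'I_m].

Definition csr_values : seq R :=
  flatten [seq [seq A i j | j <- row_support i] | i <- enum 'I_m].

End CompressedSparseRow.

(* A random access machine with integer and real registers.  Memory consists of
   finitely many arrays (the first nat in NGet, RGet, NSet, RSet names the
   array, and is fixed by the program); scalars are one-cell arrays.  Every
   constant, memory access, operation, test and assignment has unit cost.
   Integers support only addition, truncated subtraction and comparison. *)

Inductive nexpr :=
| NConst of nat
| NGet of nat & nexpr
| NAdd of nexpr & nexpr
| NSub of nexpr & nexpr.

Inductive rexpr :=
| RConst of nat
| RGet of nat & nexpr
| RAdd of rexpr & rexpr
| RSub of rexpr & rexpr
| RMul of rexpr & rexpr
| RDiv of rexpr & rexpr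
| RSqrt of rexpr.

Inductive bexpr :=
| BNle of nexpr & nexpr
| BRle of rexpr & rexpr
| BNot of bexpr
| BAnd of bexpr & bexpr.

Inductive cmd :=
| Skip
| NSet of nat & nexpr & nexpr
| RSet of nat & nexpr & rexpr
| Seq of cmd & cmd
| If of bexpr & cmd & cmd
| While of bexpr & cmd
| BidiagSvd of nexpr & nat & nat & nat.

Fixpoint ncost (e : nexpr) : nat :=
  match e with
  | NConst _ => 1
  | NGet _ e1 => (ncost e1).+1
  | NAdd e1 e2 | NSub e1 e2 => (ncost e1 + ncost e2).+1
  end.

Fixpoint rcost (e : rexpr) : nat :=
  match e with
  | RConst _ => 1
  | RGet _ e1 => (ncost e1).+1
  | RAdd e1 e2 | RSub e1 e2 | RMul e1 e2 | RDiv e1 e2 => (rcost e1 + rcost e2).+1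
  | RSqrt e1 => (rcost e1).+1
  end.

Fixpoint bcost (e : bexpr) : nat :=
  match e with
  | BNle e1 e2 => (ncost e1 + ncost e2).+1
  | BRle e1 e2 => (rcost e1 + rcost e2).+1
  | BNot e1 => (bcost e1).+1
  | BAnd e1 e2 => (bcost e1 + bcost e2).+1
  end.

Section Semantics.
Variable R : realType.

Record state := State {
  nmem : nat -> nat -> nat;
  rmem : nat -> nat -> R
}.

Fixpoint neval (s : state) (e : nexpr) : nat :=
  match e with
  | NConst c => c
  | NGet a e1 => nmem s a (neval s e1)
  | NAdd e1 e2 => neval s e1 + neval s e2
  | NSub e1 e2 => neval s e1 - neval s e2
  end%N.

Fixpoint reval (s : state) (e : rexpr) : R :=
  match e with
  | RConst c => c%:R
  | RGet a e1 => rmem s a (neval s e1)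
  | RAdd e1 e2 => reval s e1 + reval s e2
  | RSub e1 e2 => reval s e1 - reval s e2
  | RMul e1 e2 => reval s e1 * reval s e2
  | RDiv e1 e2 => reval s e1 / reval s e2
  | RSqrt e1 => Num.sqrt (reval s e1)
  end.

Fixpoint beval (s : state) (e : bexpr) : bool :=
  match e with
  | BNle e1 e2 => (neval s e1 <= neval s e2)%N
  | BRle e1 e2 => reval s e1 <= reval s e2
  | BNot e1 => ~~ beval s e1
  | BAnd e1 e2 => beval s e1 && beval s e2
  end.

Definition nset (s : state) a i x : state :=
  State (fun b j => if (b == a) && (j == i) then x else nmem s b j) (rmem s).

Definition rset (s : state) a i x : state :=
  State (nmem s) (fun b j => if (b == a) && (j == i) then x else rmem s b j).

Definition rset_seq (s : state) a (xs : seq R) : state :=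
  State (nmem s)
    (fun b j => if (b == a) && (j < size xs)%N then nth 0 xs j else rmem s b j).

(* [exec c s t s'] : from s, the command c stops in s' at cost t.  [BidiagSvd]
   writes to array [o] the singular values of the k x k bidiagonal matrix whose
   diagonal and superdiagonal are in arrays [d] and [e], at cost about k^2. *)
Inductive exec : cmd -> state -> nat -> state -> Prop :=
| ExecSkip s : exec Skip s 1 s
| ExecNSet s a i e :
    exec (NSet a i e) s (ncost i + ncost e).+1 (nset s a (neval s i) (neval s e))
| ExecRSet s a i e :
    exec (RSet a i e) s (ncost i + rcost e).+1 (rset s a (neval s i) (reval s e))
| ExecSeq c1 c2 s s1 s2 t1 t2 :
    exec c1 s t1 s1 -> exec c2 s1 t2 s2 -> exec (Seq c1 c2) s (t1 + t2) s2
| ExecIf b c1 c2 s s1 t :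
    exec (if beval s b then c1 else c2) s t s1 ->
    exec (If b c1 c2) s (bcost b + t).+1 s1
| ExecWhileF b c s : ~~ beval s b -> exec (While b c) s (bcost b).+1 s
| ExecWhileT b c s s1 s2 t1 t2 :
    beval s b -> exec c s t1 s1 -> exec (While b c) s1 t2 s2 ->
    exec (While b c) s (bcost b + t1 + t2).+1 s2
| ExecBidiagSvd k d e o s xs :
    singular_values (bidiag_mx (neval s k) (rmem s d) (rmem s e)) xs ->
    exec (BidiagSvd k d e o) s (ncost k + neval s k ^ 2).+1 (rset_seq s o xs).

(* [A] is stored in compressed sparse row format: row pointers and column
   indices in the integer arrays [p] and [c], values in the real array [x]. *)
Definition stores_csr (s : state) (p c x : nat) m n (A : 'M[R]_(m, n)) : Prop :=
  (forall i, (i <= m)%N -> nmem s p i = csr_rowptr A i) /\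
  (forall i, (i < size (csr_colidx A))%N ->
     nmem s c i = nth 0%N (csr_colidx A) i /\ rmem s x i = nth 0 (csr_values A) i).

(* The input: B in compressed sparse row format, the increasing list of the
   elements of I, the diagonals of both weight matrices, the number k of
   iterations, and the starting vector; all other cells contain zero. *)
Definition input_state m n (B : 'M[R]_(m, n)) (I : {set 'I_m})
    (wq : 'I_#|I| -> R) (w : 'I_n -> R) (k : nat) (v1 : nat -> R) : state :=
  State
    (fun a i =>
       match a with
       | 0 => nth 0 [:: m; n; #|I|; k] i
       | 1 => nth 0 (mkseq (csr_rowptr B) m.+1) i
       | 2 => nth 0 (csr_colidx B) i
       | 3 => nth 0 [seq val r | r <- enum I] i
       | _ => 0
       end%N)
    (fun a i =>
       match a with
       | 0%N => nth 0 (csr_values B) i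
       | 1%N => nth 0 (codom wq) i
       | 2%N => nth 0 (codom w) i
       | 3%N => v1 i
       | _ => 0
       end).

(* The output: the matrix M with its dimensions, the two diagonals of the k-step
   bidiagonal matrix, and the squares of its singular values. *)
Definition output_state (s : state) m n (M : 'M[R]_(m, n)) (k : nat) (v1 : nat -> R) :
    Prop :=
  [/\ nmem s 4 0 = m /\ nmem s 4 1 = n,
      stores_csr s 5 6 4 M,
      forall i, (i < k)%N -> rmem s 5 i = gkl_alpha v1 M i.+1,
      forall i, (i.+1 < k)%N -> rmem s 6 i = gkl_beta v1 M i.+1
    & exists theta, singular_values (gkl_bidiag v1 M k) theta /\
        forall i, (i < k)%N -> rmem s 7 i = nth 0 theta i ^+ 2].

End Semantics.

Fixpoint ackermann (m : nat) : nat -> nat :=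
  match m with
  | 0 => succn
  | m'.+1 => fun n => iter n.+1 (ackermann m') 1%N
  end.

Lemma ltn_ackermann m n : (n < ackermann m n)%N.
Proof.
elim: m n => [|m IHm] n //=; elim: n => [|n IHn] /=; first exact: ltnW (IHm 1%N).
exact: leq_ltn_trans IHn (IHm _).
Qed.

Lemma inv_ackermann_ex n : exists m, (0 < m)%N && (n <= ackermann m m)%N.
Proof. by exists n.+1; apply: ltnW (ltnW (ltn_ackermann _ _)). Qed.

Definition inv_ackermann (n : nat) : nat := ex_minn (inv_ackermann_ex n).

(* Main.v *)
Require Import Defs.
From mathcomp Require Import all_boot all_order all_algebra.
From mathcomp Require Import reals complex zify.

Set Implicit Arguments.
Unset Strict Implicit.
Unset Printing Implicit Defensive.

Import Order.TTheory GRing.Theory Num.Theory.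

(** Everything rests on one description of the relative cycles. By
    non-branching a row of the boundary matrix has at most two nonzero entries,
    all of them signs. The equation of an outer row therefore either kills a
    coordinate or identifies two coordinates up to sign, so that a relative
    cycle is determined on a component of the column graph by any one of its
    coordinates, and can be nonzero there only if the component is regulable
    ([kernel_regulable], [kernel_constant]). Hence the zero columns and the
    signed sums over the regulable components form a basis of the relative
    chains ([kernel_chain_basis]). It is orthogonal, and the squared norms are
    the inverses of the persistent weights. In this basis the Laplacian is a
    product that is conjugate, by a diagonal matrix, to M M^T
    ([char_poly_up_pers_laplacian]); and M M^T has, up to zeros, the spectrum of
    M^T M, that is the squares of the singular values ([svd_gram]).

    As long as no divisor vanishes the vectors of the Lanczos iteration are
    orthonormal ([gkl_orthonormal]) and the right ones span the Krylov space.
    If Q has them as columns, A Q is the product of the left vectors by the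
    bidiagonal matrix, so that the compression of A^T A to the Krylov space is
    the Gram matrix of the bidiagonal matrix ([compression_krylov_basis]); its
    eigenvalues, the Ritz values, are the squares of the singular values of the
    latter.

    For the running time, the outer rows with two entries are the edges of a
    graph with at most (n_q^L - n_q^K) edges, in which a breadth-first search
    labels the components and assigns signs ([searchP]). These signs agree, up
    to a global change, with any regulating signs ([signs_class]), so that a
    component is regulable exactly when one more pass over the rows finds no
    violated equation. A zero column is treated as a component with one
    element: then every column of M is a class of columns of B, and an inner
    row of B, having at most two entries, produces a row of M in constant time,
    already in the order of the sparse format ([row_emission_support]). All
    this takes time linear in the numbers of rows and columns. A Lanczos step
    passes a bounded number of times over the entries of M and over two
    vectors. The costs are collected in [persistent_lanczosP]; the theorem
    follows because the inverse Ackermann function is at least 1.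

    Programs are verified with a total correctness logic in which the
    postcondition speaks of the running time ([wp]); a loop is paid for by a
    potential on the memory ([wp_while]). *)

(** * Characteristic polynomials of Gram matrices *)

Local Open Scope ring_scope.

Section CharPoly.
Variable F : fieldType.

(** Both sides are the determinant of the block matrix with blocks X, A, B, 1,
    by elimination on either side. *)
Lemma char_poly_mulC m n (A : 'M[F]_(m, n)) (B : 'M[F]_(n, m)) :
  char_poly (A *m B) * 'X^n = 'X^m * char_poly (B *m A).
Proof.
pose a := map_mx polyC A; pose b := map_mx polyC B.
pose M := block_mx ('X%:M : 'M_m) a b (1%:M : 'M_n).
have detM : \det M = char_poly (A *m B).
  have : M *m block_mx 1%:M 0 (- b) 1%:M = block_mx ('X%:M - a *m b) a 0 1%:M.
    by rewrite mulmx_block !mulmx1 !mulmx0 !add0r mulmxN mul1mx subrr.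
  move/(congr1 determinant); rewrite det_mulmx det_lblock det_ublock !det1 !mulr1 => ->.
  by rewrite /char_poly /char_poly_mx map_mxM.
have : block_mx (1%:M : 'M_m) 0 (- b) ('X%:M : 'M_n) *m M =
       block_mx 'X%:M a 0 ('X%:M - b *m a).
  rewrite mulmx_block !mul1mx !mul0mx !addr0 mulNmx mulmx1 mulNmx addrC.
  by rewrite scalar_mxC subrr addrC.
move/(congr1 determinant); rewrite det_mulmx det_lblock det_ublock !det1 !det_scalar mul1r.
rewrite detM mulrC => ->; congr (_ * _).
by rewrite /char_poly /char_poly_mx map_mxM.
Qed.

Lemma char_poly_similar n (P A : 'M[F]_n) : P \in unitmx ->
  char_poly (P *m A *m invmx P) = char_poly A.
Proof.
move=> Pu; have := char_poly_mulC (P *m A) (invmx P).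
rewrite mulrC mulmxA mulVmx // mul1mx; apply: mulfI.
by rewrite monic_neq0 ?monicXn.
Qed.

End CharPoly.

Section Svd.
Variable R : realType.

Local Notation toC := (real_complex R).

(** If v is an eigenvector, the squared norm of its image under A is l times the
    squared norm of v. *)
Lemma gram_eigenvalue_ge0 m n (A : 'M[R]_(m, n)) (l : R[i]) :
  root (map_poly toC (char_poly (A^T *m A))) l -> 0 <= l.
Proof.
rewrite map_char_poly -eigenvalue_root_char map_mxM => /eigenvalueP[v vH vn0].
pose a := map_mx toC A.
pose sq k (x : 'rV[R[i]]_k) : R[i] := \sum_j x 0 j * (x 0 j)^*.
have sqE k (x : 'rV[R[i]]_k) : (x *m (map_mx Num.conj x)^T) 0 0 = sq k x.
  by rewrite mxE; apply: eq_bigr => j _; rewrite !mxE.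
have sq_ge0 k (x : 'rV[R[i]]_k) : 0 <= sq k x.
  by apply: sumr_ge0 => j _; apply: mul_conjC_ge0.
have aR : map_mx Num.conj a = a.
  by apply/matrixP => i j; rewrite !mxE; apply/conj_Creal/complex_realP; exists (A i j).
have E : sq m (v *m a^T) = l * sq n v.
  rewrite -!sqE map_mxM -map_trmx aR trmx_mul trmxK mulmxA -(mulmxA v).
  by rewrite /a map_trmx vH -scalemxAl mxE.
have vpos : 0 < sq n v.
  rewrite lt_def sq_ge0 andbT; apply: contraNneq vn0 => /eqP.
  rewrite psumr_eq0 => [/allP v0|j _]; last exact: mul_conjC_ge0.
  apply/eqP/rowP => j; rewrite mxE; apply/eqP.
  by have := v0 j (mem_index_enum _); rewrite mul_conjC_eq0.
by rewrite -(pmulr_lge0 _ vpos) -E.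
Qed.

(** The factorization over R[i] descends to R because all roots are real. *)
Lemma gram_char_poly m n (A : 'M[R]_(m, n)) :
  exists s : seq R, [/\ size s = n, all (fun x => 0 <= x) s
    & char_poly (A^T *m A) = \prod_(x <- s) ('X - x%:P)].
Proof.
set p := char_poly _.
have pm : p \is monic by apply: char_poly_monic.
have [r rE] := closed_field_poly_normal (map_poly toC p).
have {}rE : map_poly toC p = \prod_(z <- r) ('X - z%:P).
  by rewrite rE (monicP _) ?scale1r // map_monic.
have rge0 z : z \in r -> 0 <= z.
  move=> zr; apply: (@gram_eigenvalue_ge0 m n A).
  by rewrite rE root_prod_XsubC.
exists [seq complex.Re z | z <- r].
have rRe z : z \in r -> toC (complex.Re z) = z.
  move=> /rge0; case: z => a b; rewrite lecE /= => /andP[/eqP -> _].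
  reflexivity.
have pE : p = \prod_(x <- [seq complex.Re z | z <- r]) ('X - x%:P).
  apply: (@map_poly_inj _ _ toC); rewrite rE rmorph_prod big_map.
  rewrite big_seq [RHS]big_seq; apply: eq_bigr => z zr.
  by rewrite rmorphB /= map_polyX map_polyC /= rRe.
split=> //.
- have : size p = n.+1 by rewrite size_char_poly.
  by rewrite pE size_prod_XsubC => -[].
- apply/allP => x /mapP[z /rge0 + ->].
  by rewrite lecE /= => /andP[_].
Qed.

(** The eigenvalues of the smaller of the two Gram matrices are the squared
    singular values; [char_poly_mulC] transfers them to the other one. *)
Lemma svd_gram m n (A : 'M[R]_(m, n)) :
  exists s : seq R, singular_values A s /\
    char_poly (A *m A^T) = 'X^(m - minn m n) * \prod_(x <- s) ('X - (x ^+ 2)%:P).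
Proof.
pose srt (s : seq R) := sort >=%R [seq Num.sqrt x | x <- s].
have srtE s : all (fun x => 0 <= x) s ->
    [/\ size (srt s) = size s, sorted >=%R (srt s), all (fun x => 0 <= x) (srt s) &
      \prod_(x <- srt s) ('X - (x ^+ 2)%:P) = \prod_(x <- s) ('X - x%:P)].
  move=> s0; rewrite size_sort size_map all_sort; split=> //.
  - by apply: sort_sorted => x y; apply: ge_total.
  - by apply/allP => _ /mapP[x _ ->]; apply: sqrtr_ge0.
  - rewrite (perm_big [seq Num.sqrt x | x <- s]); last by rewrite perm_sort.
    rewrite big_map big_seq [RHS]big_seq; apply: eq_bigr => x xs.
    by rewrite sqr_sqrtr // (allP s0).
have Xn0 k : ('X^k : {poly R}) != 0 by rewrite monic_neq0 ?monicXn.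
have S := char_poly_mulC A A^T.
have [nm|mn] := leqP n m.
  have [s [sn s0 sE]] := gram_char_poly A.
  have [h1 h2 h3 h4] := srtE s s0.
  exists (srt s); rewrite /singular_values (minn_idPr nm) subnn expr0 mul1r h4.
  split; first by split=> //; rewrite h1.
  apply: (mulIf (Xn0 n)); rewrite S sE -mulrA [_ * 'X^n]mulrC mulrA -exprD.
  by rewrite subnK.
have mn' := ltnW mn.
have [s [sn s0 sE]] := gram_char_poly A^T.
rewrite trmxK in sE.
have [h1 h2 h3 h4] := srtE s s0.
exists (srt s); rewrite /singular_values (minn_idPl mn') subnn expr0 mul1r h4.
split=> //; split=> //; first by rewrite h1.
apply: (mulfI (Xn0 m)); rewrite -S sE mulrC mulrA -exprD.
by rewrite subnKC.
Qed.

End Svd.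

(** * The persistent Laplacian in a basis of relative cycles *)

Section ColumnGraph.
Variables (R : realType) (m n : nat) (B : 'M[R]_(m, n)) (I : {set 'I_m}).

Local Notation D := (outer_rows B I).
Local Notation adj := (col_adj B I).
Local Notation C0 := (zero_cols B I).

Lemma col_adj_sym : symmetric adj.
Proof. by move=> j k; apply: eq_existsb => i; rewrite andbC. Qed.

Lemma col_connect_sym : connect_sym adj.
Proof. exact: sym_connect_sym col_adj_sym. Qed.

Lemma col_adj_nz j k : adj j k -> (j \notin C0) && (k \notin C0).
Proof.
case/existsP => i /andP[nj nk]; rewrite !inE.
by apply/andP; split; apply/forallPn; exists i.
Qed.

Lemma col_connect_nz j k : connect adj j k -> (j \in C0) = (k \in C0).
Proof.
apply: (closed_connect (a := mem C0)) => x y /col_adj_nz /andP[nx ny] /=.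
by rewrite (negbTE nx) (negbTE ny).
Qed.

Lemma component_of C k : C \in components B I -> k \in C ->
  (k \notin C0) /\ C = [set l | connect adj k l].
Proof.
case/imsetP => j; rewrite inE => jnz -> ; rewrite inE => jk.
split; first by rewrite -(col_connect_nz jk).
by apply/setP => l; rewrite !inE (same_connect col_connect_sym jk).
Qed.

Lemma row_in_component C i k l : C \in components B I ->
  k \in C -> D i k != 0 -> D i l != 0 -> l \in C.
Proof.
move=> CC kC nk nl; have [_ ->] := component_of CC kC.
by rewrite inE connect1 //; apply/existsP; exists i; rewrite nk.
Qed.

Lemma component_nonempty C : C \in components B I -> exists k, k \in C.
Proof. by case/imsetP => j _ ->; exists j; rewrite inE. Qed.

Lemma component_ind C (P : 'I_n -> Prop) k : C \in components B I -> k \in C ->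
  P k -> (forall j l, j \in C -> l \in C -> adj j l -> P j -> P l) ->
  forall l, l \in C -> P l.
Proof.
move=> CC kC Pk step l; have [_ CE] := component_of CC kC.
rewrite CE inE => /connectP[p]; elim: p k kC Pk {CE} => [|x p IH] k kC Pk /=.
  by move=> _ ->.
case/andP=> kx px lE; have xC : x \in C.
  by have [_ ->] := component_of CC kC; rewrite inE connect1.
exact: (IH x xC (step _ _ kC xC kx Pk) px lE).
Qed.

End ColumnGraph.

Section PersistentLaplacian.
Variables (R : realType) (m n : nat) (B : 'M[R]_(m, n)) (I : {set 'I_m}).
Variables (wq : 'I_#|I| -> R) (w : 'I_n -> R).
Hypothesis B_sign : forall i j, B i j != 0 -> `|B i j| = 1.
Hypothesis B_row : forall i, (#|[set j | B i j != 0%R]| <= 2)%N.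
Hypothesis wq_gt0 : forall i, 0 < wq i.
Hypothesis w_gt0 : forall j, 0 < w j.
Variables (Cs : seq {set 'I_n}) (eps : {ffun 'I_n -> bool}).
Hypothesis reg : regulation B I Cs eps.

Local Notation D := (outer_rows B I).
Local Notation adj := (col_adj B I).
Local Notation C0 := (zero_cols B I).
Local Notation sg k := ((-1) ^+ eps k : R).

(** A zero column is a block with one element, so that the two kinds of columns
    of the persistent boundary matrix obey the same formulas. *)
Definition column_block (j : 'I_(#|C0| + size Cs)) : {set 'I_n} :=
  match split j with inl a => [set enum_val a] | inr b => component b end.

(** On a zero column [eps] is arbitrary. *)
Definition column_sign (k : 'I_n) : R := if k \in C0 then 1 else (-1) ^+ eps k.

Let Csu : uniq Cs.
Proof. by case: reg => /perm_uniq -> _; apply: enum_uniq. Qed.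

Let Cs_reg C : (C \in Cs) = (C \in components B I) && regulable B I C.
Proof. by case: reg => /perm_mem -> _; rewrite mem_enum inE. Qed.

Let Cs_eps C : C \in Cs -> regulates B I C eps.
Proof. by case: reg => _; apply. Qed.

Lemma component_Cs (b : 'I_(size Cs)) : component b \in Cs.
Proof. exact: mem_tnth. Qed.

Lemma component_comp (b : 'I_(size Cs)) : component b \in components B I.
Proof. by have := component_Cs b; rewrite Cs_reg => /andP[]. Qed.

Lemma column_sign_component (b : 'I_(size Cs)) k :
  k \in component b -> column_sign k = (-1) ^+ eps k.
Proof.
move=> kb; rewrite /column_sign.
by have [/negbTE -> _] := component_of (component_comp b) kb.
Qed.

Lemma sqr_column_sign k : column_sign k * column_sign k = 1.
Proof. by rewrite /column_sign; case: ifP; rewrite ?mulr1 // -expr2 sqrr_sign. Qed.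

Lemma pers_boundary_mxE i j :
  pers_boundary_mx B I Cs eps i j =
  \sum_(k in column_block j) inner_rows B I i k * column_sign k.
Proof.
rewrite mxE /column_block; case: (splitP j) => a _; rewrite mxE.
  by rewrite big_set1 /column_sign enum_valP mulr1.
by apply: eq_bigr => k /column_sign_component ->.
Qed.

Lemma pers_weightsE j :
  pers_weights B I w Cs 0 j = (\sum_(k in column_block j) (w k)^-1)^-1.
Proof.
rewrite mxE /column_block; case: (splitP j) => a _; rewrite mxE //.
by rewrite big_set1 invrK.
Qed.

Lemma column_block_nonempty j : exists k, k \in column_block j.
Proof.
rewrite /column_block; case: (splitP j) => a _; first by exists (enum_val a); rewrite inE.
exact: component_nonempty (component_comp a).
Qed.

Lemma column_block_inj j j' k :
  k \in column_block j -> k \in column_block j' -> j = j'.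
Proof.
have nzC (b : 'I_(size Cs)) (a : 'I_#|C0|) : enum_val a \notin component b.
  apply/negP => kb; have [] := component_of (component_comp b) kb.
  by rewrite enum_valP.
rewrite /column_block.
case: (splitP j) => a ja; case: (splitP j') => b jb; rewrite ?in_set1.
- by move=> /eqP -> /eqP /enum_val_inj ab; apply: val_inj; rewrite /= ja jb ab.
- by move=> /eqP ->; rewrite (negbTE (nzC _ _)).
- by move=> + /eqP kb; rewrite kb (negbTE (nzC _ _)).
move=> ka kb; have [_ Ea] := component_of (component_comp a) ka.
have [_ Eb] := component_of (component_comp b) kb.
have ab : val a = val b.
  apply/eqP; rewrite -(nth_uniq set0 (ltn_ord a) (ltn_ord b) Csu).
  have <- := tnth_nth set0 (in_tuple Cs) a.
  have <- := tnth_nth set0 (in_tuple Cs) b.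
  by rewrite -!/(component _) Ea Eb.
by apply: val_inj; rewrite /= ja jb ab.
Qed.

Lemma sum_column_block_gt0 j : 0 < \sum_(k in column_block j) (w k)^-1.
Proof.
have [k kj] := column_block_nonempty j; rewrite (bigD1 k) //=.
apply: ltr_pwDl; first by rewrite invr_gt0.
by apply: sumr_ge0 => l _; rewrite invr_ge0 ltW.
Qed.

Lemma pers_weights_gt0 j : 0 < pers_weights B I w Cs 0 j.
Proof. by rewrite pers_weightsE invr_gt0 sum_column_block_gt0. Qed.

Definition chain_basis : 'M[R]_(n, #|C0| + size Cs) :=
  \matrix_(k, j) if k \in column_block j then column_sign k else 0.

Lemma chain_basisP : pers_boundary_mx B I Cs eps = inner_rows B I *m chain_basis.
Proof.
apply/matrixP => i j; rewrite pers_boundary_mxE mxE big_mkcond /=.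
by apply: eq_bigr => k _; rewrite [chain_basis _ _]mxE; case: ifP; rewrite ?mulr0.
Qed.

Lemma row_le2 i (S : {set 'I_n}) :
  (#|[set k in S | D i k != 0%R]| <= 2)%N.
Proof.
apply: leq_trans (B_row (enum_val i)); apply: subset_leq_card.
by apply/subsetP => k; rewrite !inE mxE => /andP[].
Qed.

Lemma outer_sign i k : D i k != 0 -> `|D i k| = 1.
Proof. by rewrite mxE => /B_sign. Qed.

Lemma row_two i k l x : k != l -> D i k != 0 -> D i l != 0 ->
  D i x != 0 -> x = k \/ x = l.
Proof.
move=> kl nk nl nx; case: (eqVneq x k) => [|xk]; first by left.
case: (eqVneq x l) => [|xl]; first by right.
exfalso; have := row_le2 i setT; rewrite leqNgt => /negP; apply.
have <- : #|x |: (k |: [set l])| = 3%N by rewrite !cardsU1 cards1 !inE negb_or xk xl kl.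
by apply: subset_leq_card; apply/subsetP => y; rewrite !inE; case/or3P => /eqP ->.
Qed.

(** A row meeting a component in two columns vanishes outside them, so the
    corresponding equation involves these two coordinates only. *)
Lemma row_equation C i k l (c : 'cV[R]_n) : C \in components B I ->
  k \in C -> k != l -> D i k != 0 -> D i l != 0 ->
  (D *m c) i 0 = D i k * c k 0 + D i l * c l 0.
Proof.
move=> CC kC kl nk nl; rewrite mxE (bigD1 k) //= (bigD1 l) 1?eq_sym //=.
rewrite big1 ?addr0 // => j /andP[jk jl].
suff /eqP-> : D i j == 0 by rewrite mul0r.
apply: contraT => nj; case: (row_two kl nk nl nj) => E.
  by rewrite E eqxx in jk.
by rewrite E eqxx in jl.
Qed.

(** With at most two entries in a row, the three clauses of [regulates] amount to
    one cancellation. *)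
Lemma regulates_pair C (e : {ffun 'I_n -> bool}) i k :
  C \in components B I -> regulates B I C e -> k \in C -> D i k != 0 ->
  exists2 l, [/\ l \in C, k != l & D i l != 0] &
    D i k * (-1) ^+ e k + D i l * (-1) ^+ e l = 0.
Proof.
move=> CC /forallP/(_ i)/implyP H kC nk.
have /H/and3P[_ /exists_inP[p pC /eqP p1] /exists_inP[r rC /eqP r1]] :
  [exists k0 in C, D i k0 != 0] by apply/exists_inP; exists k.
have pr : p != r.
  apply/negP => /eqP prE; move: p1; rewrite prE r1 => /eqP.
  by rewrite -subr_eq0 -opprD oppr_eq0 -mulr2n pnatr_eq0.
have np : D i p != 0 by apply/negP => /eqP E; move: p1; rewrite E mul0r => /eqP; rewrite eq_sym oner_eq0.
have nr : D i r != 0.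
  apply/negP => /eqP E; move: r1; rewrite E mul0r => /eqP.
  by rewrite eq_sym oppr_eq0 oner_eq0.
case: (row_two pr np nr nk) => ->; first by exists r; rewrite ?p1 ?r1 ?subrr.
by exists p; rewrite 1?eq_sym // p1 r1 addrC subrr.
Qed.

(** In a regulated component the two entries of a row cancel. *)
Lemma outer_chain_basis : D *m chain_basis = 0.
Proof.
apply/matrixP => i j; rewrite !mxE.
under eq_bigr do rewrite [chain_basis _ _]mxE.
have E : \sum_k D i k * (if k \in column_block j then column_sign k else 0) =
   \sum_(k in column_block j) D i k * column_sign k.
  by rewrite [RHS]big_mkcond; apply: eq_bigr => k _; case: ifP; rewrite ?mulr0.
rewrite {}E /column_block; case: (splitP j) => a _.
  rewrite big_set1; have := enum_valP a; rewrite inE => /forallP/(_ i)/eqP ->.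
  by rewrite mul0r.
have CC := component_comp a; set C := component a in CC *.
have [/existsP[k /andP[kC nk]]|/existsPn no] := boolP [exists k, (k \in C) && (D i k != 0)].
  have [l [lC kl nl] E] := regulates_pair CC (Cs_eps (component_Cs a)) kC nk.
  rewrite (bigD1 k) //= (bigD1 l) /=; last by rewrite lC eq_sym.
  rewrite big1 ?addr0 => [|x /andP[/andP[xC xk] xl]].
    by rewrite !(@column_sign_component a).
  suff /eqP -> : D i x == 0 by rewrite mul0r.
  apply: contraT => nx; case: (row_two kl nk nl nx) => /eqP.
    by rewrite (negbTE xk).
  by rewrite (negbTE xl).
rewrite big1 // => k kC; have := no k; rewrite kC negbK => /eqP ->.
by rewrite mul0r.
Qed.

(** A cycle relative to the outer rows that does not vanish on a component has
    constant absolute value there, and its signs regulate the component. *)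
Lemma kernel_regulable C (c : 'cV[R]_n) k : C \in components B I ->
  D *m c = 0 -> k \in C -> c k 0 != 0 -> regulable B I C.
Proof.
move=> CC Dc kC ck.
have other i j : j \in C -> D i j != 0 -> c j 0 != 0 ->
    exists2 l, [/\ l \in C, j != l & D i l != 0] & D i j * c j 0 + D i l * c l 0 = 0.
  move=> jC nj cj.
  have [l /andP[lj nl]|no] := pickP [pred l | (l != j) && (D i l != 0)].
    exists l; first by split=> //; [exact: (row_in_component CC jC nj nl) | rewrite eq_sym].
    by rewrite -(row_equation c CC jC _ nj nl) 1?eq_sym // Dc mxE.
  have : (D *m c) i 0 = D i j * c j 0.
    rewrite mxE (bigD1 j) //= big1 ?addr0 // => l lj.
    by have := no l; rewrite /= lj /= => /negbFE/eqP ->; rewrite mul0r.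
  by rewrite Dc mxE => /esym/eqP; rewrite mulf_eq0 (negbTE nj) (negbTE cj).
have abs_c l : l \in C -> `|c l 0| = `|c k 0|.
  move: l; apply: (component_ind (P := fun l => `|c l 0| = `|c k 0|) CC kC) => // j l jC lC /existsP[i /andP[nj nl]] <-.
  have [<- //|jl] := eqVneq j l.
  have := row_equation c CC jC jl nj nl.
  rewrite Dc mxE => /esym/eqP; rewrite addr_eq0 => /eqP E.
  have := congr1 Num.norm E.
  by rewrite normrN !normrM !outer_sign // !mul1r => ->.
have cn0 l : l \in C -> c l 0 != 0 by move=> lC; rewrite -normr_eq0 abs_c // normr_eq0.
(* the signs of the coordinates regulate the component *)
pose e := [ffun l => c l 0 < 0].
have eE l : l \in C -> (-1) ^+ e l = c l 0 / `|c k 0|.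
  move=> lC; rewrite -(abs_c l lC) ffunE; case: ltrgt0P (cn0 l lC) => // cl _.
    by rewrite expr0 divff // gt_eqF.
  by rewrite expr1 invrN mulrN divff // lt_eqF.
apply/existsP; exists e; apply/forallP => i; apply/implyP => /exists_inP[j jC nj].
have [l [lC jl nl] E] := other i j jC nj (cn0 j jC).
have E' : D i j * (-1) ^+ e j + D i l * (-1) ^+ e l = 0.
  by rewrite !eE // !mulrA -mulrDl E mul0r.
have absj : `|D i j * (-1) ^+ e j| == 1 by rewrite normrM outer_sign // normr_sign mulr1.
apply/and3P; split.
- have -> : [set x in C | D i x != 0] = [set j; l].
    apply/setP => x; rewrite !inE; apply/andP/orP.
      by case=> xC nx; case: (row_two jl nj nl nx) => ->; [left|right].
    by case=> /eqP ->.
  by rewrite cards2 jl.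
- move: absj; rewrite eqr_norml ler01 andbT => /orP[|] /eqP h.
    by apply/exists_inP; exists j => //; rewrite h.
  by apply/exists_inP; exists l => //; move/eqP: E'; rewrite h addrC subr_eq0.
move: absj; rewrite eqr_norml ler01 andbT => /orP[|] /eqP h; last first.
  by apply/exists_inP; exists j => //; rewrite h.
by apply/exists_inP; exists l => //; move/eqP: E'; rewrite h addrC addr_eq0.
Qed.

(** Twisted by the signs, the equation of a row identifies two coordinates. *)
Lemma kernel_constant C (c : 'cV[R]_n) k l : C \in Cs -> D *m c = 0 ->
  k \in C -> l \in C -> c k 0 * (-1) ^+ eps k = c l 0 * (-1) ^+ eps l.
Proof.
move=> CCs Dc kC; have /andP[CC _] : (C \in components B I) && regulable B I C by rewrite -Cs_reg.
move: l; apply: (component_ind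
  (P := fun l => c k 0 * (-1) ^+ eps k = c l 0 * (-1) ^+ eps l) CC kC) => // j l jC lC /existsP[i /andP[nj nl]] ->.
have [<- //|jl] := eqVneq j l.
have := row_equation c CC jC jl nj nl; rewrite Dc mxE => E1.
have [l' [lC' jl' nl'] E2] := regulates_pair CC (Cs_eps CCs) jC nj.
have ll' : l' = l.
  by case: (row_two jl nj nl nl') => // ll; rewrite ll eqxx in jl'.
rewrite {l'}ll' in lC' jl' nl' E2.
have sgsg x : (-1 : R) ^+ eps x * (-1) ^+ eps x = 1 by rewrite -expr2 sqrr_sign.
have E1' : (D i j * (-1) ^+ eps j) * (c j 0 * (-1) ^+ eps j) +
           (D i l * (-1) ^+ eps l) * (c l 0 * (-1) ^+ eps l) = 0.
  rewrite mulrACA sgsg mulr1 [in X in _ + X]mulrACA sgsg mulr1.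
  by rewrite -E1.
move/eqP: E2; rewrite addrC addr_eq0 => /eqP E2.
move/eqP: E1'; rewrite E2 mulNr subr_eq0 => /eqP; apply: mulfI.
by rewrite mulf_neq0 ?signr_eq0.
Qed.

(** A relative cycle vanishes on the components that are not regulable, and on
    the others it is a multiple of the signs. *)
Lemma kernel_chain_basis (c : 'cV[R]_n) : D *m c = 0 -> exists y, c = chain_basis *m y.
Proof.
move=> Dc.
have pk j : {k | k \in column_block j}.
  by apply: sigW; case: (column_block_nonempty j) => k kj; exists k.
(* the coordinate on a block can be read at any of its elements *)
pose y : 'cV[R]_(#|C0| + size Cs) := \col_j (c (sval (pk j)) 0 * column_sign (sval (pk j))).
exists y; apply/colP => k; rewrite mxE.
under eq_bigr do rewrite [chain_basis _ _]mxE.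
have one j : k \in column_block j -> c k 0 = column_sign k * y j 0.
  move=> kj; suff E : c k 0 * column_sign k = y j 0.
    by rewrite -E mulrCA sqr_column_sign mulr1.
  rewrite mxE; case: (pk j) => l /=; move: kj; rewrite /column_block.
  case: (splitP j) => a _; rewrite ?in_set1.
    by move=> /eqP -> /eqP ->.
  move=> ka la; rewrite !(@column_sign_component a) //.
  exact: kernel_constant (component_Cs a) Dc ka la.
have [/existsP[j kj]|/existsPn no] := boolP [exists j, k \in column_block j].
  rewrite (bigD1 j) //= kj big1 ?addr0 ?(one _ kj) // => l lj.
  case: ifP => kl; last by rewrite mul0r.
  by rewrite (column_block_inj kl kj) eqxx in lj.
rewrite big1 => [|j _]; last by rewrite (negbTE (no j)) mul0r.
apply/eqP; apply: contraT => ck.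
have [k0|k0] := boolP (k \in C0).
  have := no (lshift _ (enum_rank_in k0 k)); rewrite /column_block (unsplitK (inl _)).
  by rewrite inE enum_rankK_in ?eqxx.
pose C := [set l | connect adj k l].
have CC : C \in components B I by apply/imsetP; exists k; rewrite // inE.
have kC : k \in C by rewrite inE.
have CCs : C \in Cs by rewrite Cs_reg CC (kernel_regulable CC Dc kC ck).
have iC : (index C Cs < size Cs)%N by rewrite index_mem.
have := no (rshift _ (Ordinal iC)); rewrite /column_block (unsplitK (inr _)).
by rewrite /component (tnth_nth set0) /= nth_index // kC.
Qed.

(** The relative chains are the inverse image of a coordinate subspace, whose
    equations are the outer rows. *)
Lemma pers_chainsP (c : 'cV[R]_n) :
  (c \in pers_chains B I) = (D *m c == 0).
Proof.
rewrite -memv_preim lfunE /=; set x := B *m c.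
have xE : (D *m c == 0) = [forall i, (i \notin I) ==> (x i 0 == 0)].
  apply/eqP/forallP => [Dc i|h].
    apply/implyP => iI; have iI' : i \in ~: I by rewrite inE.
    have /matrixP/(_ (enum_rank_in iI' i) 0) := Dc; rewrite !mxE.
    under eq_bigr do rewrite mxE enum_rankK_in //.
    by move/eqP.
  apply/colP => i; rewrite !mxE.
  have := enum_valP i; rewrite inE => iI.
  have /eqP := implyP (h (enum_val i)) iI; rewrite mxE => xi; rewrite -[RHS]xi.
  by apply: eq_bigr => j _; rewrite mxE.
rewrite xE; apply/idP/forallP => [|h].
  move=> xs i; apply/implyP => iI; clear xE; move: x xs => x.
  set s := [seq _ | _ <- _] => xs.
  suff : (<<s>> <= lker (linfun (row i : 'cV[R]_m -> 'M[R]_1)))%VS.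
    move/subvP/(_ _ xs); rewrite memv_ker lfunE /= => /eqP/matrixP/(_ 0 0).
    by rewrite !mxE => /eqP.
  apply/span_subvP => _ /mapP[l lI ->]; rewrite memv_ker lfunE /=.
  apply/eqP/matrixP => a b; rewrite !ord1 !mxE eqxx andbT; case: eqP => // E.
  by rewrite mem_enum -E (negbTE iI) in lI.
have -> : x = \sum_(i in I) x i 0 *: delta_mx i 0.
  rewrite {1}(matrix_sum_delta x) [RHS]big_mkcond; apply: eq_bigr => i _.
  rewrite big_ord_recl big_ord0 addr0; case: ifP => // iI.
  by have := h i; rewrite iI /= => /eqP ->; rewrite scale0r.
apply: memv_suml => i iI; apply: memvZ; apply: memv_span.
by apply/mapP; exists i; rewrite // mem_enum.
Qed.

Local Notation P := chain_basis.
Local Notation Bp := (pers_boundary_mx B I Cs eps).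
Local Notation pw := (pers_weights B I w Cs).

Lemma chain_ipE p (u : 'I_p -> R) (x y : 'cV[R]_p) :
  chain_ip u x y = (x^T *m (diag_mx (\row_i (u i)^-1) *m y)) 0 0.
Proof.
rewrite mxE; apply: eq_bigr => i _; rewrite mul_diag_mx !mxE.
by rewrite mulrCA mulrA.
Qed.

(** Distinct blocks are disjoint. *)
Lemma chain_basis_gram :
  P^T *m (diag_mx (\row_i (w i)^-1) *m P) = diag_mx (map_mx (fun x => x^-1) pw).
Proof.
apply/matrixP => i j; rewrite [RHS]mxE [map_mx _ _ _ _]mxE pers_weightsE invrK [LHS]mxE.
have [<-|ij] := eqVneq i j.
  rewrite mulr1n [RHS]big_mkcond; apply: eq_bigr => k _.
  rewrite mxE mul_diag_mx !mxE; case: ifP => _; last by rewrite mul0r.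
  by rewrite mulrCA sqr_column_sign mulr1.
rewrite mulr0n big1 // => k _; rewrite mxE mul_diag_mx !mxE.
case: ifP => [ki|_]; last by rewrite mul0r.
case: ifP => [kj|_]; last by rewrite !mulr0.
by rewrite (column_block_inj ki kj) eqxx in ij.
Qed.

Lemma chain_ip_basis (y z : 'cV[R]_(#|C0| + size Cs)) :
  chain_ip w (P *m y) (P *m z) = (y^T *m (diag_mx (map_mx (fun x => x^-1) pw) *m z)) 0 0.
Proof. by rewrite chain_ipE -chain_basis_gram trmx_mul !mulmxA. Qed.

Lemma chain_ip_eq0 (x : 'cV[R]_n) : chain_ip w x x = 0 -> x = 0.
Proof.
move=> /eqP; rewrite psumr_eq0 => [/allP h|i _]; last first.
  by rewrite -mulrA; apply: mulr_ge0; [rewrite invr_ge0 ltW | rewrite -expr2 sqr_ge0].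
apply/colP => i; have /eqP := h i (mem_index_enum _).
rewrite -mulrA => /eqP; rewrite mulf_eq0 invr_eq0 (gt_eqF (w_gt0 i)) /= -expr2.
by rewrite sqrf_eq0 mxE => /eqP.
Qed.

Lemma pers_boundaryE (c : subvs_of (pers_chains B I)) :
  pers_boundary B I c = inner_rows B I *m vsval c.
Proof.
pose f := rowsub (fun i : 'I_#|I| => enum_val i) \o (mulmx B \o @vsval _ _ (pers_chains B I)).
have -> : pers_boundary B I c = linfun f c by [].
by rewrite lfunE /f /= -mul_rowsub_mx.
Qed.

(** The adjoint of the boundary map, in the coordinates of [chain_basis]. *)
Definition laplacian_factor : 'M[R]_(#|C0| + size Cs, #|I|) :=
  diag_mx pw *m (Bp^T *m diag_mx (\row_i (wq i)^-1)).

Let dual y : 'cV[R]_n := P *m (laplacian_factor *m y).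

Let dual_chain y : dual y \in pers_chains B I.
Proof. by rewrite pers_chainsP /dual mulmxA outer_chain_basis mul0mx. Qed.

Let dualP (x : subvs_of (pers_chains B I)) y :
  chain_ip wq (pers_boundary B I x) y = chain_ip w (vsval x) (dual y).
Proof.
have := subvsP x; rewrite pers_chainsP => /eqP /kernel_chain_basis[z xE].
rewrite pers_boundaryE xE chain_ip_basis chain_ipE mulmxA -chain_basisP /laplacian_factor.
rewrite trmx_mul -!mulmxA; congr ((_ *m _) _ _).
have pwV : diag_mx (map_mx (fun x => x^-1) pw) *m diag_mx pw = 1%:M.
  apply/matrixP => i j; rewrite mul_diag_mx !mxE; case: eqP => [->|_]; rewrite ?mulr0 //.
  have := pers_weights_gt0 j; rewrite mxE => h.
  by rewrite !mulr1n mulVf // gt_eqF.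
by rewrite (mulmxA (diag_mx (map_mx _ pw))) pwV mul1mx.
Qed.

(** [adjoint] chooses some map satisfying the adjunction. One exists by [dualP],
    and the difference of two values of such maps has norm zero. *)
Lemma pers_coboundaryE y : vsval (pers_coboundary B wq w y) = dual y.
Proof.
rewrite /pers_coboundary /adjoint.
set S := (fun g : 'Hom(_, _) => _).
have [g Sg] : exists g, S g.
  exists (linfun (vsproj (pers_chains B I) \o mulmx (P *m laplacian_factor))).
  move=> x z; rewrite dualP lfunE /= vsprojK -mulmxA //.
  exact: dual_chain.
have := classical_sets.xgetI 0 Sg; set h := classical_sets.xget _ _ => Sh.
have [d dE] : exists d : subvs_of (pers_chains B I), vsval d = vsval (h y) - dual y.
  by exists (h y - vsproj (pers_chains B I) (dual y)); rewrite linearB /= vsprojK.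
apply/eqP; rewrite -subr_eq0 -dE; apply/eqP/chain_ip_eq0.
have := Sh d y; rewrite dualP => E.
rewrite {2}dE /chain_ip.
under eq_bigr do rewrite [(_ - _ : 'cV_n) _ _]mxE [(- _ : 'cV_n) _ _]mxE mulrBr.
by rewrite sumrB; apply/eqP; rewrite subr_eq0 eq_sym; apply/eqP.
Qed.

Lemma up_pers_laplacianE : up_pers_laplacian B wq w = Bp *m laplacian_factor.
Proof.
apply/matrixP => i j; rewrite mxE pers_boundaryE pers_coboundaryE /dual.
by rewrite mulmxA -chain_basisP mulmxA -colE mxE.
Qed.

(** The two matrices are conjugate by the square roots of the weights of the
    inner simplices. *)
Theorem char_poly_up_pers_laplacian :
  char_poly (up_pers_laplacian B wq w) =
  char_poly (pers_mx B wq w Cs eps *m (pers_mx B wq w Cs eps)^T).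
Proof.
pose S : 'M[R]_#|I| := diag_mx (\row_i Num.sqrt (wq i)).
pose T : 'M[R]_#|I| := diag_mx (\row_i (Num.sqrt (wq i))^-1).
have sq0 i : Num.sqrt (wq i) != 0 by rewrite gt_eqF // sqrtr_gt0.
have ST : S *m T = 1%:M.
  apply/matrixP => i j; rewrite mul_diag_mx !mxE; case: eqP => [->|_]; rewrite ?mulr0 //.
  by rewrite mulr1n divff.
have [Su _] := mulmx1_unit ST.
have TE : invmx S = T.
  by rewrite -[invmx S]mulmx1 -ST mulmxA mulVmx // mul1mx.
have TT : T *m T = diag_mx (\row_i (wq i)^-1).
  apply/matrixP => i j; rewrite mul_diag_mx !mxE; case: eqP => [->|_]; rewrite ?mulr0 //.
  by rewrite !mulr1n -invfM -expr2 sqr_sqrtr // ltW.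
have VV : diag_mx (map_mx Num.sqrt pw) *m diag_mx (map_mx Num.sqrt pw) = diag_mx pw.
  apply/matrixP => i j; rewrite mul_diag_mx !mxE; case: eqP => [->|_]; rewrite ?mulr0 //.
  rewrite !mulr1n -expr2; have := pers_weights_gt0 j; rewrite mxE => /ltW h.
  by rewrite sqr_sqrtr.
rewrite up_pers_laplacianE -[RHS](char_poly_similar _ Su) TE; congr char_poly.
rewrite /pers_mx -/T /laplacian_factor -TT -VV.
rewrite trmx_mul trmx_mul !tr_diag_mx !mulmxA ST mul1mx.
by [].
Qed.

End PersistentLaplacian.

(** * Lanczos vectors and Ritz values *)

Section DotProduct.
Variable R : realType.

Definition dot p (y z : 'cV[R]_p) : R := (y^T *m z) 0 0.

Lemma dotC p (y z : 'cV[R]_p) : dot y z = dot z y.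
Proof. by rewrite /dot !mxE; apply: eq_bigr => i _; rewrite !mxE mulrC. Qed.

Lemma dotDr p (y z t : 'cV[R]_p) : dot y (z + t) = dot y z + dot y t.
Proof. by rewrite /dot mulmxDr mxE. Qed.

Lemma dotZr p c (y z : 'cV[R]_p) : dot y (c *: z) = c * dot y z.
Proof. by rewrite /dot -scalemxAr mxE. Qed.

Lemma dotDl p (y z t : 'cV[R]_p) : dot (z + t) y = dot z y + dot t y.
Proof. by rewrite !(dotC _ y) dotDr. Qed.

Lemma dotZl p c (y z : 'cV[R]_p) : dot (c *: z) y = c * dot z y.
Proof. by rewrite !(dotC _ y) dotZr. Qed.

Lemma dotr0 p (y : 'cV[R]_p) : dot y 0 = 0.
Proof. by rewrite /dot mulmx0 mxE. Qed.

Lemma dot_mulmx m n (A : 'M[R]_(m, n)) (y : 'cV[R]_m) (z : 'cV[R]_n) : dot y (A *m z) = dot (A^T *m y) z.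
Proof. by rewrite /dot trmx_mul trmxK mulmxA. Qed.

Lemma dot_sum p (y : 'cV[R]_p) : dot y y = \sum_i y i 0 ^+ 2.
Proof. by rewrite /dot mxE; apply: eq_bigr => i _; rewrite mxE expr2. Qed.

Lemma sqr_norm2 p (y : 'cV[R]_p) : norm2 y ^+ 2 = dot y y.
Proof. by rewrite dot_sum sqr_sqrtr // sumr_ge0 // => i _; apply: sqr_ge0. Qed.

Lemma norm2_eq0 p (y : 'cV[R]_p) : norm2 y = 0 -> y = 0.
Proof.
move=> y0; have := sqr_norm2 y; rewrite y0 expr0n /= dot_sum => /esym/eqP.
rewrite psumr_eq0 => [/allP h|i _]; last exact: sqr_ge0.
by apply/colP => i; have /eqP := h i (mem_index_enum _); rewrite mxE; move/eqP; rewrite sqrf_eq0 => /eqP.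
Qed.

(** This also holds for a zero norm, since the vector then vanishes: the
    relations between Lanczos vectors survive a breakdown. *)
Lemma norm2_scale p (y : 'cV[R]_p) : norm2 y *: ((norm2 y)^-1 *: y) = y.
Proof.
have [y0|y0] := eqVneq (norm2 y) 0; first by rewrite y0 scale0r (norm2_eq0 y0).
by rewrite scalerA divff // scale1r.
Qed.

Lemma norm2_unit p (y : 'cV[R]_p) : norm2 y != 0 ->
  dot ((norm2 y)^-1 *: y) ((norm2 y)^-1 *: y) = 1.
Proof.
move=> y0; rewrite dotZl dotZr -sqr_norm2 expr2 mulrA -invfM -expr2.
by rewrite mulVf // expf_neq0.
Qed.

End DotProduct.

Section LanczosRecurrence.
Variables (R : realType) (m n : nat) (A : 'M[R]_(m, n)) (x : 'cV[R]_n).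
Variables (U : nat -> 'cV[R]_m) (V : nat -> 'cV[R]_n) (a b : nat -> R).
Hypothesis V0 : V 0%N = x.
Hypothesis b0 : b 0%N = 0.
Hypothesis gkl_mulmx : forall j, A *m V j = a j.+1 *: U j.+1 + b j *: U j.
Hypothesis gkl_mulmx_tr :
  forall j, A^T *m U j.+1 = b j.+1 *: V j.+1 + a j.+1 *: V j.
Hypothesis gkl_u_unit : forall j, a j.+1 != 0 -> dot (U j.+1) (U j.+1) = 1.
Hypothesis gkl_v_unit : forall j, b j.+1 != 0 -> dot (V j.+1) (V j.+1) = 1.
Hypothesis gkl_u0 : forall j, a j.+1 = 0 -> U j.+1 = 0.

Variable k : nat.
Hypothesis x_unit : dot x x = 1.
Hypothesis nobreak : forall j, (0 < j < k)%N -> a j != 0 /\ b j != 0.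

(** Move A to the other side in the product of [A *m V j] with an earlier left
    vector, and expand with the second recurrence. *)
Lemma gkl_u_ortho_step j :
  (forall i l, (i <= j)%N -> (l <= j)%N -> dot (V i) (V l) = (i == l)%:R) ->
  (forall i, (0 < i <= j)%N -> dot (U i) (U j) = (i == j)%:R) ->
  forall i, (0 < i <= j)%N -> dot (U i) (U j.+1) = 0.
Proof.
move=> hV hU [//|i] ij; have [a0|a0] := eqVneq (a j.+1) 0.
  by rewrite (gkl_u0 a0) dotr0.
apply: (mulfI a0); rewrite mulr0 -dotZr.
have -> : a j.+1 *: U j.+1 = A *m V j + (- b j) *: U j.
  by rewrite gkl_mulmx scaleNr addrK.
rewrite dotDr dotZr dot_mulmx gkl_mulmx_tr dotDl !dotZl hU //.
have /= ij' := ij.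
rewrite !hV // 1?ltnW //.
have -> : (i == j) = false by rewrite ltn_eqF.
rewrite mulr0 addr0; case: eqP => [->|_]; last by rewrite !mulr0 addr0.
by rewrite !mulr1 subrr.
Qed.

(** The two families must be built together: the orthogonality of a new vector
    of one of them uses the previous vectors of the other. *)
Lemma gkl_orthonormal j : (j < k)%N ->
  (forall i l, (i <= j)%N -> (l <= j)%N -> dot (V i) (V l) = (i == l)%:R) /\
  (forall i l, (0 < i <= j)%N -> (0 < l <= j)%N -> dot (U i) (U l) = (i == l)%:R).
Proof.
elim: j => [_|j IH jk].
  by split=> [[|i] [|l]|[|i]] //; rewrite V0 x_unit.
have [hV hU] := IH (ltnW jk); have [a0 bn0] := nobreak (j := j.+1) jk.
have uu : dot (U j.+1) (U j.+1) = 1 by apply: gkl_u_unit.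
have uo i : (0 < i <= j)%N -> dot (U i) (U j.+1) = 0.
  by apply: gkl_u_ortho_step => // i' ij'; apply: hU => //; lia.
have hU' i l : (0 < i <= j.+1)%N -> (0 < l <= j.+1)%N -> dot (U i) (U l) = (i == l)%:R.
  move=> hi hl; have [ij|ij] := eqVneq i j.+1; have [lj|lj] := eqVneq l j.+1.
  - by rewrite ij lj eqxx uu.
  - by rewrite ij dotC uo; [rewrite eq_sym (negbTE lj)|lia].
  - by rewrite lj uo; [rewrite (negbTE ij)|lia].
  - by apply: hU; lia.
have vo i : (i <= j)%N -> dot (V i) (V j.+1) = 0.
  move=> ij; apply: (mulfI bn0); rewrite mulr0 -dotZr.
  have -> : b j.+1 *: V j.+1 = A^T *m U j.+1 + (- a j.+1) *: V j.
    by rewrite gkl_mulmx_tr scaleNr addrK.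
  rewrite dotDr dotZr hV // dotC -dot_mulmx gkl_mulmx dotDr !dotZr.
  have [E|ne] := eqVneq i j.
    rewrite E uu mulr1 mulr1; case: (j) uo => [|j'] uo; first by rewrite b0 mul0r addr0 subrr.
    by rewrite dotC uo ?mulr0 ?addr0 ?subrr //; lia.
  rewrite mulr0 addr0 dotC uo; last by lia.
  rewrite mulr0 add0r; case: (i) ij ne => [|i'] ij ne; first by rewrite b0 mul0r.
  by rewrite dotC uo ?mulr0 //; lia.
have vv : dot (V j.+1) (V j.+1) = 1 by apply: gkl_v_unit.
split=> // i l hi hl; have [ij|ij] := eqVneq i j.+1; have [lj|lj] := eqVneq l j.+1.
- by rewrite ij lj eqxx vv.
- by rewrite ij dotC vo; [rewrite eq_sym (negbTE lj)|lia].
- by rewrite lj vo; [rewrite (negbTE ij)|lia].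
- by apply: hV; lia.
Qed.

Hypothesis k_gt0 : (0 < k)%N.

Lemma gkl_v_ortho i l : (i < k)%N -> (l < k)%N -> dot (V i) (V l) = (i == l)%:R.
Proof.
case: k k_gt0 gkl_orthonormal => // k' _ h ik lk.
by have [hV _] := h k' (ltnSn _); apply: hV.
Qed.

(** Only the last left vector can vanish, namely when alpha_k = 0. *)
Lemma gkl_u_ortho i l : (i < k)%N -> (l < k)%N ->
  dot (U i.+1) (U l.+1) = ((i == l) && ((i.+1 < k)%N || (a k != 0)))%:R.
Proof.
case: k k_gt0 gkl_orthonormal nobreak => // k' _ h nb ik lk.
have [hV hU] := h k' (ltnSn _).
have last i' : (0 < i' <= k')%N -> dot (U i') (U k'.+1) = 0.
  by apply: gkl_u_ortho_step => // i2 h2; apply: hU => //; lia.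
have [ik'|ik'] := eqVneq i k'; have [lk'|lk'] := eqVneq l k'.
- rewrite ik' lk' ltnn eqxx /=; have [a0|a0] := eqVneq (a k'.+1) 0.
    by rewrite (gkl_u0 a0) dotr0.
  by rewrite gkl_u_unit.
- by rewrite ik' dotC last; [rewrite eq_sym (negbTE lk')|lia].
- by rewrite lk' last; [rewrite (negbTE ik')|lia].
- by rewrite hU ?eqSS; [have -> : (i.+1 < k'.+1)%N by lia|lia|lia]; rewrite andbT.
Qed.

Definition krylov_basis : 'M[R]_(n, k) := \matrix_(i, j) V j i 0.

Lemma krylov_basis_unit : krylov_basis^T *m krylov_basis = 1%:M.
Proof.
apply/matrixP => i j; rewrite [RHS]mxE -[i == j]/(i == j :> nat) -gkl_v_ortho //.
by rewrite /dot !mxE; apply: eq_bigr => l _; rewrite !mxE.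
Qed.

Definition gkl_bidiag_of : 'M[R]_k := bidiag_mx k (fun i => a i.+1) (fun i => b i.+1).

Definition left_basis : 'M[R]_(m, k) := \matrix_(i, j) U j.+1 i 0.

Lemma mulmx_krylov_basis : A *m krylov_basis = left_basis *m gkl_bidiag_of.
Proof.
apply/matrixP => i j.
have -> : (A *m krylov_basis) i j = (A *m V j) i 0.
  by rewrite !mxE; apply: eq_bigr => l _; rewrite !mxE.
rewrite gkl_mulmx !mxE (bigD1 j) //= !mxE eqxx [X in X + _ = _]mulrC; congr (_ + _).
case: j => -[|j] jk /=.
  rewrite b0 mul0r big1 // => l lj; rewrite !mxE /=.
  have -> : (0%N == l) = false by apply/negbTE; rewrite eq_sym.
  by rewrite mulr0.
have jk' := ltnW jk.
rewrite (bigD1 (Ordinal jk')) /=; last by rewrite -val_eqE /= ltn_eqF.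
rewrite !mxE /= eqxx gtn_eqF // mulrC big1 ?addr0 // => l /andP[l1 l2]; rewrite !mxE.
have -> : (j.+1 == l) = false by apply/negbTE; rewrite eq_sym.
have -> : (j.+1 == l.+1) = false by apply/negbTE; rewrite eqSS eq_sym.
by rewrite mulr0.
Qed.

(** If the last left vector vanishes, the left vectors are not orthonormal, but
    then the last row of the bidiagonal matrix vanishes as well. *)
Lemma compression_krylov_basis :
  krylov_basis^T *m (A^T *m A) *m krylov_basis = gkl_bidiag_of^T *m gkl_bidiag_of.
Proof.
have -> : krylov_basis^T *m (A^T *m A) *m krylov_basis =
   (A *m krylov_basis)^T *m (A *m krylov_basis) by rewrite trmx_mul !mulmxA.
rewrite mulmx_krylov_basis trmx_mul -mulmxA; congr (_ *m _).
rewrite mulmxA; apply/matrixP => i j; rewrite mxE (bigD1 i) //= big1 => [|l li].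
  have -> : (left_basis^T *m left_basis) i i = dot (U i.+1) (U i.+1).
    by rewrite /dot !mxE; apply: eq_bigr => l _; rewrite !mxE.
  rewrite gkl_u_ortho // eqxx addr0.
  have [ik|ik] := ltnP i.+1 k; first by rewrite mul1r.
  have ik' : i.+1 = k by apply/eqP; rewrite eqn_leq ik ltn_ord.
  have [a0|a0] := eqVneq (a k) 0; last by rewrite mul1r.
  rewrite /= mul0r !mxE; case: eqP => [_|_]; first by rewrite ik' a0.
  by case: eqP => // ji; have := ltn_ord j; rewrite ji ik' ltnn.
have -> : (left_basis^T *m left_basis) i l = dot (U i.+1) (U l.+1).
  by rewrite /dot !mxE; apply: eq_bigr => l' _; rewrite !mxE.
rewrite gkl_u_ortho //.
have -> : (i == l :> nat) = false by apply/negbTE; rewrite eq_sym.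
by rewrite mul0r.
Qed.

Local Notation H := (A^T *m A).

(** The new right vector is solved for in the two recurrences, where only the
    multiplication by A^T A raises the degree. *)
Lemma gkl_v_krylov l : (l < k)%N ->
  exists c : nat -> R, V l = \sum_(i < l.+1) c i *: iter i (mulmx H) x.
Proof.
elim/ltn_ind: l => -[|l] IH lk.
  by exists (fun=> 1); rewrite big_ord_recl big_ord0 addr0 scale1r V0.
have [a0 bn0] := nobreak (j := l.+1) lk.
have [c cE] := IH l (ltnSn _) (ltnW lk).
have [d dE] : exists d : nat -> R, b l *: U l = 0 /\ l = 0%N \/
    b l *: (A^T *m U l) = \sum_(i < l.+1) d i *: iter i (mulmx H) x.
  case: l IH lk a0 bn0 c cE => [|l] IH lk a0 bn0 c cE.
    by exists (fun=> 0); left; rewrite b0 scale0r.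
  have [d dE] := IH l (leqnSn _) (ltnW (ltnW lk)).
  exists (fun i => b l.+1 * (b l.+1 * c i + a l.+1 * (if (i < l.+1)%N then d i else 0))).
  right; rewrite gkl_mulmx_tr cE dE.
  rewrite scalerDr !scalerA.
  have -> : \sum_(i < l.+1) d i *: iter i (mulmx H) x =
    \sum_(i < l.+2) (if (i < l.+1)%N then d i else 0) *: iter i (mulmx H) x.
    rewrite [RHS]big_ord_recr /= ltnn scale0r addr0; apply: eq_bigr => i _.
    by rewrite ltn_ord.
  rewrite !scaler_sumr -big_split /=; apply: eq_bigr => i _.
  by rewrite !scalerA -scalerDl mulrDr !mulrA.
have {d dE}[d dE] : exists d : nat -> R,
    b l *: (A^T *m U l) = \sum_(i < l.+1) d i *: iter i (mulmx H) x.
  case: dE => [[u0 ->]|]; last by exists d.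
  by exists (fun=> 0); rewrite b0 scale0r big1 // => i _; rewrite scale0r.
(* A^T A V_l = a b V_(l+1) + a^2 V_l + b_l A^T U_l, solved for V_(l+1) *)
pose e i := (a l.+1 * b l.+1)^-1 * ((if i is i'.+1 then c i' else 0) -
   (if (i < l.+1)%N then d i + a l.+1 ^+ 2 * c i else 0)).
exists e.
have E : (a l.+1 * b l.+1) *: V l.+1 = H *m V l - b l *: (A^T *m U l) - a l.+1 ^+ 2 *: V l.
  rewrite -mulmxA gkl_mulmx mulmxDr -!scalemxAr addrK gkl_mulmx_tr scalerDr !scalerA.
  by rewrite -expr2 addrK.
have ab0 : a l.+1 * b l.+1 != 0 by rewrite mulf_neq0.
apply: (scalerI ab0); rewrite E dE cE mulmx_sumr.
transitivity (\sum_(i < l.+2) ((if (i : nat) is i'.+1 then c i' else 0) -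
   (if (i < l.+1)%N then d i + a l.+1 ^+ 2 * c i else 0)) *: iter i (mulmx H) x).
  under [RHS]eq_bigr do rewrite scalerBl.
  rewrite sumrB -addrA -opprD; congr (_ - _).
    rewrite [RHS]big_ord_recl scale0r add0r; apply: eq_bigr => i _.
    by rewrite -scalemxAr.
  rewrite [RHS]big_ord_recr /= ltnn scale0r addr0 scaler_sumr -big_split /=.
  by apply: eq_bigr => i _; rewrite ltn_ord scalerA -scalerDl.
rewrite scaler_sumr; apply: eq_bigr => i _; rewrite scalerA /e mulrA divff // mul1r.
by [].
Qed.

(** One inclusion suffices, by equality of the ranks. *)
Lemma krylov_basis_span : (krylov_basis^T == krylov_mx H x k)%MS.
Proof.
have sub : (krylov_basis^T <= krylov_mx H x k)%MS.
  apply/row_subP => j; have [c cE] := gkl_v_krylov (ltn_ord j).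
  have -> : row j krylov_basis^T = \sum_(i < j.+1) c i *: row (widen_ord (ltn_ord j) i) (krylov_mx H x k).
    apply/rowP => l; rewrite 2!mxE mxE cE !summxE; apply: eq_bigr => i _.
    by rewrite !mxE.
  by apply: summx_sub => i _; apply: scalemx_sub; apply: row_sub.
rewrite sub /=; have := mxrank_leqif_sup sub => -[_ <-].
rewrite eqn_leq mxrankS //=; apply: leq_trans (rank_leq_row _) _.
have r1 : \rank (1%:M : 'M[R]_k) = k by apply: mxrank1.
by rewrite -[X in (X <= _)%N]r1 -krylov_basis_unit mxrankM_maxl.
Qed.

Lemma lanczos_ritz theta : singular_values gkl_bidiag_of theta ->
  ritz_values H x [seq y ^+ 2 | y <- theta].
Proof.
case=> szt _ _; rewrite minnn subnn expr0 mul1r => cp.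
have sz : size [seq y ^+ 2 | y <- theta] = k by rewrite size_map szt minnn.
have prodE : \prod_(l <- [seq y ^+ 2 | y <- theta]) ('X - l%:P) =
  char_poly (krylov_basis^T *m H *m krylov_basis).
  by rewrite compression_krylov_basis cp big_map.
move: [seq _ | _ <- _] sz prodE => ls sz prodE; rewrite /ritz_values prodE.
rewrite sz; exists krylov_basis; split=> //; first exact: krylov_basis_unit.
exact: krylov_basis_span.
Qed.

End LanczosRecurrence.

Section GolubKahanLanczos.
Variables (R : realType) (m n : nat) (A : 'M[R]_(m, n)) (x : 'cV[R]_n).

Lemma gkl_step_mulmx j : A *m gkl_v (gkl A x j) =
  gkl_a (gkl A x j.+1) *: gkl_u (gkl A x j.+1) + gkl_b (gkl A x j) *: gkl_u (gkl A x j).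
Proof. by rewrite /= norm2_scale subrK. Qed.

Lemma gkl_step_mulmx_tr j : A^T *m gkl_u (gkl A x j.+1) =
  gkl_b (gkl A x j.+1) *: gkl_v (gkl A x j.+1) + gkl_a (gkl A x j.+1) *: gkl_v (gkl A x j).
Proof. by rewrite /= norm2_scale subrK. Qed.

Lemma gkl_ritz_values k theta : dot x x = 1 -> (0 < k)%N ->
  (forall j, (0 < j < k)%N -> gkl_a (gkl A x j) != 0 /\ gkl_b (gkl A x j) != 0) ->
  singular_values (bidiag_mx k (fun i => gkl_a (gkl A x i.+1))
                               (fun i => gkl_b (gkl A x i.+1))) theta ->
  ritz_values (A^T *m A) x [seq y ^+ 2 | y <- theta].
Proof.
move=> xu k0 nb; apply: (lanczos_ritz (a := fun i => gkl_a (gkl A x i))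
  (b := fun i => gkl_b (gkl A x i)) (U := fun i => gkl_u (gkl A x i))
  (V := fun i => gkl_v (gkl A x i))) => // j.
- exact: gkl_step_mulmx.
- exact: gkl_step_mulmx_tr.
- exact: norm2_unit.
- exact: norm2_unit.
- by move=> /= ->; rewrite invr0 scale0r.
Qed.

End GolubKahanLanczos.

Theorem gkl_approximates (R : realType) (v1 : nat -> R) m n (A : 'M[R]_(m, n))
    (L : 'M[R]_m) k :
  char_poly L = char_poly (A *m A^T) ->
  (0 < k)%N -> \sum_(i < minn m n) v1 i ^+ 2 = 1 ->
  gkl_approximates_eigenvalues v1 A L k.
Proof.
move=> LA k0 v1u.
have [sigma [sA cA]] := svd_gram A.
have [theta [tA _]] := svd_gram (gkl_bidiag v1 A k).
exists sigma, theta; split=> //; first by rewrite LA.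
move: tA; rewrite /gkl_bidiag /gkl_no_breakdown /gkl_alpha /gkl_beta /on_tall.
have su n' : minn m n = n' -> dot (start_vec v1 n') (start_vec v1 n') = 1.
  by move=> <-; rewrite dot_sum -v1u; apply: eq_bigr => i _; rewrite mxE.
case: ltnP => mn tA nb; apply: (gkl_ritz_values _ k0 nb tA); apply: su.
  exact/minn_idPl/ltnW.
exact/minn_idPr.
Qed.

(** * A program logic with running times *)

Local Close Scope ring_scope.

Fixpoint nat_writes (c : cmd) : seq nat :=
  match c with
  | NSet a _ _ => [:: a]
  | Seq c1 c2 | If _ c1 c2 => nat_writes c1 ++ nat_writes c2
  | While _ c1 => nat_writes c1
  | _ => [::]
  end.

Fixpoint real_writes (c : cmd) : seq nat :=
  match c with
  | RSet a _ _ | BidiagSvd _ _ _ a => [:: a]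
  | Seq c1 c2 | If _ c1 c2 => real_writes c1 ++ real_writes c2
  | While _ c1 => real_writes c1
  | _ => [::]
  end.

Fixpoint loop_free (c : cmd) : bool :=
  match c with
  | Seq c1 c2 | If _ c1 c2 => loop_free c1 && loop_free c2
  | While _ _ | BidiagSvd _ _ _ _ => false
  | _ => true
  end.

(** Meant for loop-free commands: loops and singular value computations count
    for zero. *)
Fixpoint max_cost (c : cmd) : nat :=
  match c with
  | Skip => 1
  | NSet _ i e => (ncost i + ncost e).+1
  | RSet _ i e => (ncost i + rcost e).+1
  | Seq c1 c2 => max_cost c1 + max_cost c2
  | If b c1 c2 => (bcost b + maxn (max_cost c1) (max_cost c2)).+1
  | _ => 0
  end.

Notation nvar x := (NGet x (NConst 0)) (only parsing).
Notation rvar x := (RGet x (NConst 0)) (only parsing).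
Notation nassign x e := (NSet x (NConst 0) e) (only parsing).
Notation rassign x e := (RSet x (NConst 0) e) (only parsing).
Notation nincr x := (NSet x (NConst 0) (NAdd (NGet x (NConst 0)) (NConst 1))) (only parsing).
Notation nlt e1 e2 := (BNot (BNle e2 e1)) (only parsing).
Notation nzero e := (BNle e (NConst 0)) (only parsing).

Declare Scope ram_scope.
Delimit Scope ram_scope with ram.
Notation "c1 ;; c2" := (Seq c1 c2) (at level 90, right associativity) : ram_scope.

Definition For (x : nat) (e : nexpr) (c : cmd) : cmd :=
  (nassign x (NConst 0);; While (nlt (nvar x) e) (c;; nincr x))%ram.

Definition for_cost (e : nexpr) (n c : nat) : nat := n * (c + ncost e + 11) + ncost e + 8.

Section RamLogic.
Variable R : realType.
Implicit Types s : state R.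

(** Total correctness, with a postcondition on the running time and the final
    memory. *)
Definition wp (c : cmd) s (Q : nat -> state R -> Prop) : Prop :=
  exists t s', exec c s t s' /\ Q t s'.

(** The arrays in [ns] (integers) and [rs] (reals) may differ. *)
Definition agree (ns rs : seq nat) s s' : Prop :=
  (forall a, a \notin ns -> nmem s' a = nmem s a) /\
  (forall a, a \notin rs -> rmem s' a = rmem s a).

Lemma agree_refl ns rs s : agree ns rs s s.
Proof. by []. Qed.

Lemma agree_trans ns rs s1 s2 s3 :
  agree ns rs s1 s2 -> agree ns rs s2 s3 -> agree ns rs s1 s3.
Proof.
by move=> [n1 r1] [n2 r2]; split=> a h; [rewrite n2 // n1 | rewrite r2 // r1].
Qed.

Lemma agree_sub ns rs ns' rs' s s' : {subset ns <= ns'} -> {subset rs <= rs'} ->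
  agree ns rs s s' -> agree ns' rs' s s'.
Proof.
move=> hn hr [n1 r1]; split=> a h.
  by apply: n1; apply: contra h => /hn.
by apply: r1; apply: contra h => /hr.
Qed.

Lemma agree_nset ns rs s a i x : a \in ns -> agree ns rs s (nset s a i x).
Proof.
move=> an; split=> // b bn /=; have /negbTE -> : b != a by apply: contraNneq bn => ->.
by [].
Qed.

(** This is the frame rule: what a command may change can be read off its text. *)
Lemma exec_agree c s t s' : exec c s t s' -> agree (nat_writes c) (real_writes c) s s'.
Proof.
have eqn a b : a \notin [:: b] -> (a == b) = false by rewrite inE => /negbTE.
elim=> {c s t s'} //=.
- by move=> s a i e; split=> // b /eqn E; rewrite /= E.
- by move=> s a i e; split=> // b /eqn E; rewrite /= E.
- move=> c1 c2 s s1 s2 t1 t2 _ h1 _ h2.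
  apply: agree_trans (agree_sub _ _ h1) (agree_sub _ _ h2) => x;
    by rewrite mem_cat => ->; rewrite ?orbT.
- move=> b c1 c2 s s1 t _; case: (beval s b) => h.
    by apply: (agree_sub _ _ h) => x; rewrite mem_cat => ->.
  by apply: (agree_sub _ _ h) => x; rewrite mem_cat => ->; rewrite orbT.
- by move=> b c s s1 s2 t1 t2 _ _ h1 _ h2; apply: agree_trans h1 h2.
- by move=> s k d e o xs _; split=> // b /eqn E; rewrite /= E.
Qed.

(** On loop-free commands execution is a function, so that the memory after them
    can be computed by simplification. *)
Fixpoint run (c : cmd) s : state R :=
  match c with
  | NSet a i e => nset s a (neval s i) (neval s e)
  | RSet a i e => rset s a (neval s i) (reval s e)
  | Seq c1 c2 => run c2 (run c1 s)
  | If b c1 c2 => if beval s b then run c1 s else run c2 s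
  | _ => s
  end.

Lemma exec_run c s : loop_free c -> exists2 t, exec c s t (run c s) & t <= max_cost c.
Proof.
elim: c s => //=.
- by exists 1 => //; constructor.
- by move=> a i e s _; eexists; first constructor.
- by move=> a i e s _; eexists; first constructor.
- move=> c1 IH1 c2 IH2 s /andP[/(IH1 s)[t1 e1 h1] /(IH2 (run c1 s))[t2 e2 h2]].
  by exists (t1 + t2); [econstructor; eauto | apply: leq_add].
- move=> b c1 IH1 c2 IH2 s /andP[/(IH1 s)[t1 e1 h1] /(IH2 s)[t2 e2 h2]].
  exists (bcost b + if beval s b then t1 else t2).+1.
    by constructor; case: (beval s b).
  rewrite ltnS leq_add2l; case: (beval s b).
    exact: leq_trans h1 (leq_maxl _ _).
  exact: leq_trans h2 (leq_maxr _ _).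
Qed.

Lemma run_agree c s : loop_free c -> agree (nat_writes c) (real_writes c) s (run c s).
Proof. by move=> /(exec_run s)[t e _]; apply: exec_agree e. Qed.

Lemma run_if b c1 c2 s : run (If b c1 c2) s = if beval s b then run c1 s else run c2 s.
Proof. by []. Qed.

Lemma run_seq c1 c2 s : run (Seq c1 c2) s = run c2 (run c1 s).
Proof. by []. Qed.

Lemma run_nset a i e s : run (NSet a i e) s = nset s a (neval s i) (neval s e).
Proof. by []. Qed.

Lemma run_rset a i e s : run (RSet a i e) s = rset s a (neval s i) (reval s e).
Proof. by []. Qed.

Lemma wp_conseq c s (Q Q' : nat -> state R -> Prop) :
  (forall t s', agree (nat_writes c) (real_writes c) s s' -> Q t s' -> Q' t s') ->
  wp c s Q -> wp c s Q'.
Proof.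
move=> h [t [s' [e q]]]; exists t, s'; split=> //; apply: h q.
exact: exec_agree e.
Qed.

Lemma wp_run c s (Q : nat -> state R -> Prop) : loop_free c ->
  (forall t, t <= max_cost c -> Q t (run c s)) -> wp c s Q.
Proof. by move=> /(exec_run s)[t e h] q; exists t, (run c s); split=> //; apply: q. Qed.

Lemma wp_seq c1 c2 s (Q : nat -> state R -> Prop) :
  wp c1 s (fun t1 s1 => wp c2 s1 (fun t2 s2 => Q (t1 + t2) s2)) -> wp (Seq c1 c2) s Q.
Proof.
move=> [t1 [s1 [e1 [t2 [s2 [e2 q]]]]]]; exists (t1 + t2), s2; split=> //.
by econstructor; eauto.
Qed.

Lemma wp_if b c1 c2 s (Q : nat -> state R -> Prop) :
  (beval s b -> wp c1 s (fun t s' => Q (bcost b + t).+1 s')) ->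
  (~~ beval s b -> wp c2 s (fun t s' => Q (bcost b + t).+1 s')) ->
  wp (If b c1 c2) s Q.
Proof.
move=> h1 h2; case E: (beval s b).
  have [t [s' [e q]]] := h1 E; exists (bcost b + t).+1, s'; split=> //.
  by constructor; rewrite E.
have [t [s' [e q]]] := h2 (negbT E); exists (bcost b + t).+1, s'; split=> //.
by constructor; rewrite E.
Qed.

(** The potential [phi] bounds the remaining running time, so that it proves
    termination and pays for the iterations at once. *)
Lemma wp_while b c s (P : state R -> Prop) (phi : state R -> nat)
    (Q : nat -> state R -> Prop) :
  P s ->
  (forall s1, agree (nat_writes c) (real_writes c) s s1 -> P s1 -> beval s1 b ->
     wp c s1 (fun t s2 => P s2 /\ bcost b + t + phi s2 < phi s1)) ->
  (forall t s1, agree (nat_writes c) (real_writes c) s s1 -> P s1 -> ~~ beval s1 b ->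
     t <= phi s + bcost b + 1 -> Q t s1) ->
  wp (While b c) s Q.
Proof.
move=> Ps body post.
suff H s1 : agree (nat_writes c) (real_writes c) s s1 -> P s1 ->
    exists t s2, [/\ exec (While b c) s1 t s2, P s2, ~~ beval s2 b,
      agree (nat_writes c) (real_writes c) s s2 & t <= phi s1 + bcost b + 1].
  have [t [s2 [e p nb ag h]]] := H s (agree_refl _ _ _) Ps.
  by exists t, s2; split=> //; apply: post.
have [N] := ubnP (phi s1); elim: N s1 => // N IH s1 hN ag1 P1.
case E: (beval s1 b); last first.
  exists (bcost b).+1, s1; rewrite E; split=> //; last by rewrite addn1 ltnS leq_addl.
  by constructor; rewrite E.
have [t [s2 [e [P2 h2]]]] := body s1 ag1 P1 E.
have ag2 := agree_trans ag1 (exec_agree e).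
have [|t' [s3 [e3 P3 nb3 ag3 h3]]] := IH s2 _ ag2 P2; first by lia.
exists (bcost b + t + t').+1, s3; split=> //; last by lia.
by apply: ExecWhileT e3.
Qed.

(** The invariant [P] speaks only of what the body changes: the rest of the
    memory is known to agree with the state before the loop. *)
Lemma wp_for x e c s N C (P : nat -> state R -> Prop) (Q : nat -> state R -> Prop) :
  let W := x :: nat_writes c in
  x \notin nat_writes c ->
  (forall s1, agree W (real_writes c) s s1 -> neval s1 e = N) ->
  P 0 (nset s x 0 0) ->
  (forall i s1, i < N -> agree W (real_writes c) s s1 -> nmem s1 x 0 = i -> P i s1 ->
     wp c s1 (fun t s2 => t <= C /\ P i.+1 (nset s2 x 0 i.+1))) ->
  (forall t s1, agree W (real_writes c) s s1 -> P N s1 ->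
     t <= for_cost e N C -> Q t s1) ->
  wp (For x e c) s Q.
Proof.
move=> W xc eN P0 body post; apply: wp_seq; apply: wp_run => // t0 /= t0h.
have xW : x \in W by rewrite inE eqxx.
set s0 := nset s x 0 0; have ag0 : agree W (real_writes c) s s0 by apply: agree_nset.
have sub s1 : agree (nat_writes c ++ [:: x]) (real_writes c ++ [::]) s0 s1 ->
    agree W (real_writes c) s s1.
  move=> h; apply: agree_trans ag0 _; apply: agree_sub h => y.
    by rewrite mem_cat !inE orbC.
  by rewrite cats0.
pose P' s1 := exists i, [/\ i <= N, nmem s1 x 0 = i & P i s1].
pose phi s1 := (N - nmem s1 x 0) * (C + ncost e + 11).
apply: (wp_while (P := P') (phi := phi)).
- by exists 0; split=> //=; rewrite eqxx.
- move=> s1 /sub ag1 [i [iN xi Pi]] /=; rewrite -ltnNge xi (eN _ ag1) => iN'.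
  apply: wp_seq; have := body i s1 iN' ag1 xi Pi.
  apply: wp_conseq => t s2 ag2 [tC P2]; apply: wp_run => //= t2 t2h.
  have x2 : nmem s2 x 0 = i by rewrite (proj1 ag2).
  rewrite x2 addn1; split.
    by exists i.+1; split=> //=; rewrite eqxx.
  rewrite /phi /= eqxx /= xi.
  have -> : N - i = (N - i.+1).+1 by lia.
  rewrite mulSn; lia.
move=> t s1 /sub ag1 [i [iN xi Pi]] /=; rewrite -ltnNge xi (eN _ ag1) -leqNgt => Ni.
move=> th; have iE : i = N by apply/eqP; rewrite eqn_leq iN.
rewrite iE in Pi; apply: post => //.
move: th t0h; rewrite /phi /= eqxx /= subn0 /for_cost; lia.
Qed.

End RamLogic.

Arguments run : simpl never.
Definition run_simp := (run_seq, run_nset, run_rset).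

(** * Memory layout, and the graph of the outer rows *)

(** Arrays 0 to 3 of integers and of reals hold the input, arrays 4 to 7 the
    output; the names starting with [x_] are those of one-cell arrays. *)
Notation a_dims := 0%N (only parsing).
Notation a_rowptr := 1%N (only parsing).
Notation a_colidx := 2%N (only parsing).
Notation a_inner := 3%N (only parsing).
Notation a_outdims := 4%N (only parsing).
Notation a_outptr := 5%N (only parsing).
Notation a_outcol := 6%N (only parsing).
Notation a_isinner := 7%N (only parsing).
Notation a_nonzero := 8%N (only parsing).
Notation a_head := 9%N (only parsing).
Notation a_next := 10%N (only parsing).
Notation a_dst := 11%N (only parsing).
Notation a_parity := 12%N (only parsing).
Notation a_label := 13%N (only parsing).
Notation a_sign := 14%N (only parsing).
Notation a_queue := 15%N (only parsing).
Notation a_bad := 16%N (only parsing).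
Notation a_column := 17%N (only parsing).
Notation a_outrow := 19%N (only parsing).
Notation x_i := 30%N (only parsing).
Notation x_first := 31%N (only parsing).
Notation x_len := 32%N (only parsing).
Notation x_col1 := 33%N (only parsing).
Notation x_col2 := 34%N (only parsing).
Notation x_parity := 35%N (only parsing).
Notation x_arcs := 36%N (only parsing).
Notation x_labels := 37%N (only parsing).
Notation x_done := 38%N (only parsing).
Notation x_seen := 39%N (only parsing).
Notation x_arc := 40%N (only parsing).
Notation x_root := 41%N (only parsing).
Notation x_dst := 42%N (only parsing).
Notation x_columns := 43%N (only parsing).
Notation x_target1 := 46%N (only parsing).
Notation x_target2 := 47%N (only parsing).
Notation x_nnz := 49%N (only parsing).
Notation a_tallrow := 50%N (only parsing).
Notation a_tallcol := 51%N (only parsing).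
Notation x_height := 52%N (only parsing).
Notation x_width := 53%N (only parsing).
Notation x_step := 54%N (only parsing).
Notation r_val := 0%N (only parsing).
Notation r_wq := 1%N (only parsing).
Notation r_w := 2%N (only parsing).
Notation r_v := 3%N (only parsing).
Notation r_outval := 4%N (only parsing).
Notation r_alpha := 5%N (only parsing).
Notation r_beta := 6%N (only parsing).
Notation r_eigen := 7%N (only parsing).
Notation r_classwt := 8%N (only parsing).
Notation r_u := 10%N (only parsing).
Notation r_sigma := 11%N (only parsing).
Notation r_val1 := 20%N (only parsing).
Notation r_val2 := 21%N (only parsing).
Notation r_alphaj := 23%N (only parsing).
Notation r_betaj := 24%N (only parsing).
Notation r_acc := 25%N (only parsing).
Notation dim_rows := (NGet 0 (NConst 0)) (only parsing).
Notation dim_cols := (NGet 0 (NConst 1)) (only parsing).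
Notation dim_inner := (NGet 0 (NConst 2)) (only parsing).
Notation dim_steps := (NGet 0 (NConst 3)) (only parsing).

Definition signed_arc := ((nat * nat) * bool)%type.
Definition arc0 : signed_arc := ((0, 0), false).
Definition src (x : signed_arc) := x.1.1.
Definition dst (x : signed_arc) := x.1.2.

(** Positions are counted from 1, and 0 is the null pointer. The arcs leaving a
    column are linked from the last one to the first one; the head of the list
    and its links are positions of this kind. *)
Definition last_pos (l : seq nat) (v : nat) : nat := size l - index v (rev l).

Lemma last_pos_rcons l x v :
  last_pos (rcons l x) v = if x == v then (size l).+1 else last_pos l v.
Proof. by rewrite /last_pos rev_rcons size_rcons /=; case: eqP; rewrite ?subn0. Qed.

Definition mark_inner : cmd :=
  For x_i dim_inner (NSet a_isinner (NGet a_inner (nvar x_i)) (NConst 1)).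

Local Open Scope ram_scope.

Definition push_arc (a b : nat) : cmd :=
  nincr x_arcs;;
  NSet a_next (nvar x_arcs) (NGet a_head (nvar a));;
  NSet a_dst (nvar x_arcs) (nvar b);;
  NSet a_parity (nvar x_arcs) (nvar x_parity);;
  NSet a_head (nvar a) (nvar x_arcs).

Definition load_row : cmd :=
  nassign x_first (NGet a_rowptr (nvar x_i));;
  nassign x_len (NSub (NGet a_rowptr (NAdd (nvar x_i) (NConst 1))) (nvar x_first)).

Definition load_fst : cmd := nassign x_col1 (NGet a_colidx (nvar x_first)).
Definition load_snd : cmd :=
  nassign x_col2 (NGet a_colidx (NAdd (nvar x_first) (NConst 1)));;
  If (BRle (RConst 0) (RGet r_val (nvar x_first)))
    (If (BRle (RConst 0) (RGet r_val (NAdd (nvar x_first) (NConst 1))))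
       (nassign x_parity (NConst 1)) (nassign x_parity (NConst 0)))
    (If (BRle (RConst 0) (RGet r_val (NAdd (nvar x_first) (NConst 1))))
       (nassign x_parity (NConst 0)) (nassign x_parity (NConst 1))).

Definition scan_row : cmd :=
  If (nzero (NGet a_isinner (nvar x_i)))
    (load_row;;
     If (nzero (nvar x_len)) Skip
       (load_fst;; NSet a_nonzero (nvar x_col1) (NConst 1);;
        If (BNle (nvar x_len) (NConst 1)) Skip
          (load_snd;; NSet a_nonzero (nvar x_col2) (NConst 1);;
           push_arc x_col1 x_col2;; push_arc x_col2 x_col1)))
    Skip.

Definition scan_rows : cmd := For x_i dim_rows scan_row.

Section Scan.
Variable R : realType.
Implicit Types s : state R.

Definition stores_arcs s (A : seq signed_arc) : Prop :=
  [/\ nmem s x_arcs 0 = size A,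
      forall v, nmem s a_head v = last_pos (map src A) v
    & forall p, p < size A ->
        [/\ nmem s a_next p.+1 = last_pos (map src (take p A)) (src (nth arc0 A p)),
            nmem s a_dst p.+1 = dst (nth arc0 A p)
          & nmem s a_parity p.+1 = (nth arc0 A p).2]].

Lemma push_arcP s A a b (par : bool) : (a, b) = (x_col1, x_col2) \/ (a, b) = (x_col2, x_col1) ->
  nmem s x_parity 0 = par -> stores_arcs s A ->
  stores_arcs (run (push_arc a b) s) (rcons A ((nmem s a 0, nmem s b 0), par)).
Proof.
move=> ab par35 [cntA headA arcA].
have main x y : (forall v, (if v == x then (size A).+1 else nmem s a_head v) =
      last_pos [seq src i | i <- rcons A (x, y, par)] v) /\
   forall p, p < (size A).+1 -> let z := nth arc0 (rcons A (x, y, par)) p in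
     [/\ (if p.+1 == (size A).+1 then nmem s a_head x else nmem s a_next p.+1) =
           last_pos [seq src i | i <- take p (rcons A (x, y, par))] (src z),
         (if p.+1 == (size A).+1 then y else nmem s a_dst p.+1) = dst z
       & (if p.+1 == (size A).+1 then nmem s x_parity 0 else nmem s a_parity p.+1) = z.2].
  split=> [v|p pA]; first by rewrite map_rcons last_pos_rcons size_map eq_sym headA.
  rewrite eqSS nth_rcons -cats1 take_cat; have [pA'|pA'] := ltnP p (size A).
    by rewrite ltn_eqF //; apply: arcA.
  have -> : p = size A by lia.
  by rewrite eqxx subnn take0 cats0 par35 headA.
have [m1 m2] := main (nmem s a 0) (nmem s b 0).
by case: ab m1 m2 => -[-> ->] m1 m2; split; rewrite /= ?size_rcons ?cntA ?addn1.
Qed.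

Variables (m n : nat) (rowE : nat -> seq (nat * bool)) (inner : nat -> bool).

Definition stores_rows s : Prop :=
  [/\ nmem s a_dims 0 = m, nmem s a_dims 1 = n &
      forall i, i < m -> nmem s a_rowptr i.+1 = nmem s a_rowptr i + size (rowE i) /\
       forall l, l < size (rowE i) ->
         nmem s a_colidx (nmem s a_rowptr i + l) = (nth (0, true) (rowE i) l).1 /\
         (0 <= rmem s r_val (nmem s a_rowptr i + l))%R = (nth (0, true) (rowE i) l).2].

(** The parity of an arc tells whether regulating signs differ at its ends,
    which happens when the two entries of the row have the same sign. *)
Definition row_arcs i : seq signed_arc :=
  if inner i then [::] else
  if rowE i is [:: (a, x); (b, y)] then [:: (a, b, x == y); (b, a, x == y)] else [::].

Definition arcs_upto i : seq signed_arc := flatten [seq row_arcs l | l <- iota 0 i].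

Definition outer_col i v : bool :=
  has (fun l => ~~ inner l && (v \in map fst (rowE l))) (iota 0 i).

Lemma arcs_uptoS i : arcs_upto i.+1 = arcs_upto i ++ row_arcs i.
Proof. by rewrite /arcs_upto -[i.+1]addn1 iotaD map_cat flatten_cat /= cats0 add0n. Qed.

Lemma outer_colS i v :
  outer_col i.+1 v = outer_col i v || (~~ inner i && (v \in map fst (rowE i))).
Proof. by rewrite /outer_col -[i.+1]addn1 iotaD has_cat /= orbF add0n. Qed.

Definition stores_inner s : Prop := forall i, i < m -> nmem s a_isinner i = inner i.

Hypothesis rowE_le2 : forall i, i < m -> size (rowE i) <= 2.

Lemma load_sndP s e (x y : bool) : nmem s x_first 0 = e ->
  (0 <= rmem s r_val e)%R = x -> (0 <= rmem s r_val (e + 1)%N)%R = y ->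
  nmem (run load_snd s) x_col2 0 = nmem s a_colidx (e + 1) /\
  nmem (run load_snd s) x_parity 0 = (x == y).
Proof.
move=> ee ex ey; rewrite /load_snd run_seq run_nset !run_if /= ee ex.
by case: x ex => ex; rewrite ey; case: (y); rewrite !run_simp /=.
Qed.

Lemma scan_rowsP s : stores_rows s -> stores_inner s ->
  (forall i, nmem s a_nonzero i = 0) -> stores_arcs s [::] ->
  wp scan_rows s (fun t s' => [/\ stores_arcs s' (arcs_upto m),
     forall v, nmem s' a_nonzero v = outer_col m v &
     t <= for_cost dim_rows m (max_cost scan_row)]).
Proof.
move=> [hm hn hrow] hin h8 harc.
apply: (wp_for (N := m) (C := max_cost scan_row)
  (P := fun i s' => stores_arcs s' (arcs_upto i) /\ forall v, nmem s' a_nonzero v = outer_col i v)) => //.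
- by move=> s1 [ag _] /=; rewrite ag.
- move=> i s1 im [agn agr] xi [harc1 h81].
  apply: wp_run => // t tC; split=> {t tC}//.
  suff [h1 h2] : stores_arcs (run scan_row s1) (arcs_upto i ++ row_arcs i) /\
      forall v, nmem (run scan_row s1) a_nonzero v =
        outer_col i v || (~~ inner i && (v \in map fst (rowE i))).
    by split=> /=; [rewrite arcs_uptoS | move=> v; rewrite outer_colS -h2].
  have [r1 re] := hrow i im.
  have a0 : nmem s1 a_dims = nmem s a_dims by rewrite agn.
  have a1 : nmem s1 a_rowptr = nmem s a_rowptr by rewrite agn.
  have a2 : nmem s1 a_colidx = nmem s a_colidx by rewrite agn.
  have a7 : nmem s1 a_isinner = nmem s a_isinner by rewrite agn.
  have b0 : rmem s1 r_val = rmem s r_val by rewrite agr.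
  rewrite /scan_row run_if [beval _ _]/= xi a7 hin //.
  case ini: (inner i).
    by rewrite /row_arcs ini cats0 /=; split=> // v; rewrite orbF.
  rewrite run_seq; set s2 := run load_row s1.
  have e31 : nmem s2 x_first 0 = nmem s a_rowptr i by rewrite /= xi a1.
  have e32 : nmem s2 x_len 0 = size (rowE i) by rewrite /= xi a1 addn1 r1 addKn.
  have arc2 : stores_arcs s2 (arcs_upto i) by [].
  have h82 v : nmem s2 a_nonzero v = outer_col i v by rewrite -h81.
  have a22 : nmem s2 a_colidx = nmem s a_colidx by rewrite -a2.
  have b02 : rmem s2 r_val = rmem s r_val by rewrite -b0.
  clearbody s2.
  rewrite run_if [beval _ _]/= e32 /row_arcs ini.
  case: (rowE i) (rowE_le2 im) re e32 => [|[a x] [|[b y] [|//]]] _ re e32.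
  - by rewrite cats0; split=> // v; rewrite orbF.
  - rewrite !run_simp run_if /= e32 /= cats0; split=> // v; rewrite in_cons orbF.
    rewrite e31 a22; have [/=] := re 0 isT; rewrite addn0 => -> _.
    by case: eqP => [->|_]; rewrite ?orbT //= orbF h82.
  have [/=] := re 0 isT; have [/=] := re 1 isT; rewrite addn0 => c1 v1 c0 v0.
  rewrite !run_simp run_if.
  set s3 := nset (nset _ _ _ _) _ _ _.
  have f31 : nmem s3 x_first 0 = nmem s a_rowptr i by [].
  have f33 : nmem s3 x_col1 0 = a by rewrite /= e31 a22.
  have f8 v : nmem s3 a_nonzero v = outer_col i v || (v == a).
    by rewrite /= e31 a22 c0; case: eqP; rewrite ?orbT ?orbF ?h82.
  have f32 : nmem s3 x_len 0 = 2 by [].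
  have arc3 : stores_arcs s3 (arcs_upto i) by [].
  have a3 : nmem s3 a_colidx = nmem s a_colidx by [].
  have b3 : rmem s3 r_val = rmem s r_val by [].
  clearbody s3.
  rewrite [beval _ _]/= f32 run_seq.
  have [|||g34 g35] := @load_sndP s3 (nmem s a_rowptr i) x y; rewrite ?b3 //.
  have [agl rgl] := @run_agree _ load_snd s3 isT.
  move: (run load_snd s3) g34 g35 agl rgl => s4 g34 g35 agl rgl.
  rewrite a3 c1 in g34.
  rewrite run_seq; set s5 := run (NSet _ _ _) s4.
  have k8 v : nmem s5 a_nonzero v = outer_col i v || [|| v == a, v == b | false].
    by rewrite /s5 run_nset /= g34 agl // f8 orbF orbA; case: eqP; rewrite ?orbT ?orbF.
  have arc5 : stores_arcs s5 (arcs_upto i).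
    by rewrite /stores_arcs /s5 run_nset /= !agl.
  have k33 : nmem s5 x_col1 0 = a by rewrite /s5 run_nset /= agl.
  have k34 : nmem s5 x_col2 0 = b by rewrite /s5 run_nset /= .
  have k35 : nmem s5 x_parity 0 = (x == y) by rewrite /s5 run_nset /=.
  clearbody s5; rewrite run_seq.
  have [ag6 _] := @run_agree _ (push_arc x_col1 x_col2) s5 isT.
  have arc6 := push_arcP (or_introl erefl) k35 arc5.
  move: (run (push_arc x_col1 x_col2) s5) ag6 arc6 => s6 ag6 arc6.
  have k356 : nmem s6 x_parity 0 = (x == y) by rewrite ag6.
  have [ag7 _] := @run_agree _ (push_arc x_col2 x_col1) s6 isT.
  have arc7 := push_arcP (or_intror erefl) k356 arc6.
  split=> [|v]; last by rewrite ag7 // ag6.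
  by move: arc7; rewrite -!cats1 -catA !ag6 // k33 k34.
by move=> t s' _ [? ?] ?.
Qed.

End Scan.

(** * Breadth-first search: invariants *)

Lemma count_sub_lt T (a1 a2 : pred T) (l : seq T) :
  subpred a2 a1 -> has (fun x => a1 x && ~~ a2 x) l -> count a2 l < count a1 l.
Proof.
move=> sub; rewrite has_count.
suff -> : count a1 l = count a2 l + count (fun x => a1 x && ~~ a2 x) l.
  by rewrite -{1}[count a2 l]addn0 ltn_add2l.
elim: l => //= x l ->; have := sub x.
by case: (a2 x) (a1 x) => [] [] // h; rewrite ?h //=; lia.
Qed.

Lemma last_posP l v : last_pos l v <= size l /\
  (last_pos l v != 0 -> nth 0 l (last_pos l v).-1 = v) /\
  forall r, last_pos l v <= r < size l -> nth 0 l r != v.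
Proof.
elim/last_ind: l => [|l x [IH1 [IH2 IH3]]]; first by split=> //; split=> // r.
rewrite last_pos_rcons size_rcons; case: eqP => [->|/eqP xv].
  by split=> //; split=> [_|r] /=; [rewrite nth_rcons ltnn eqxx | lia].
split; first exact: leq_trans IH1 _.
split=> [p0|r /andP[h1 h2]].
  have lt : (last_pos l v).-1 < size l by lia.
  by rewrite nth_rcons lt IH2.
rewrite nth_rcons; have [rl|rl] := ltnP r (size l); first by rewrite IH3 // h1.
by have -> : r == size l by lia.
Qed.

Section Search.
Variables (n : nat) (A : seq signed_arc).
Hypothesis A_sym : forall a b x, (a, b, x) \in A -> (b, a, x) \in A.
Hypothesis A_dst : forall a b x, (a, b, x) \in A -> b < n.

Inductive reach (r : nat) : nat -> bool -> Prop :=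
| reach_root : reach r r false
| reach_arc a b x y : reach r a x -> (a, b, y) \in A -> reach r b (x (+) y).

Definition arc_src r := src (nth arc0 A r).
Definition arc_dst r := dst (nth arc0 A r).
Definition arc_par r := (nth arc0 A r).2.

Lemma arc_mem r : r < size A -> (arc_src r, arc_dst r, arc_par r) \in A.
Proof. by rewrite /arc_src /arc_dst /arc_par /src /dst => /(mem_nth arc0); case: nth => -[]. Qed.

Lemma arc_index x : x \in A -> exists2 r, r < size A & nth arc0 A r = x.
Proof. by move=> xA; exists (index x A); rewrite ?index_mem ?nth_index. Qed.

Definition next_arc p := last_pos (map src (take p A)) (arc_src p).
Definition first_arc v := last_pos (map src A) v.

Lemma first_arcP v : first_arc v <= size A /\
  (first_arc v != 0 -> arc_src (first_arc v).-1 = v) /\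
  forall r, first_arc v <= r < size A -> arc_src r != v.
Proof.
rewrite /first_arc; have := last_posP (map src A) v; rewrite size_map.
case=> h1 [h2 h3]; split=> //; split=> [p0|r hr].
  by rewrite -[RHS](h2 p0) (nth_map arc0) //; lia.
by have := h3 r hr; rewrite (nth_map arc0) //; case/andP: hr.
Qed.

Lemma next_arcP p : p < size A -> next_arc p <= p /\
  (next_arc p != 0 -> arc_src (next_arc p).-1 = arc_src p) /\
  forall r, next_arc p <= r < p -> arc_src r != arc_src p.
Proof.
move=> pA; rewrite /next_arc; move: (arc_src p) => v.
have st : size (take p A) = p by rewrite size_takel // ltnW.
have := last_posP (map src (take p A)) v; rewrite size_map st.
case=> h1 [h2 h3]; split=> //; split=> [p0|r hr].
  have lt : (last_pos [seq src i | i <- take p A] v).-1 < p.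
    by case: (last_pos _ v) p0 h1.
  by rewrite -[RHS](h2 p0) (nth_map arc0) ?st // nth_take.
have := h3 r hr; case/andP: hr => _ rp.
by rewrite (nth_map arc0) ?st // nth_take.
Qed.

(** The first [h] vertices of the queue [q] are finished; the arcs of the next
    one are followed from the last to the first, down to position [p]. *)
Definition followed (q : seq nat) h p r : bool :=
  (arc_src r \in take h q) || [&& h < size q, arc_src r == nth 0 q h & p <= r].

(** A vertex that is seen but not finished belongs to the current class [c]
    (si_last). This is what makes labels constant along the followed arcs
    (si_closed): an arc to another class would have been followed backwards. *)
Record search_inv (q : seq nat) (h p j c : nat) (comp root : nat -> nat)
    (sg : nat -> bool) : Prop := SearchInv {
  si_uniq : uniq q;
  si_h : h <= size q;
  si_comp : forall v, (comp v != 0) = (v \in q);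
  si_lt : forall v, v \in q -> v < n;
  si_c : forall v, comp v <= c;
  si_reach : forall v, v \in q -> reach (root (comp v)) v (sg v);
  si_root : forall l, 0 < l <= c -> root l \in q /\ comp (root l) = l;
  si_closed : forall r, r < size A -> followed q h p r ->
    arc_dst r \in q /\ comp (arc_dst r) = comp (arc_src r);
  si_last : forall v, v \in q -> v \notin take h q -> comp v = c;
  si_p : h < size q -> p <= size A /\ (p != 0 -> arc_src p.-1 = nth 0 q h);
  si_j : forall v, v < j -> v \in q;
  si_jn : j <= n /\ (j < n \/ size q <= h);
  si_cq : c <= size q
}.

(** A vertex counts twice as long as it is not seen, and once while it waits in
    the queue, so that each iteration lowers the sum. *)
Definition todo (q : seq nat) h p j : nat :=
  (n - j) + 2 * (n - size q) + (size q - h) +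
  count (fun r => ~~ followed q h p r) (iota 0 (size A)).

Definition upd T (f : nat -> T) u x v := if v == u then x else f v.

Section Steps.
Variables (q : seq nat) (h p j c : nat) (comp root : nat -> nat) (sg : nat -> bool).
Hypothesis inv : search_inv q h p j c comp root sg.

Lemma search_size_q : size q <= n.
Proof.
rewrite -[n](size_iota 0); apply: uniq_leq_size (si_uniq inv) _ => v vq.
by rewrite mem_iota /= add0n (si_lt inv).
Qed.

Lemma current_notin : h < size q -> nth 0 q h \notin take h q.
Proof.
move=> hq; have := si_uniq inv; rewrite -{1}(cat_take_drop h q) cat_uniq.
case/and3P=> _ /hasPn no _; apply: no; rewrite (drop_nth 0 hq) inE eqxx.
by [].
Qed.

Lemma comp_current : h < size q -> comp (nth 0 q h) = c.
Proof. by move=> hq; apply: (si_last inv); [apply: mem_nth | apply: current_notin]. Qed.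

Lemma search_pop : h < size q -> p = 0 ->
  let p' := first_arc (nth 0 q h.+1) in
  search_inv q h.+1 p' j c comp root sg /\ todo q h.+1 p' j < todo q h p j.
Proof.
move=> hq p0 p'.
have sub r : r < size A -> followed q h.+1 p' r -> followed q h p r.
  move=> rA; rewrite /followed (take_nth 0 hq) mem_rcons inE p0 leq0n andbT hq /=.
  case/orP => [/orP[-> |->]|/and3P[h1 /eqP rh pr]]; rewrite ?orbT //.
  have [_ [_ no]] := first_arcP (nth 0 q h.+1).
  by have := no r; rewrite -/p' pr rA rh eqxx => /(_ isT).
have sub' r : followed q h p r -> followed q h.+1 p' r.
  rewrite /followed (take_nth 0 hq) mem_rcons inE.
  by case/orP => [->|/and3P[_ -> _]]; rewrite ?orbT.
split; last first.
  rewrite /todo.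
  have := @sub_count _ (fun r => ~~ followed q h.+1 p' r) (fun r => ~~ followed q h p r)
     (fun r => contra (sub' r)) (iota 0 (size A)).
  lia.
split; try by case: inv.
- by move=> r rA /(sub r rA); apply: si_closed inv _ rA.
- move=> v vq; rewrite (take_nth 0 hq) mem_rcons inE negb_or => /andP[_].
  exact: si_last inv v vq.
- move=> hq'; have [h1 [h2 _]] := first_arcP (nth 0 q h.+1).
  by split.
- have [h1 h2] := si_jn inv; split=> //; case: h2 => [|]; first by left.
  by rewrite leqNgt hq.
Qed.

Lemma search_skip : size q <= h -> j < n -> j \in q ->
  search_inv q h p j.+1 c comp root sg /\ todo q h p j.+1 < todo q h p j.
Proof.
move=> qh jn jq; split; last by rewrite /todo; lia.
split; try by case: inv.
- by move=> v; rewrite ltnS leq_eqVlt => /orP[/eqP -> //|]; apply: si_j inv v.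
- by split=> //; right.
Qed.

Lemma search_root : size q <= h -> j < n -> j \notin q ->
  let q' := rcons q j in
  search_inv q' h (first_arc j) j c.+1 (upd comp j c.+1) (upd root c.+1 j) (upd sg j false)
  /\ todo q' h (first_arc j) j < todo q h p j.
Proof.
move=> qh jn jq q'.
have hE : h = size q by apply/eqP; rewrite eqn_leq (si_h inv) qh.
have tk : take h q' = q by rewrite hE /q' -cats1 take_size_cat.
have tk0 : take h q = q by rewrite hE take_size.
have nj v : v \in q -> (v == j) = false by move=> vq; apply/negbTE; apply: contraNneq jq => <-.
have fq r : followed q h p r = (arc_src r \in q).
  by rewrite /followed tk0 hE ltnn /= orbF.
have hq' : nth 0 q' h = j by rewrite /q' nth_rcons hE ltnn eqxx.
have fq' r : r < size A -> followed q' h (first_arc j) r = (arc_src r \in q).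
  move=> rA; rewrite /followed tk hq'; case: (arc_src r \in q) => //=.
  apply/negP => /and3P[_ /eqP rj pr]; have [_ [_ no]] := first_arcP j.
  by have := no r; rewrite pr rA rj eqxx => /(_ isT).
have cN v : v \in q -> upd comp j c.+1 v = comp v by move=> /nj; rewrite /upd => ->.
split; last first.
  rewrite /todo size_rcons.
  have -> : count (fun r => ~~ followed q' h (first_arc j) r) (iota 0 (size A)) =
            count (fun r => ~~ followed q h p r) (iota 0 (size A)).
    by apply: eq_in_count => r; rewrite mem_iota /= add0n => rA; rewrite fq' // fq.
  have sq : (size q).+1 <= n.
    rewrite -(size_rcons q j) -[n](size_iota 0); apply: uniq_leq_size.
      by rewrite rcons_uniq jq (si_uniq inv).
    move=> v; rewrite mem_rcons inE mem_iota /= add0n => /orP[/eqP -> //|].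
    exact: si_lt inv v.
  lia.
split.
- by rewrite rcons_uniq jq (si_uniq inv).
- by rewrite size_rcons ltnW // ltnS (si_h inv).
- move=> v; rewrite mem_rcons inE /upd; have [_|_] := eqVneq v j; first by [].
  exact: (si_comp inv).
- by move=> v; rewrite mem_rcons inE => /orP[/eqP -> //|]; apply: si_lt inv v.
- by move=> v; rewrite /upd; case: eqP => // _; apply: leqW; apply: (si_c inv).
- move=> v; rewrite mem_rcons inE => /orP[/eqP ->|vq].
    by rewrite /upd !eqxx; apply: reach_root.
  rewrite cN // /upd nj // ltn_eqF; first exact: (si_reach inv).
  by rewrite ltnS (si_c inv).
- move=> l /andP[l0 lc]; rewrite /upd; have [->|ln] := eqVneq l c.+1.
    by rewrite mem_rcons inE !eqxx.
  have [rq rl] : root l \in q /\ comp (root l) = l by apply: (si_root inv); lia.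
  by rewrite mem_rcons inE rq orbT nj.
- move=> r rA; rewrite fq' // => sq.
  have [|dq dc] := si_closed inv rA (_ : followed q h p r); first by rewrite fq.
  by rewrite mem_rcons inE dq orbT !cN.
- move=> v; rewrite tk mem_rcons inE => /orP[/eqP ->|->] // _.
  by rewrite /upd eqxx.
- rewrite hq' => _; have [h1 [h2 _]] := first_arcP j.
  by [].
- by move=> v vj; rewrite mem_rcons inE (si_j inv) // orbT.
- by split; [apply: ltnW|left].
- by rewrite size_rcons ltnS (si_cq inv).
Qed.

(** If the target is finished, the reverse arc has been followed and gives the
    equality of the labels; otherwise both ends are in the current class. *)
Lemma search_known : h < size q -> p != 0 -> arc_dst p.-1 \in q ->
  let p' := next_arc p.-1 in
  search_inv q h p' j c comp root sg /\ todo q h p' j < todo q h p j.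
Proof.
move=> hq p0 uq p'.
have [pA /(_ p0) sp] := si_p inv hq.
have pA' : p.-1 < size A by lia.
have [n1 [n2 n3]] := next_arcP pA'.
have pp : followed q h p' p.-1 by rewrite /followed hq sp eqxx /p' n1 orbT.
have np : ~~ followed q h p p.-1.
  rewrite /followed sp (negbTE (current_notin hq)) /= negb_and hq eqxx /=; lia.
have mono r : followed q h p r -> followed q h p' r.
  rewrite /followed => /orP[->//|/and3P[-> -> /=]] pr.
  by rewrite (_ : p' <= r) ?orbT // /p'; lia.
have cases r : followed q h p' r -> r = p.-1 \/ followed q h p r.
  rewrite /followed => /orP[->|/and3P[_ /eqP re pr]]; first by right.
  rewrite hq re eqxx /=; have [|] := leqP p r; first by right; rewrite orbT.
  move=> rp; have [->|rn] := eqVneq r p.-1; first by left.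
  have := n3 r; rewrite -/p' pr sp re eqxx (_ : r < p.-1); last by lia.
  by move/(_ isT).
split; last first.
  rewrite /todo; have := @count_sub_lt _ (fun r => ~~ followed q h p r)
    (fun r => ~~ followed q h p' r) (iota 0 (size A)).
  suff H : subpred (fun r => ~~ followed q h p' r) (fun r => ~~ followed q h p r) /\
    has (fun x => ~~ followed q h p x && ~~ ~~ followed q h p' x) (iota 0 (size A)).
    by case: H => H1 H2 /(_ H1 H2); lia.
  split; first by move=> r; apply: contra; apply: mono.
  by apply/hasP; exists p.-1; rewrite ?mem_iota ?np ?pp.
split; try by case: inv.
- move=> r rA /cases[->|]; last exact: si_closed inv r rA.
  split=> //; rewrite sp comp_current //.
  (* a finished target has followed the reverse arc *)
  have [ut|ut] := boolP (arc_dst p.-1 \in take h q); last exact: (si_last inv).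
  have := A_sym (arc_mem pA'); case/arc_index => r' rA' rE.
  have fr : followed q h p r' by rewrite /followed /arc_src rE /src /= ut.
  have [_] := si_closed inv rA' fr; rewrite /arc_dst /arc_src rE /src /dst /=.
  by rewrite -/(src _) -/(arc_src _) sp comp_current.
- by move=> _; split; [rewrite /p'; lia|rewrite -sp; apply: n2].
Qed.

(** Following an arc to a new vertex is to label the vertex, and then to follow
    an arc between seen vertices ([search_known]). *)
Lemma search_new : h < size q -> p != 0 -> arc_dst p.-1 \notin q ->
  let u := arc_dst p.-1 in let q' := rcons q u in
  let sg' := upd sg u (sg (nth 0 q h) (+) arc_par p.-1) in
  search_inv q' h p j c (upd comp u c) root sg' /\ todo q' h p j <= todo q h p j.
Proof.
move=> hq p0 uq u q' sg'.
have [pA /(_ p0) sp] := si_p inv hq.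
have pA' : p.-1 < size A by lia.
have arcp := arc_mem pA'.
have un : u < n := A_dst arcp.
have nj v : v \in q -> (v == u) = false.
  by move=> vq; apply/negbTE; apply/eqP => E; rewrite -/u -E vq in uq.
have tk : take h q' = take h q by rewrite /q' -cats1 takel_cat // (si_h inv).
have nt : nth 0 q' h = nth 0 q h by rewrite /q' nth_rcons hq.
have fq r : followed q' h p r = followed q h p r.
  by rewrite /followed tk nt size_rcons hq (leqW hq).
have cN v : v \in q -> upd comp u c v = comp v by move=> /nj; rewrite /upd => ->.
have vq : nth 0 q h \in q by apply: mem_nth.
have c0 : 0 < c.
  by rewrite -(comp_current hq) lt0n (si_comp inv).
split; last first.
  rewrite /todo size_rcons (eq_count (a2 := fun r => ~~ followed q h p r)); last first.
    by move=> r; rewrite fq.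
  have sq : (size q).+1 <= n.
    rewrite -(size_rcons q u) -[n](size_iota 0); apply: uniq_leq_size.
      by rewrite rcons_uniq uq (si_uniq inv).
    move=> v; rewrite mem_rcons inE mem_iota /= add0n => /orP[/eqP -> //|].
    exact: si_lt inv v.
  lia.
split.
- by rewrite rcons_uniq uq (si_uniq inv).
- by rewrite size_rcons ltnW // ltnS (si_h inv).
- move=> v; rewrite mem_rcons inE /upd; have [_|_] := eqVneq v u; first by rewrite -lt0n c0.
  exact: (si_comp inv).
- by move=> v; rewrite mem_rcons inE => /orP[/eqP -> //|]; apply: si_lt inv v.
- by move=> v; rewrite /upd; case: eqP => // _; apply: (si_c inv).
- move=> v; rewrite mem_rcons inE => /orP[/eqP ->|vq']; last first.
    by rewrite cN // /sg' /upd nj //; apply: (si_reach inv).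
  rewrite /sg' /upd eqxx; apply: reach_arc (_ : reach _ (nth 0 q h) _) _.
    by have := si_reach inv vq; rewrite comp_current.
  by rewrite -sp.
- move=> l lc; have [rq rl] := si_root inv lc.
  by rewrite mem_rcons inE rq orbT cN.
- move=> r rA; rewrite fq => fr; have [dq dc] := si_closed inv rA fr.
  have sq : arc_src r \in q.
    by case/orP: fr => [/mem_take //|/and3P[_ /eqP -> _]].
  by rewrite mem_rcons inE dq orbT !cN.
- move=> v; rewrite tk mem_rcons inE => /orP[/eqP ->|vq'] nv; first by rewrite /upd eqxx.
  by rewrite cN // (si_last inv).
- by rewrite nt => _; split.
- by move=> v vj; rewrite mem_rcons inE (si_j inv) // orbT.
- have [h1 h2] := si_jn inv; split=> //; case: h2 => [|]; first by left.
  by rewrite leqNgt hq.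
- by rewrite size_rcons; apply: leqW; apply: si_cq inv.
Qed.

End Steps.

Lemma search_init : search_inv [::] 0 0 0 0 (fun=> 0) (fun=> 0) (fun=> false).
Proof.
split=> //.
- by move=> l; lia.
- by split=> //; right.
Qed.

End Search.

(** * Breadth-first search: the program *)

(** With truncated subtraction, (a - b) + (b - a) is the exclusive or of two
    bits. *)
Definition visit_dst : cmd :=
  NSet a_label (nvar x_dst) (nvar x_labels);;
  NSet a_sign (nvar x_dst)
    (NAdd (NSub (NGet a_sign (NGet a_queue (nvar x_done))) (NGet a_parity (nvar x_arc)))
          (NSub (NGet a_parity (nvar x_arc)) (NGet a_sign (NGet a_queue (nvar x_done)))));;
  NSet a_queue (nvar x_seen) (nvar x_dst);;
  nincr x_seen.

Definition visit_root : cmd :=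
  nincr x_labels;;
  NSet a_label (nvar x_root) (nvar x_labels);;
  NSet a_sign (nvar x_root) (NConst 0);;
  NSet a_queue (nvar x_seen) (nvar x_root);;
  nincr x_seen;;
  nassign x_arc (NGet a_head (nvar x_root)).

(** The loops over the roots, the queue and the arcs are merged into one, which
    is paid for by a single potential. The root stays under examination until
    its whole class is finished. *)
Definition search_step : cmd :=
  If (nlt (nvar x_done) (nvar x_seen))
    (If (nzero (nvar x_arc))
       (nincr x_done;; nassign x_arc (NGet a_head (NGet a_queue (nvar x_done))))
       (nassign x_dst (NGet a_dst (nvar x_arc));;
        If (nzero (NGet a_label (nvar x_dst))) visit_dst Skip;;
        nassign x_arc (NGet a_next (nvar x_arc))))
    (If (nzero (NGet a_label (nvar x_root))) visit_root (nincr x_root)).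

Definition search : cmd := While (nlt (nvar x_root) dim_cols) search_step.

Definition search_unit : nat := max_cost search_step + 8.

Section SearchCorrect.
Variables (R : realType) (n : nat) (A : seq signed_arc).
Implicit Types s : state R.
Hypothesis A_sym : forall a b x, (a, b, x) \in A -> (b, a, x) \in A.
Hypothesis A_dst : forall a b x, (a, b, x) \in A -> b < n.

Definition stores_search s q h p j c comp (sg : nat -> bool) : Prop :=
  [/\ forall v, nmem s a_label v = comp v, forall v, nmem s a_sign v = sg v,
      forall i, nmem s a_queue i = nth 0 q i &
      [/\ nmem s x_labels 0 = c, nmem s x_done 0 = h, nmem s x_seen 0 = size q,
          nmem s x_arc 0 = p & nmem s x_root 0 = j]].

Definition todo_of s : nat :=
  todo n A (mkseq (nmem s a_queue) (nmem s x_seen 0)) (nmem s x_done 0) (nmem s x_arc 0) (nmem s x_root 0).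

Lemma todo_ofE s q h p j c comp sg :
  stores_search s q h p j c comp sg -> todo_of s = todo n A q h p j.
Proof.
case=> _ _ mq [_ mh mt mp mj]; rewrite /todo_of mh mt mp mj; congr todo.
apply: (@eq_from_nth _ 0); rewrite size_mkseq // => i iq.
by rewrite nth_mkseq // mq.
Qed.

Lemma search_stepP s q h p j c comp root sg :
  stores_arcs s A -> search_inv n A q h p j c comp root sg ->
  stores_search s q h p j c comp sg -> j < n ->
  exists q' h' p' j' c' comp' root' sg',
    [/\ search_inv n A q' h' p' j' c' comp' root' sg',
        stores_search (run search_step s) q' h' p' j' c' comp' sg' &
        todo n A q' h' p' j' < todo n A q h p j].
Proof.
move=> [_ headA arcA] inv [m13 m14 m15 [m37 m38 m39 m40 m41]] jn.
rewrite /search_step run_if [beval _ _]/= m38 m39 -ltnNge.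
have [hq|qh] := ltnP h (size q); last first.
  rewrite run_if [beval _ _]/= m41 m13 leqn0.
  have [cj|cj] := eqVneq (comp j) 0.
    have jq : j \notin q by rewrite -(si_comp inv) cj.
    have [i1 i2] := search_root inv qh jn jq.
    exists (rcons q j), h, (first_arc A j), j, c.+1, (upd comp j c.+1),
       (upd root c.+1 j), (upd sg j false); split=> //.
    rewrite /visit_root !run_simp; split=> [v|v|i|] /=;
      rewrite ?m41 ?m37 ?m39 ?m38 /= ?addn1 //.
    - by rewrite m13 /upd; case: eqP.
    - by rewrite m14 /upd; case: eqP.
    - rewrite nth_rcons m15; case: (ltngtP i (size q)) => // iq.
      by rewrite nth_default // ltnW.
    - by rewrite size_rcons /first_arc headA.
  have jq : j \in q by rewrite -(si_comp inv) cj.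
  have [i1 i2] := search_skip inv qh jn jq.
  exists q, h, p, j.+1, c, comp, root, sg; split=> //.
  by rewrite !run_simp; split=> [v|v|i|] /=; rewrite ?m41 ?addn1.
rewrite run_if [beval _ _]/= m40 leqn0.
have [p0|p0] := eqVneq p 0.
  have [i1 i2] := search_pop inv hq p0.
  exists q, h.+1, (first_arc A (nth 0 q h.+1)), j, c, comp, root, sg; split=> //.
  rewrite !run_simp; split=> [v|v|i|] /=; rewrite ?m38 ?addn1 //.
  by rewrite m15 headA.
have [pA sp] := si_p inv hq.
have [|a10 a11 a12] := arcA p.-1; first by lia.
have pS : p.-1.+1 = p by lia.
rewrite pS in a10 a11 a12.
rewrite run_seq run_nset; set s1 := nset s _ _ _.
have e42 : nmem s1 x_dst 0 = arc_dst A p.-1 by rewrite /= m40 a11.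
have e40 : nmem s1 x_arc 0 = p by [].
have e10 : nmem s1 a_next p = next_arc A p.-1 by [].
have e12 : nmem s1 a_parity p = arc_par A p.-1 by [].
have st1 : stores_search s1 q h p j c comp sg by [].
clearbody s1.
have [b13 b14 b15 [b37 b38 b39 b40 b41]] := st1.
rewrite run_seq run_if [beval _ _]/= e42 b13 leqn0.
have [cu|cu] := eqVneq (comp (arc_dst A p.-1)) 0; last first.
  have uq : arc_dst A p.-1 \in q by rewrite -(si_comp inv) cu.
  have [i1 i2] := search_known A_sym inv hq p0 uq.
  exists q, h, (next_arc A p.-1), j, c, comp, root, sg; split=> //.
  by rewrite run_nset; split=> [v|v|i|] //=; rewrite e40.
have uq : arc_dst A p.-1 \notin q by rewrite -(si_comp inv) cu.
have [i1 i2] := search_new A_dst inv hq p0 uq.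
have hq' : h < size (rcons q (arc_dst A p.-1)) by rewrite size_rcons ltnW.
have uq' : arc_dst A p.-1 \in rcons q (arc_dst A p.-1) by rewrite mem_rcons inE eqxx.
have [i3 i4] := search_known A_sym i1 hq' p0 uq'.
exists (rcons q (arc_dst A p.-1)), h, (next_arc A p.-1), j, c,
  (upd comp (arc_dst A p.-1) c), root,
  (upd sg (arc_dst A p.-1) (sg (nth 0 q h) (+) arc_par A p.-1)).
split=> //; last exact: leq_trans i4 i2.
rewrite /visit_dst !run_simp; split=> [v|v|i|] /=;
  rewrite ?e42 ?b37 ?b38 ?b39 ?b40 ?b41 /= ?addn1 //.
- by rewrite b13 /upd; case: eqP.
- rewrite b15 e12 /upd !b14; case: eqP => // _.
  by case: (sg (nth 0 q h)) (arc_par A p.-1) => [] [].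
- rewrite nth_rcons b15; case: (ltngtP i (size q)) => // iq.
  by rewrite nth_default // ltnW.
- by rewrite size_rcons.
Qed.

(** Since the sign of a vertex is the parity of a path from the root of its
    class, the signs can be compared with those of any regulation. *)
Definition labelling c (comp : nat -> nat) (root : nat -> nat) (sg : nat -> bool) : Prop :=
  [/\ c <= n,
      forall v, v < n -> 0 < comp v <= c /\ reach A (root (comp v)) v (sg v),
      forall l, 0 < l <= c -> root l < n /\ comp (root l) = l
    & forall a b x, (a, b, x) \in A -> comp a = comp b].

Lemma searchP s : nmem s a_dims 1 = n -> stores_arcs s A ->
  (forall a, a \in [:: 13; 14; 15; 37; 38; 39; 40; 41] -> forall i, nmem s a i = 0) ->
  wp search s (fun t s' =>
    [/\ exists root, exists2 sg : nat -> bool, (forall v, nmem s' a_sign v = sg v) &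
          labelling (nmem s' x_labels 0) (nmem s' a_label) root sg
      & t <= search_unit * (4 * n + size A + 1)]).
Proof.
move=> hn harc zero.
pose P s' := exists q h p j c comp root sg,
  search_inv n A q h p j c comp root sg /\ stores_search s' q h p j c comp sg.
apply: (wp_while (P := P) (phi := fun s' => search_unit * todo_of s')).
- exists [::], 0, 0, 0, 0, (fun=> 0), (fun=> 0), (fun=> false).
  split; first exact: search_init.
  by split=> [v|v|i|]; rewrite ?nth_nil ?zero //; split; rewrite zero.
- move=> s1 [ag _] [q [h [p [j [c [comp [root [sg [inv st]]]]]]]]].
  have harc1 : stores_arcs s1 A by rewrite /stores_arcs !ag.
  have [_ _ _ [_ _ _ _ m41]] := st.
  rewrite /= m41 ag // hn -ltnNge => jn; apply: wp_run => // t tC.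
  have [q' [h' [p' [j' [c' [comp' [root' [sg' [inv' st' lt]]]]]]]]] :=
    search_stepP harc1 inv st jn.
  split; first by exists q', h', p', j', c', comp', root', sg'.
  rewrite (todo_ofE st) (todo_ofE st').
  have : search_unit * (todo n A q' h' p' j').+1 <= search_unit * todo n A q h p j.
    by rewrite leq_mul2l lt orbT.
  rewrite mulnS {1}/search_unit; move: tC; lia.
move=> t s1 [ag _] [q [h [p [j [c [comp [root [sg [inv [m13 m14 m15 [m37 m38 m39 m40 m41]]]]]]]]]]].
rewrite /= m41 ag // hn -ltnNge -leqNgt => nj tb.
have [jn hq] := si_jn inv.
have qh : size q <= h by case: hq => //; lia.
have jE : j = n by apply/eqP; rewrite eqn_leq jn nj.
have allq v : v < n -> v \in q by rewrite -jE; apply: (si_j inv).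
have tk : take h q = q by rewrite take_oversize.
split.
  exists root, sg; first exact: m14; split; rewrite ?m37.
  - exact: leq_trans (si_cq inv) (search_size_q inv).
  - move=> v vn; rewrite m13; split; last exact: (si_reach inv) (allq v vn).
    by rewrite (si_c inv) andbT lt0n (si_comp inv) allq.
  - by move=> l lc; have [/(si_lt inv) ? ?] := si_root inv lc; rewrite m13.
  - move=> a b x abx; rewrite !m13.
    have /arc_index[r rA rE] := A_sym abx.
    have fr : followed A q h p r.
      rewrite /followed tk allq // /arc_src rE /src /=; exact: A_dst abx.
    by have [_] := si_closed inv rA fr; rewrite /arc_dst /arc_src rE /src /dst.
apply: leq_trans tb _.
have start : todo_of s <= 4 * n + size A.
  have [z15 z38 z39 z40 z41] : [/\ nmem s a_queue 0 = 0, nmem s x_done 0 = 0, nmem s x_seen 0 = 0,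
    nmem s x_arc 0 = 0 & nmem s x_root 0 = 0] by split; rewrite zero.
  rewrite /todo_of /todo z38 z39 z40 z41 size_mkseq subn0.
  have := count_size (fun r => ~~ followed A (mkseq (nmem s a_queue) 0) 0 0 r) (iota 0 (size A)).
  by rewrite size_iota; lia.
by rewrite mulnDr muln1 -addnA leq_add // leq_mul2l start orbT.
Qed.

End SearchCorrect.

(** * Regulable classes, numbering and weights of the columns *)

Definition sign_diff : nexpr :=
  NAdd (NSub (NGet a_sign (nvar x_col1)) (NGet a_sign (nvar x_col2)))
       (NSub (NGet a_sign (nvar x_col2)) (NGet a_sign (nvar x_col1))).

Definition check_row : cmd :=
  If (nzero (NGet a_isinner (nvar x_i)))
    (load_row;;
     If (nzero (nvar x_len)) Skip
       (load_fst;;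
        If (BNle (nvar x_len) (NConst 1)) (NSet a_bad (NGet a_label (nvar x_col1)) (NConst 1))
          (load_snd;;
           If (BAnd (BNle sign_diff (nvar x_parity)) (BNle (nvar x_parity) sign_diff)) Skip
             (NSet a_bad (NGet a_label (nvar x_col1)) (NConst 1)))))
    Skip.

Definition check_rows : cmd := For x_i dim_rows check_row.

Definition assign_column (l : nexpr) : cmd := nincr x_columns;; NSet a_column l (nvar x_columns).

Definition number_zero : cmd :=
  For x_i dim_cols
    (If (nzero (NGet a_nonzero (nvar x_i))) (assign_column (NGet a_label (nvar x_i))) Skip).

Definition number_classes : cmd :=
  For x_i (nvar x_labels)
    (If (BAnd (nzero (NGet a_bad (NAdd (nvar x_i) (NConst 1))))
              (nzero (NGet a_column (NAdd (nvar x_i) (NConst 1)))))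
       (assign_column (NAdd (nvar x_i) (NConst 1))) Skip).

Definition target (v : nexpr) : nexpr := NGet a_column (NGet a_label v).

Definition sum_weights : cmd :=
  For x_i dim_cols
    (RSet r_classwt (target (nvar x_i))
       (RAdd (RGet r_classwt (target (nvar x_i))) (RDiv (RConst 1) (RGet r_w (nvar x_i))))).

Section Numbering.
Variable R : realType.
Implicit Types s : state R.

Lemma mark_innerP s (m : nat) (l : seq nat) (inner : nat -> bool) :
  nmem s a_dims 2 = size l -> (forall r, r < size l -> nmem s a_inner r = nth 0 l r) ->
  (forall i, inner i = (i \in l)) -> (forall i, nmem s a_isinner i = 0) ->
  wp mark_inner s (fun t s' => stores_inner m inner s' /\
    t <= for_cost dim_inner (size l) 20).
Proof.
move=> hs hl innerE h7.
apply: (wp_for (N := size l) (C := 20)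
   (P := fun r s' => forall i, nmem s' a_isinner i = (i \in take r l))) => //.
- by move=> s1 [ag _] /=; rewrite ag.
- by move=> i /=; rewrite h7 take0.
- move=> r s1 rl [ag _] xr h; apply: wp_run => // t tC; split=> [|i]; first exact: leq_trans tC _.
  rewrite run_nset /= xr ag // hl // (take_nth 0 rl) mem_rcons inE.
  by case: eqP.
by move=> t s1 _ h tC; split=> // i _; rewrite h take_size innerE.
Qed.

Section Check.
Variables (m n : nat) (rowE : nat -> seq (nat * bool)) (inner : nat -> bool).
Hypothesis rowE_le2 : forall i, i < m -> size (rowE i) <= 2.
Variables (comp : nat -> nat) (sg : nat -> bool).

(** Such a row prevents the class [l] from being regulated by the signs of the
    search. *)
Definition row_bad i l : bool :=
  match rowE i with
  | [:: (a, _)] => comp a == l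
  | [:: (a, x); (b, y)] => (sg a (+) sg b != (x == y)) && (comp a == l)
  | _ => false
  end.

Definition bad_upto i l := has (fun r => ~~ inner r && row_bad r l) (iota 0 i).

Lemma bad_uptoS i l : bad_upto i.+1 l = bad_upto i l || (~~ inner i && row_bad i l).
Proof. by rewrite /bad_upto -[i.+1]addn1 iotaD has_cat /= orbF add0n. Qed.

Lemma check_rowsP s : stores_rows m n rowE s -> stores_inner m inner s ->
  (forall v, nmem s a_label v = comp v) -> (forall v, nmem s a_sign v = sg v) ->
  (forall l, nmem s a_bad l = 0) ->
  wp check_rows s (fun t s' => (forall l, nmem s' a_bad l = bad_upto m l) /\
     t <= for_cost dim_rows m (max_cost check_row)).
Proof.
move=> [hm hn hrow] hin h13 h14 h16.
apply: (wp_for (N := m) (C := max_cost check_row)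
  (P := fun i s' => forall l, nmem s' a_bad l = bad_upto i l)) => //.
- by move=> s1 [ag _] /=; rewrite ag.
- move=> i s1 im [agn agr] xi h161.
  apply: wp_run => // t tC; split=> {t tC}//.
  suff h l : nmem (run check_row s1) a_bad l = bad_upto i l || (~~ inner i && row_bad i l).
    by move=> l; rewrite bad_uptoS -h.
  have [r1 re] := hrow i im.
  rewrite /check_row run_if [beval _ _]/= xi agn // hin //.
  case ini: (inner i); first by rewrite orbF.
  rewrite run_seq; have [ag2 rg2] := @run_agree _ load_row s1 isT.
  have e31 : nmem (run load_row s1) x_first 0 = nmem s a_rowptr i.
    by rewrite /load_row !run_simp /= xi agn.
  have e32 : nmem (run load_row s1) x_len 0 = size (rowE i).
    by rewrite /load_row !run_simp /= xi agn // addn1 r1 addKn.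
  move: (run load_row s1) ag2 rg2 e31 e32 => s2 ag2 rg2 e31 e32.
  have k2 : nmem s2 a_colidx = nmem s a_colidx by rewrite ag2 // agn.
  have k13 v : nmem s2 a_label v = comp v by rewrite ag2 // agn.
  have k14 v : nmem s2 a_sign v = sg v by rewrite ag2 // agn.
  have k16 v : nmem s2 a_bad v = bad_upto i v by rewrite ag2 // h161.
  have k0 : rmem s2 r_val = rmem s r_val by rewrite rg2 // agr.
  rewrite run_if [beval _ _]/= e32 /row_bad.
  case: (rowE i) (rowE_le2 im) re e32 => [|[a x] [|[b y] [|//]]] _ re e32.
  - by rewrite orbF; exact: k16.
  - rewrite [_ <= 0]/= run_seq run_if /load_fst run_nset [beval _ _]/= e32 run_nset /= e31 k2.
    have [/=] := re 0 isT; rewrite addn0 => -> _; rewrite k13 k16 eq_sym.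
    by case: eqP; rewrite ?orbT ?orbF.
  have [c0 v0] := re 0 isT; have [c1 v1] := re 1 isT; rewrite addn0 /= in c0 v0.
  rewrite /= in c1 v1.
  rewrite [size _ <= 0]/= run_seq /load_fst run_nset run_if [beval _ _]/=.
  set s3 := nset _ _ _ _.
  have f31 : nmem s3 x_first 0 = nmem s a_rowptr i by [].
  have f32 : nmem s3 x_len 0 = 2 by [].
  have f33 : nmem s3 x_col1 0 = a by rewrite /= e31 k2.
  have f2 : nmem s3 a_colidx = nmem s a_colidx by [].
  have f0 : rmem s3 r_val = rmem s r_val by [].
  have f13 v : nmem s3 a_label v = comp v by rewrite -k13.
  have f14 v : nmem s3 a_sign v = sg v by rewrite -k14.
  have f16 v : nmem s3 a_bad v = bad_upto i v by rewrite -k16.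
  clearbody s3.
  rewrite e32 [_ <= 1]/= run_seq run_if.
  have [|||g34 g35] := @load_sndP _ s3 (nmem s a_rowptr i) x y; rewrite ?f0 //.
  have [agl rgl] := @run_agree _ load_snd s3 isT.
  move: (run load_snd s3) g34 g35 agl rgl => s4 g34 g35 agl rgl.
  rewrite f2 c1 in g34.
  rewrite [beval _ _]/= g34 g35 !agl // f33 !f14.
  have -> : ((sg a - sg b + (sg b - sg a) <= (x == y)) &&
            ((x == y) <= sg a - sg b + (sg b - sg a))) = (sg a (+) sg b == (x == y)).
    by case: (sg a) (sg b) (x == y) => [] [] [].
  case: (sg a (+) sg b == (x == y)); first by rewrite orbF [run _ _]/= agl // f16.
  rewrite run_nset /= !agl // f33 f13 f16 [comp a == l]eq_sym.
  by case: eqP; rewrite ?orbT ?orbF.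
Qed.

End Check.

(** The list [X] determines the whole array, so that numbering a column is [rcons]. *)
Definition stores_columns s (X : seq nat) : Prop :=
  nmem s x_columns 0 = size X /\
  forall l, nmem s a_column l = if l \in X then (index l X).+1 else 0.

Lemma assign_columnP s X e l : l \notin X ->
  neval (nset s 43 0 (size X).+1) e = l -> stores_columns s X ->
  stores_columns (run (assign_column e) s) (rcons X l).
Proof.
move=> lX el [h43 h17]; rewrite /assign_column !run_simp; split=> [|l'] /=.
  by rewrite size_rcons h43 addn1.
rewrite h43 addn1 el mem_rcons inE -cats1 index_cat h17.
have [->|ll] := eqVneq l' l; last by case: ifP.
by rewrite (negbTE lX) /= eqxx addn0.
Qed.

Lemma number_zeroP s n (comp : nat -> nat) (nz : nat -> bool) :
  nmem s a_dims 1 = n -> (forall v, nmem s a_label v = comp v) ->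
  (forall v, nmem s a_nonzero v = nz v) ->
  {in [pred v | (v < n) && ~~ nz v] &, injective comp} -> stores_columns s [::] ->
  wp number_zero s (fun t s' =>
    stores_columns s' [seq comp v | v <- iota 0 n & ~~ nz v] /\
    t <= for_cost dim_cols n 20).
Proof.
move=> hn h13 h8 inj h0.
apply: (wp_for (N := n) (C := 20)
  (P := fun i s' => stores_columns s' [seq comp v | v <- iota 0 i & ~~ nz v])) => //.
- by move=> s1 [ag _] /=; rewrite ag.
- move=> i s1 iN [ag _] xi h; apply: wp_run => // t tC; split; first exact: leq_trans tC _.
  suff H : stores_columns (run (If (nzero (NGet a_nonzero (nvar x_i))) (assign_column (NGet a_label (nvar x_i))) Skip) s1)
     ([seq comp v | v <- iota 0 i & ~~ nz v] ++ (if nz i then [::] else [:: comp i])).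
    have -> : [seq comp v | v <- iota 0 i.+1 & ~~ nz v] =
       [seq comp v | v <- iota 0 i & ~~ nz v] ++ (if nz i then [::] else [:: comp i]).
      by rewrite -[i.+1]addn1 iotaD filter_cat map_cat /= add0n; case: (nz i).
    exact: H.
  rewrite run_if [beval _ _]/= xi ag // h8.
  case nzi: (nz i); first by rewrite cats0.
  rewrite cats1; apply: assign_columnP => //; last by rewrite /= xi ag.
  apply/mapP => -[v]; rewrite mem_filter mem_iota /= add0n => /andP[nv vi] E.
  have : i = v by apply: inj => //; rewrite inE ?iN ?nzi // nv (ltn_trans vi iN).
  by move=> iv; rewrite iv ltnn in vi.
Qed.

Lemma number_classesP s c (bad : nat -> bool) (X : seq nat) :
  nmem s x_labels 0 = c -> (forall l, nmem s a_bad l = bad l) ->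
  stores_columns s X ->
  wp number_classes s (fun t s' =>
    stores_columns s' (X ++ [seq l <- iota 1 c | ~~ bad l & l \notin X]) /\
    t <= for_cost (nvar x_labels) c 30).
Proof.
move=> hc hb h0.
pose Y i := X ++ [seq l <- iota 1 i | ~~ bad l & l \notin X].
apply: (wp_for (N := c) (C := 30) (P := fun i s' => stores_columns s' (Y i))) => //.
- by move=> s1 [ag _] /=; rewrite ag.
- by rewrite /Y cats0.
- move=> i s1 iN [ag _] xi h; apply: wp_run => // t tC; split; first exact: leq_trans tC _.
  set body := If _ _ _.
  suff H : stores_columns (run body s1)
     (Y i ++ (if ~~ bad i.+1 && (i.+1 \notin X) then [:: i.+1] else [::])).
    have -> : Y i.+1 = Y i ++ (if ~~ bad i.+1 && (i.+1 \notin X) then [:: i.+1] else [::]).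
      by rewrite /Y -[i.+1]addn1 iotaD filter_cat catA /= [1 + i]addnC addn1.
    exact: H.
  rewrite /body run_if [beval _ _]/= xi ag // addn1 hb.
  have [h43 h17] := h; rewrite h17.
  have -> : ((if i.+1 \in Y i then (index i.+1 (Y i)).+1 else 0) <= 0) = (i.+1 \notin X).
    rewrite /Y mem_cat mem_filter mem_iota add1n ltnn !andbF orbF.
    by case: (i.+1 \in X).
  have -> : (bad i.+1 <= 0) = ~~ bad i.+1 by case: (bad _).
  case: ifP => [/andP[nb nX]|_]; last by rewrite cats0.
  rewrite cats1; apply: assign_columnP => //; last by rewrite /= xi addn1.
  by rewrite /Y mem_cat negb_or nX mem_filter mem_iota add1n ltnn !andbF.
Qed.

Lemma sum_weightsP s n (tgt : nat -> nat) (w : nat -> R) :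
  nmem s a_dims 1 = n -> (forall v, v < n -> nmem s a_column (nmem s a_label v) = tgt v) ->
  (forall v, v < n -> rmem s r_w v = w v) -> (forall c, rmem s r_classwt c = 0%R) ->
  wp sum_weights s (fun t s' =>
    (forall c, rmem s' r_classwt c = \sum_(v <- iota 0 n | tgt v == c) (w v)^-1)%R /\
    t <= for_cost dim_cols n 30).
Proof.
move=> hn htgt hw h8.
apply: (wp_for (N := n) (C := 30) (P := fun i s' =>
   forall c, rmem s' r_classwt c = \sum_(v <- iota 0 i | tgt v == c) (w v)^-1)%R) => //.
- by move=> s1 [ag _] /=; rewrite ag.
- by move=> c /=; rewrite big_nil h8.
- move=> i s1 iN [ag rg] xi h; apply: wp_run => // t tC; split; first exact: leq_trans tC _.
  move=> c; have -> : (\sum_(v <- iota 0 i.+1 | tgt v == c) (w v)^-1 =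
     \sum_(v <- iota 0 i | tgt v == c) (w v)^-1 + if tgt i == c then (w i)^-1 else 0)%R.
    by rewrite -[i.+1]addn1 iotaD big_cat big_cons big_nil /= add0n addr0.
  rewrite run_rset /= xi !ag // htgt // h rg // hw // div1r.
  by rewrite [c == _]eq_sym; case: eqP => [->|_]; rewrite ?addr0 ?h.
Qed.

End Numbering.

(** * Emission of the rows of M *)

Definition load_entry (c v : nat) (e : nexpr) : cmd :=
  nassign x_col1 (NGet a_colidx e);;
  nassign c (target (nvar x_col1));;
  If (nzero (NGet a_sign (nvar x_col1)))
    (rassign v (RGet r_val e)) (rassign v (RSub (RConst 0) (RGet r_val e))).

Definition emit (c v : nat) : cmd :=
  If (nzero (nvar c)) Skip
    (If (BAnd (BRle (rvar v) (RConst 0)) (BRle (RConst 0) (rvar v))) Skip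
       (NSet a_outcol (nvar x_nnz) (NSub (nvar c) (NConst 1));;
        NSet a_outrow (nvar x_nnz) (nvar x_i);;
        RSet r_outval (nvar x_nnz)
          (RMul (RDiv (rvar v) (RSqrt (RGet r_wq (nvar x_i))))
                (RSqrt (RDiv (RConst 1) (RGet r_classwt (nvar c)))));;
        nincr x_nnz)).

Definition load_entries : cmd :=
  nassign x_first (NGet a_rowptr (NGet a_inner (nvar x_i)));;
  nassign x_len (NSub (NGet a_rowptr (NAdd (NGet a_inner (nvar x_i)) (NConst 1))) (nvar x_first));;
  nassign x_target1 (NConst 0);; nassign x_target2 (NConst 0);;
  rassign r_val1 (RConst 0);; rassign r_val2 (RConst 0);;
  If (nzero (nvar x_len)) Skip
    (load_entry x_target1 r_val1 (nvar x_first);;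
     If (BNle (nvar x_len) (NConst 1)) Skip
       (load_entry x_target2 r_val2 (NAdd (nvar x_first) (NConst 1)))).

Definition merge_entries : cmd :=
  If (BAnd (BNle (nvar x_target1) (nvar x_target2)) (BNle (nvar x_target2) (nvar x_target1)))
    (rassign r_val1 (RAdd (rvar r_val1) (rvar r_val2));; nassign x_target2 (NConst 0)) Skip.

Definition emit_entries : cmd :=
  If (BNle (nvar x_target1) (nvar x_target2)) (emit x_target1 r_val1;; emit x_target2 r_val2) (emit x_target2 r_val2;; emit x_target1 r_val1).

Definition emit_row : cmd :=
  load_entries;; merge_entries;; emit_entries;;
  NSet a_outptr (NAdd (nvar x_i) (NConst 1)) (nvar x_nnz).

Definition emit_rows : cmd := For x_i dim_inner emit_row.

Section Emission.
Variable R : realType.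
Implicit Types s : state R.

Definition coo0 : (nat * nat) * R := ((0, 0), 0%R).

Definition stores_coo s (E : seq ((nat * nat) * R)) : Prop :=
  nmem s x_nnz 0 = size E /\ forall e, e < size E ->
    [/\ nmem s a_outrow e = (nth coo0 E e).1.1, nmem s a_outcol e = (nth coo0 E e).1.2
      & rmem s r_outval e = (nth coo0 E e).2].

Variables (wqr S : nat -> R) (ent : nat -> seq (nat * R)).

(** The target 0 stands for a column that does not contribute to M, or for a
    missing entry; zero values are dropped too. *)
Definition emission r (cv : nat * R) : seq ((nat * nat) * R) :=
  if (cv.1 == 0) || (cv.2 == 0%R) then [::]
  else [:: ((r, cv.1.-1), cv.2 / Num.sqrt (wqr r) * Num.sqrt (1 / S cv.1))%R].

(** Two entries that go to the same column are added, and distinct columns are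
    put in increasing order, as the sparse format demands. *)
Definition row_emission r : seq ((nat * nat) * R) :=
  let x := nth (0, 0%R) (ent r) 0 in let y := nth (0, 0%R) (ent r) 1 in
  if x.1 == y.1 then emission r (x.1, x.2 + y.2)%R
  else if x.1 <= y.1 then emission r x ++ emission r y
  else emission r y ++ emission r x.

Definition emissions i := flatten [seq row_emission r | r <- iota 0 i].

Lemma emissionsS i : emissions i.+1 = emissions i ++ row_emission i.
Proof. by rewrite /emissions -[i.+1]addn1 iotaD map_cat flatten_cat /= cats0 add0n. Qed.

Lemma emitP s E c v r cv : (c, v) = (x_target1, r_val1) \/ (c, v) = (x_target2, r_val2) ->
  stores_coo s E -> nmem s c 0 = cv.1 -> rmem s v 0 = cv.2 -> nmem s x_i 0 = r ->
  rmem s r_wq r = wqr r -> rmem s r_classwt cv.1 = S cv.1 ->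
  stores_coo (run (emit c v) s) (E ++ emission r cv).
Proof.
move=> cvE [h49 hE] hc hv hr hw hS.
rewrite /emit run_if [beval _ _]/= hc /emission.
have [->|c0] := eqVneq cv.1 0; first by rewrite cats0; split.
rewrite leqn0 (negbTE c0) run_if [beval _ _]/= hv -eq_le.
case: eqP => [_|_]; first by rewrite cats0; split.
set x := ((r, cv.1.-1), (cv.2 / Num.sqrt (wqr r) * Num.sqrt (1 / S cv.1))%R).
have main e : e < (size E).+1 -> let y := nth (coo0) (rcons E x) e in
    [/\ (if e == size E then r else nmem s a_outrow e) = y.1.1,
        (if e == size E then cv.1 - 1 else nmem s a_outcol e) = y.1.2
      & (if e == size E then x.2 else rmem s r_outval e) = y.2].
  rewrite ltnS nth_rcons leq_eqVlt; case: eqP => [->|_] /= eE.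
    by rewrite ltnn subn1.
  by rewrite eE; apply: hE.
by rewrite cats1 !run_simp; case: cvE hc hv => -[-> ->] hc hv;
  split=> [|e] /=; rewrite size_rcons h49 ?addn1 // hc hv hr hw hS; apply: main.
Qed.

(** The memory describes, for each inner row, its entries: the 1-based column
    of M they go to (0 for none), and their value up to the sign of the column. *)
Definition stores_entries s nI : Prop :=
  forall r, r < nI -> let i := nmem s a_inner r in
    [/\ size (ent r) <= 2, nmem s a_rowptr i.+1 = nmem s a_rowptr i + size (ent r) &
     forall l, l < size (ent r) -> let v := nmem s a_colidx (nmem s a_rowptr i + l) in
       nmem s a_column (nmem s a_label v) = (nth (0, 0%R) (ent r) l).1 /\
       (if (nmem s a_sign v <= 0)%N then rmem s r_val (nmem s a_rowptr i + l)
        else 0 - rmem s r_val (nmem s a_rowptr i + l))%R = (nth (0, 0%R) (ent r) l).2].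

Lemma load_entryP s c v e : (c, v) = (x_target1, r_val1) \/ (c, v) = (x_target2, r_val2) ->
  (forall s1 a j x, a \in [:: 33; 46; 47] -> neval (nset s1 a j x) e = neval s1 e) ->
  let s' := run (load_entry c v e) s in
  nmem s' c 0 = nmem s a_column (nmem s a_label (nmem s a_colidx (neval s e))) /\
  rmem s' v 0 = (if (nmem s a_sign (nmem s a_colidx (neval s e)) <= 0)%N then rmem s r_val (neval s e)
        else 0 - rmem s r_val (neval s e))%R.
Proof.
move=> cv h s'; rewrite /s' /load_entry !run_simp run_if !run_simp.
by case: cv => -[-> ->]; rewrite /= !h //; case: ifP.
Qed.

Lemma load_entriesP s nI r : stores_entries s nI -> r < nI -> nmem s x_i 0 = r ->
  let s' := run load_entries s in
  let x := nth (0, 0%R) (ent r) 0 in let y := nth (0, 0%R) (ent r) 1 in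
  [/\ nmem s' x_target1 0 = x.1, rmem s' r_val1 0 = x.2, nmem s' x_target2 0 = y.1 & rmem s' r_val2 0 = y.2].
Proof.
move=> H /H{H}; set i := nmem s a_inner r => -[le2 hS hent] hr s'; rewrite /s' /load_entries.
rewrite !run_simp; set s1 := rset _ _ _ _.
have e31 : nmem s1 x_first 0 = nmem s a_rowptr i by rewrite /= hr.
have e32 : nmem s1 x_len 0 = size (ent r) by rewrite /= hr -/i addn1 hS addKn.
have e46 : nmem s1 x_target1 0 = 0 by [].
have e47 : nmem s1 x_target2 0 = 0 by [].
have e20 : (rmem s1 r_val1 0 = 0)%R by [].
have e21 : (rmem s1 r_val2 0 = 0)%R by [].
have ag a : a \in [:: 2; 13; 14; 17] -> nmem s1 a = nmem s a.
  by rewrite !inE => /or4P[] /eqP ->.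
have a0 : rmem s1 r_val = rmem s r_val by [].
clearbody s1.
rewrite run_if [beval _ _]/= e32.
have scalar e : e = nvar x_first \/ e = NAdd (nvar x_first) (NConst 1) ->
    (forall s2 a j x, a \in [:: 33; 46; 47] -> neval (nset s2 a j x) e = neval s2 e).
  by case=> -> s2 a j x; rewrite !inE => /or3P[] /eqP ->.
case: (ent r) le2 e32 hent => [|x1 l1] le2 e32 hent; first by split.
rewrite [size _ <= 0]/= run_seq.
have [||] := @load_entryP s1 46 20 (nvar x_first); first by left.
  by apply: scalar; left.
have [ag1 rg1] := @run_agree _ (load_entry x_target1 r_val1 (nvar x_first)) s1 isT.
move: (run (load_entry _ _ _) s1) ag1 rg1 => s2 ag1 rg1.
rewrite [neval _ _]/= e31 !ag // a0 => c1 v1.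
have [h1 h2] := hent 0 isT; rewrite addn0 in h1 h2.
rewrite run_if [beval _ _]/= ag1 // e32.
case: l1 le2 e32 hent h1 h2 => [|y1 [|//]] _ e32 hent h1 h2.
  by split; rewrite [run _ _]/= ?c1 ?v1 ?ag1 ?rg1.
rewrite [size _ <= 1]/=; have [h3 h4] := hent 1 isT.
have [||] := @load_entryP s2 47 21 (NAdd (nvar x_first) (NConst 1)); first by right.
  by apply: scalar; right.
have [ag2 rg2] := @run_agree _ (load_entry x_target2 r_val2 (NAdd (nvar x_first) (NConst 1))) s2 isT.
move: (run (load_entry _ _ _) s2) ag2 rg2 => s3 ag2 rg2.
rewrite [neval _ _]/= !ag1 // rg1 // e31 !ag // a0 => c2 v2.
by split; [rewrite ag2 // c1|rewrite rg2 // v1|rewrite c2|rewrite v2].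
Qed.

Lemma emit_rowsP s nI : nmem s a_dims 2 = nI -> stores_entries s nI ->
  (forall r, r < nI -> rmem s r_wq r = wqr r) -> (forall c, rmem s r_classwt c = S c) ->
  nmem s x_nnz 0 = 0 -> nmem s a_outptr 0 = 0 ->
  wp emit_rows s (fun t s' => [/\ stores_coo s' (emissions nI),
      forall r, r <= nI -> nmem s' a_outptr r = size (emissions r) &
      t <= for_cost dim_inner nI (max_cost emit_row)]).
Proof.
move=> hn hent hw hS h49 h5.
apply: (wp_for (N := nI) (C := max_cost emit_row) (P := fun i s' =>
   stores_coo s' (emissions i) /\ forall r, r <= i -> nmem s' a_outptr r = size (emissions r))) => //.
- by move=> s1 [ag _] /=; rewrite ag.
- by split=> // r; rewrite leqn0 => /eqP -> /=; rewrite h5.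
- move=> r s1 rI [ag rg] xr [hE hp]; apply: wp_run => // t tC; split=> {t tC} //.
  suff : stores_coo (run emit_row s1) (emissions r.+1) /\
      forall l, nmem (run emit_row s1) a_outptr l =
        if l == r.+1 then size (emissions r.+1) else nmem s1 a_outptr l.
    move: (run emit_row s1) => s' [H1 H2]; split=> // l lr; rewrite /= H2.
    by case: eqP => [->//|/eqP lr']; apply: hp; rewrite -ltnS ltn_neqAle lr'.
  rewrite /emit_row run_seq.
  have [|c1 v1 c2 v2] := @load_entriesP s1 nI r _ rI xr.
    by move=> r' /hent; rewrite !ag // rg.
  have [ag1 rg1] := @run_agree _ load_entries s1 isT.
  have hE1 : stores_coo (run load_entries s1) (emissions r).
    by rewrite /stores_coo !ag1 // rg1.
  move: (run load_entries s1) c1 v1 c2 v2 ag1 rg1 hE1 => s2 c1 v1 c2 v2 ag1 rg1 hE1.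
  rewrite run_seq.
  have [ag2 rg2] := @run_agree _ merge_entries s2 isT.
  have hE2 : stores_coo (run merge_entries s2) (emissions r).
    by rewrite /stores_coo !ag2 // rg2.
  have [x' [y' [[d1 w1 d2 w2] rE]]] : exists x' y', [/\ nmem (run merge_entries s2) x_target1 0 = x'.1,
     rmem (run merge_entries s2) r_val1 0 = x'.2, nmem (run merge_entries s2) x_target2 0 = y'.1
     & rmem (run merge_entries s2) r_val2 0 = y'.2] /\
     row_emission r = if x'.1 <= y'.1 then emission r x' ++ emission r y'
        else emission r y' ++ emission r x'.
    rewrite /row_emission /merge_entries run_if [beval _ _]/= c1 c2 -eqn_leq.
    set x := nth _ _ 0; set y := nth _ _ 1.
    case: (x.1 == y.1).
      exists (x.1, x.2 + y.2)%R, (0, y.2); rewrite !run_simp /= c1 v1 v2; split=> //.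
      by rewrite leqn0 /emission /=; case: (x.1 == 0).
    by exists x, y.
  move: (run merge_entries s2) d1 w1 d2 w2 ag2 rg2 hE2 => s3 d1 w1 d2 w2 ag2 rg2 hE2.
  rewrite run_seq.
  have r3 : nmem s3 x_i 0 = r by rewrite ag2 // ag1.
  have q3 : rmem s3 r_wq r = wqr r by rewrite rg2 // rg1 // rg // hw.
  have S3 c : rmem s3 r_classwt c = S c by rewrite rg2 // rg1 // rg // hS.
  have hE3 : stores_coo (run emit_entries s3) (emissions r.+1).
    rewrite emissionsS rE /emit_entries run_if [beval _ _]/= d1 d2.
    case: leqP => _; rewrite run_seq catA.
      have [ag4 rg4] := @run_agree _ (emit x_target1 r_val1) s3 isT.
      apply: (@emitP _ _ 47 21 r y'); rewrite ?ag4 ?rg4 //; first by right.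
      by apply: (@emitP _ _ 46 20 r x') => //; left.
    have [ag4 rg4] := @run_agree _ (emit x_target2 r_val2) s3 isT.
    apply: (@emitP _ _ 46 20 r x'); rewrite ?ag4 ?rg4 //; first by left.
    by apply: (@emitP _ _ 47 21 r y') => //; right.
  have [ag4 rg4] := @run_agree _ emit_entries s3 isT.
  move: (run emit_entries s3) ag4 rg4 hE3 => s4 ag4 rg4 hE3.
  rewrite run_nset; split; first exact: hE3.
  move=> l; rewrite /= ag4 // r3 addn1 (proj1 hE3).
  by rewrite ag4 // ag2 // ag1.
by move=> t s1 _ [? ?] ?.
Qed.

End Emission.

(** * The Lanczos iteration on a matrix in coordinate format *)

Definition map_loop (D : nat) (n : nexpr) (e : rexpr) : cmd :=
  For x_i n (RSet D (nvar x_i) e).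

Definition add_product (D S da sa : nat) : cmd :=
  For x_i (nvar x_nnz)
    (RSet D (NGet da (nvar x_i))
       (RAdd (RGet D (NGet da (nvar x_i)))
             (RMul (RGet r_outval (nvar x_i)) (RGet S (NGet sa (nvar x_i)))))).

Definition sum_squares (D dim : nat) : cmd :=
  rassign r_acc (RConst 0);;
  For x_i (nvar dim)
    (rassign r_acc (RAdd (rvar r_acc) (RMul (RGet D (nvar x_i)) (RGet D (nvar x_i))))).

(** One of the two halves of a Lanczos step: the vector in [D] is replaced, in
    place, by the normalization of the product with [S] minus [cin] times [D].
    The other half exchanges the roles of rows and columns. *)
Definition half_step (D S dim da sa cin cout : nat) : cmd :=
  map_loop D (nvar dim) (RMul (RSub (RConst 0) (rvar cin)) (RGet D (nvar x_i)));;
  add_product D S da sa;;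
  sum_squares D dim;;
  rassign cout (RSqrt (rvar r_acc));;
  map_loop D (nvar dim) (RDiv (RGet D (nvar x_i)) (rvar cout)).

Definition lanczos_step : cmd :=
  half_step r_u r_v x_height a_tallrow a_tallcol r_betaj r_alphaj;;
  half_step r_v r_u x_width a_tallcol a_tallrow r_alphaj r_betaj;;
  RSet r_alpha (nvar x_step) (rvar r_alphaj);;
  RSet r_beta (nvar x_step) (rvar r_betaj).

Definition lanczos : cmd := For x_step dim_steps lanczos_step.

Definition square_singular_values : cmd :=
  BidiagSvd dim_steps r_alpha r_beta r_sigma;;
  map_loop r_eigen dim_steps (RMul (RGet r_sigma (nvar x_i)) (RGet r_sigma (nvar x_i))).

Section Lanczos.
Variable R : realType.
Implicit Types s : state R.

Lemma map_loopP D n e (f : nat -> R) s p :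
  (forall s1, agree [:: 30] [:: D] s s1 -> neval s1 n = p) ->
  (forall s1 i, i < p -> agree [:: 30] [:: D] s s1 -> nmem s1 x_i 0 = i ->
     rmem s1 D i = rmem s D i -> reval s1 e = f i) ->
  wp (map_loop D n e) s (fun t s' =>
    (forall l, rmem s' D l = if l < p then f l else rmem s D l) /\
    t <= for_cost n p (rcost e + 10)).
Proof.
move=> hn he.
apply: (wp_for (N := p) (C := rcost e + 10) (P := fun i s' =>
  forall l, rmem s' D l = if l < i then f l else rmem s D l)) => //.
move=> i s1 ip ag xi h; apply: wp_run => // t tC; split.
  by apply: leq_trans tC _; rewrite /max_cost /=; lia.
have hei : reval s1 e = f i by apply: he => //; rewrite h ltnn.
move=> l; rewrite run_rset /= xi eqxx /= hei ltnS leq_eqVlt h.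
by case: eqP => [->|_].
Qed.

Lemma add_productP D S da sa s nnz : D != S -> D != 4 -> da != 30 -> sa != 30 ->
  nmem s x_nnz 0 = nnz ->
  wp (add_product D S da sa) s (fun t s' =>
    (forall l, rmem s' D l = rmem s D l +
       \sum_(e <- iota 0 nnz | nmem s da e == l) rmem s r_outval e * rmem s S (nmem s sa e))%R /\
    t <= for_cost (nvar x_nnz) nnz 40).
Proof.
move=> DS D4 da30 sa30 h49.
apply: (wp_for (N := nnz) (C := 40) (P := fun i s' => forall l, rmem s' D l = rmem s D l +
   \sum_(e <- iota 0 i | nmem s da e == l) rmem s r_outval e * rmem s S (nmem s sa e))%R) => //.
- by move=> s1 [ag _] /=; rewrite ag.
- by move=> l /=; rewrite big_nil addr0.
move=> i s1 iN [ag rg] xi h; apply: wp_run => // t tC; split; first exact: leq_trans tC _.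
move=> l; have -> : (\sum_(e <- iota 0 i.+1 | nmem s da e == l) rmem s r_outval e * rmem s S (nmem s sa e) =
   \sum_(e <- iota 0 i | nmem s da e == l) rmem s r_outval e * rmem s S (nmem s sa e) +
   if nmem s da i == l then rmem s r_outval i * rmem s S (nmem s sa i) else 0)%R.
  by rewrite -[i.+1]addn1 iotaD big_cat big_cons big_nil /= add0n addr0.
have r4 : rmem s1 r_outval = rmem s r_outval by rewrite rg // inE eq_sym.
have rS : rmem s1 S = rmem s S by rewrite rg // inE eq_sym.
rewrite run_rset /= xi eqxx /= !ag ?inE // r4 rS !h.
by rewrite [l == _]eq_sym; case: eqP => [->|_]; rewrite ?addr0 ?addrA.
Qed.

Lemma sum_squaresP D dim s p : D != 25 -> dim != 30 -> nmem s dim 0 = p ->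
  wp (sum_squares D dim) s (fun t s' =>
    rmem s' r_acc 0 = (\sum_(i <- iota 0 p) rmem s D i * rmem s D i)%R /\
    t <= for_cost (nvar dim) p 40 + 4).
Proof.
move=> D25 d30 hp; apply: wp_seq; apply: wp_run => // t0 t0C; rewrite run_rset.
apply: (wp_for (N := p) (C := 40) (P := fun i s' =>
  rmem s' r_acc 0 = \sum_(l <- iota 0 i) rmem s D l * rmem s D l)%R) => //.
- by move=> s1 [ag _] /=; rewrite ag ?inE.
- by rewrite /= big_nil.
- move=> i s1 iN [ag rg] xi h; apply: wp_run => // t tC; split; first exact: leq_trans tC _.
  have -> : (\sum_(l <- iota 0 i.+1) rmem s D l * rmem s D l =
     \sum_(l <- iota 0 i) rmem s D l * rmem s D l + rmem s D i * rmem s D i)%R.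
    by rewrite -[i.+1]addn1 iotaD big_cat big_cons big_nil /= add0n addr0.
  by rewrite run_rset /= xi h rg ?inE //= (negbTE D25).
move=> t s1 _ h tC; split=> //; rewrite addnC leq_add //; exact: leq_trans t0C _.
Qed.

Definition stores_vec s a n (v : 'cV[R]_n) : Prop := forall i : 'I_n, rmem s a i = v i 0%R.

(** [da], [sa] and the reals of array 4 list the nonzero entries of [A], in
    coordinate format. *)
Definition stores_entries_of s da sa nnz p q (A : 'M[R]_(p, q)) : Prop :=
  (forall e, e < nnz -> nmem s sa e < q) /\
  forall i j, A i j = (\sum_(e <- iota 0 nnz | (nmem s da e == i :> nat) && (nmem s sa e == j :> nat)) rmem s r_outval e)%R.

Lemma stores_mulmx s da sa nnz S p q (A : 'M[R]_(p, q)) (z : 'cV[R]_q) (i : 'I_p) :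
  stores_entries_of s da sa nnz A -> stores_vec s S z ->
  (\sum_(e <- iota 0 nnz | nmem s da e == i) rmem s r_outval e * rmem s S (nmem s sa e) =
   (A *m z) i 0)%R.
Proof.
move=> [lt hA] hz; rewrite mxE.
under [RHS]eq_bigr => j _ do rewrite hA mulr_suml.
rewrite (exchange_big_dep (fun e => nmem s da e == i)) /=; last by move=> j e _ /andP[].
rewrite big_seq_cond [RHS]big_seq_cond; apply: eq_bigr => e /andP[].
rewrite mem_iota /= add0n => en ei; have sq := lt e en.
rewrite (bigD1 (Ordinal sq)) /=; last by rewrite ei eqxx.
rewrite -(hz (Ordinal sq)) big1 ?addr0 // => j /andP[/andP[_ /eqP ej] nj].
by case/eqP: nj; apply: val_inj; rewrite /= ej.
Qed.

Definition half_cost p nnz := 60 * (3 * p + nnz + 5).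

Lemma half_stepP D S dim da sa cin cout s p q nnz (A : 'M[R]_(p, q))
    (y : 'cV[R]_p) (z : 'cV[R]_q) c :
  let u := (A *m z - c *: y)%R in
  uniq [:: D; S; 4; 25; cin; cout] -> 30 \notin [:: dim; da; sa] ->
  nmem s dim 0 = p -> nmem s x_nnz 0 = nnz -> stores_entries_of s da sa nnz A ->
  stores_vec s D y -> stores_vec s S z -> rmem s cin 0 = c ->
  wp (half_step D S dim da sa cin cout) s (fun t s' =>
    [/\ stores_vec s' D ((norm2 u)^-1 *: u)%R, rmem s' cout 0 = norm2 u &
        t <= half_cost p nnz]).
Proof.
move=> u; rewrite /= !inE !negb_or !andbT.
case/and5P=> /and5P[DS D4 D25 Dcin Dcout] /and4P[S4 S25 Scin Scout] _ _ _.
move=> /and3P[dim30 da30 sa30] hdim h49 hA hy hz hc.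
rewrite eq_sym in dim30; rewrite eq_sym in da30; rewrite eq_sym in sa30.
have notin a b : a != b -> b \notin [:: a] by move=> ab; rewrite inE eq_sym.
apply: wp_seq; apply: (wp_conseq _ (@map_loopP D (nvar dim)
  (RMul (RSub (RConst 0) (rvar cin)) (RGet D (nvar x_i)))
  (fun i => (- c) * rmem s D i)%R s p _ _)); first last.
- by move=> s1 i ip [ag rg] xi h /=; rewrite xi h rg ?hc ?sub0r // notin.
- by move=> s1 [ag _] /=; rewrite ag // inE.
move=> t1 s1 [ag1 rg1] [h1 T1].
have {}ag1 a : a != 30 -> nmem s1 a = nmem s a.
  by move=> h; apply: ag1; rewrite /= !inE !negb_or !h.
have {}rg1 a : a != D -> rmem s1 a = rmem s a.
  by move=> h; apply: rg1; rewrite /= !inE ?negb_or ?h.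
apply: wp_seq; apply: (wp_conseq _ (@add_productP D S da sa s1 nnz _ _ _ _ _)) => //; last by rewrite ag1.
move=> t2 s2 [ag2 rg2] [h2 T2].
have ag12 a : a != 30 -> nmem s2 a = nmem s a.
  by move=> h; rewrite ag2 ?ag1 //= !inE !negb_or !h.
have rg12 a : a != D -> rmem s2 a = rmem s a.
  by move=> h; rewrite rg2 ?rg1 //= !inE ?negb_or ?h.
have hu (i : 'I_p) : rmem s2 D i = u i 0%R.
  rewrite h2 h1 ltn_ord hy mulNr addrC /u [RHS]mxE [X in (_ = _ + X)%R]mxE.
  rewrite [X in (_ = _ - X)%R]mxE; congr (_ - _)%R.
  rewrite -(stores_mulmx i hA hz); apply: eq_big => [e|e _].
    by rewrite ag1.
  by rewrite ag1 // !rg1 // eq_sym.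
apply: wp_seq; apply: (wp_conseq _ (@sum_squaresP D dim s2 p _ _ _)) => //; last by rewrite ag12.
move=> t3 s3 [ag3 rg3] [h3 T3].
have {}ag3 a : a != 30 -> nmem s3 a = nmem s2 a.
  by move=> h; apply: ag3; rewrite /= !inE !negb_or !h.
have {}rg3 a : a != 25 -> rmem s3 a = rmem s2 a.
  by move=> h; apply: rg3; rewrite /= !inE ?negb_or !h.
have hn : Num.sqrt (rmem s3 r_acc 0) = norm2 u.
  rewrite h3 /norm2; congr Num.sqrt.
  rewrite (_ : iota 0 p = index_iota 0 p); last by rewrite /index_iota subn0.
  by rewrite big_mkord; apply: eq_bigr => i _; rewrite hu expr2.
apply: wp_seq; apply: wp_run => // t4 T4; rewrite run_rset.
apply: (wp_conseq _ (@map_loopP D (nvar dim) (RDiv (RGet D (nvar x_i)) (rvar cout))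
  (fun i => (norm2 u)^-1 * rmem s2 D i)%R _ p _ _)).
- move=> t5 s5 [_ rg5] [h5 T5]; split.
  + by move=> i; rewrite h5 ltn_ord hu [RHS]mxE.
  + rewrite rg5 /=; first by rewrite eqxx /= hn.
    by rewrite !inE eq_sym.
  by move: T1 T2 T3 T4 T5; rewrite /half_cost /for_cost /=; lia.
- by move=> s5 [ag5 _] /=; rewrite ag5 ?inE //= ag3 // ag12.
move=> s5 i ip [ag5 rg5] xi h /=; rewrite xi h rg5 ?inE 1?eq_sym //= !eqxx hn.
by rewrite (negbTE Dcout) /= rg3 // mulrC.
Qed.

Lemma lanczosP s p q nnz k (A : 'M[R]_(p, q)) (v1 : nat -> R) :
  nmem s a_dims 3 = k -> nmem s x_nnz 0 = nnz -> nmem s x_height 0 = p -> nmem s x_width 0 = q ->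
  stores_entries_of s a_tallrow a_tallcol nnz A ->
  (forall e, e < nnz -> nmem s a_tallrow e < p) ->
  (forall i, i < q -> rmem s r_v i = v1 i) -> (forall i, rmem s r_u i = 0%R) ->
  rmem s r_betaj 0 = 0%R ->
  wp lanczos s (fun t s' =>
    [/\ forall i, i < k -> rmem s' r_alpha i = gkl_a (gkl A (start_vec v1 q) i.+1),
        forall i, i < k -> rmem s' r_beta i = gkl_b (gkl A (start_vec v1 q) i.+1)
      & t <= for_cost dim_steps k (half_cost p nnz + half_cost q nnz + 20)]).
Proof.
move=> hk h49 h52 h53 hA hlt hv hu hb.
pose G i := gkl A (start_vec v1 q) i.
have hAT : stores_entries_of s a_tallcol a_tallrow nnz A^T.
  split=> // i j; rewrite mxE (proj2 hA); apply: eq_bigl => e; exact: andbC.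
apply: (wp_for (N := k) (C := half_cost p nnz + half_cost q nnz + 20) (P := fun j s' =>
  [/\ stores_vec s' r_u (gkl_u (G j)), stores_vec s' r_v (gkl_v (G j)),
   rmem s' r_betaj 0 = gkl_b (G j), forall i, i < j -> rmem s' r_alpha i = gkl_a (G i.+1)
   & forall i, i < j -> rmem s' r_beta i = gkl_b (G i.+1)])) => //.
- by move=> s1 [ag _] /=; rewrite ag.
- by split=> // i /=; rewrite ?hu ?hv // mxE.
- move=> j s1 jk [ag rg] xj [hu1 hv1 hb1 ha5 hb6].
  have E a : a \in [:: 50; 51; 49; 52; 53] -> nmem s1 a = nmem s a.
    by rewrite !inE => H; rewrite ag //; move: H; do 4 (case/orP => [/eqP -> //|]); move/eqP ->.
  have E4 : rmem s1 r_outval = rmem s r_outval by rewrite rg.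
  apply: wp_seq; apply: (wp_conseq _ (@half_stepP 10 3 52 50 51 24 23 s1 p q nnz A _ _ _
     isT isT _ _ _ hu1 hv1 hb1)); rewrite ?E //; last by rewrite /stores_entries_of !E // E4.
  move=> t1 s2 [ag2 rg2] [u2 a2 T1].
  apply: wp_seq; apply: (wp_conseq _ (@half_stepP 3 10 53 51 50 23 24 s2 q p nnz A^T _ _ _
     isT isT _ _ _ _ u2 a2)); rewrite ?ag2 ?E //; last first.
    by rewrite /stores_vec rg2.
    by rewrite /stores_entries_of !ag2 // !E // rg2 // E4.
  move=> t2 s3 [ag3 rg3] [v3 b3 T2].
  apply: wp_run => // t3 T3; rewrite !run_simp.
  have e23 : rmem s3 r_alphaj 0 = gkl_a (G j.+1) by rewrite rg3.
  have e54 : nmem s3 x_step 0 = j by rewrite ag3 // ag2.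
  have e10 : stores_vec s3 r_u (gkl_u (G j.+1)) by rewrite /stores_vec rg3.
  have e3 : stores_vec s3 r_v (gkl_v (G j.+1)) by [].
  have e24 : rmem s3 r_betaj 0 = gkl_b (G j.+1) by [].
  have e5 : rmem s3 r_alpha = rmem s1 r_alpha by rewrite rg3 // rg2.
  have e6 : rmem s3 r_beta = rmem s1 r_beta by rewrite rg3 // rg2.
  clearbody G; split; first by move: T1 T2 T3; rewrite /=; lia.
  split=> //= i; rewrite ltnS leq_eqVlt e54.
    by case: eqP => [-> _|_ /=]; rewrite ?e23 // e5; apply: ha5.
  by case: eqP => [-> _|_ /=]; rewrite ?e24 // e6; apply: hb6.
by move=> t s1 _ [_ _ _ ? ?] ?.
Qed.

Lemma square_singular_valuesP s k (d e : nat -> R) :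
  nmem s a_dims 3 = k -> (forall i, i < k -> rmem s r_alpha i = d i) ->
  (forall i, i.+1 < k -> rmem s r_beta i = e i) ->
  wp square_singular_values s (fun t s' =>
    (exists theta, singular_values (bidiag_mx k d e) theta /\
       forall i, i < k -> rmem s' r_eigen i = (nth 0 theta i ^+ 2)%R) /\
    t <= k ^ 2 + 60 * (k + 1)).
Proof.
move=> hk hd he.
have bE : bidiag_mx k (rmem s r_alpha) (rmem s r_beta) = bidiag_mx k d e.
  apply/matrixP => i j; rewrite !mxE; case: eqP => _; first exact: hd.
  by case: eqP => // ji; apply: he; rewrite -ji.
have [theta [hth _]] := svd_gram (bidiag_mx k d e).
apply: wp_seq; exists (ncost dim_steps + k ^ 2).+1, (rset_seq s 11 theta).
split.
  have -> : k = neval s dim_steps by rewrite /= hk.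
  by apply: ExecBidiagSvd; rewrite /= hk bE.
have sz : size theta = k by case: hth => ->; rewrite minnn.
apply: (wp_conseq _ (@map_loopP 7 dim_steps (RMul (RGet r_sigma (nvar x_i)) (RGet r_sigma (nvar x_i)))
  (fun i => nth 0 theta i * nth 0 theta i)%R _ k _ _)).
- move=> t s' _ [h T]; split.
    by exists theta; split=> // i ik; rewrite h ik expr2.
  by move: T; rewrite /for_cost /=; lia.
- by move=> s1 [ag _] /=; rewrite ag.
by move=> s1 i ik [_ rg] xi _ /=; rewrite xi rg //= sz ik.
Qed.

End Lanczos.

(** * Compressed sparse row format *)

Section Csr.
Variables (R : realType) (m n : nat) (A : 'M[R]_(m, n)).

Lemma csr_rowptr0 : csr_rowptr A 0 = 0.
Proof. by rewrite /csr_rowptr big1. Qed.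

Lemma csr_rowptrS (i : 'I_m) :
  csr_rowptr A i.+1 = csr_rowptr A i + size (row_support A i).
Proof.
rewrite /csr_rowptr (bigD1 i) //= addnC; congr (_ + _).
by apply: eq_bigl => r; rewrite ltnS -val_eqE /= [RHS]ltn_neqAle andbC.
Qed.

Definition csr_entries : seq ((nat * nat) * R) :=
  flatten [seq [seq ((val i, val j), A i j) | j <- row_support A i] | i <- enum 'I_m].

Lemma csr_colidxE : csr_colidx A = [seq x.1.2 | x <- csr_entries].
Proof.
rewrite /csr_colidx /csr_entries map_flatten -map_comp; congr flatten.
by apply: eq_map => i /=; rewrite -map_comp.
Qed.

Lemma csr_valuesE : csr_values A = [seq x.2 | x <- csr_entries].
Proof.
rewrite /csr_values /csr_entries map_flatten -map_comp; congr flatten.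
by apply: eq_map => i /=; rewrite -map_comp.
Qed.

(** The entries of a row are contiguous, and start at its row pointer. *)
Lemma csr_entries_cat (i : 'I_m) : exists s1 s2,
  csr_entries = s1 ++ [seq ((val i, val j), A i j) | j <- row_support A i] ++ s2 /\
  size s1 = csr_rowptr A i.
Proof.
pose f := fun i : 'I_m => [seq ((val i, val j), A i j) | j <- row_support A i].
have E : enum 'I_m = take i (enum 'I_m) ++ i :: drop i.+1 (enum 'I_m).
  rewrite -{1}(cat_take_drop i (enum 'I_m)) (drop_nth i) ?size_enum_ord //.
  by rewrite nth_ord_enum.
exists (flatten [seq f j | j <- take i (enum 'I_m)]), (flatten [seq f j | j <- drop i.+1 (enum 'I_m)]).
split; first by rewrite /csr_entries {1}E map_cat flatten_cat.
have {E} : forall k, k <= m -> size (flatten [seq f j | j <- take k (enum 'I_m)]) = csr_rowptr A k.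
  elim=> [|k IH] km; first by rewrite take0 csr_rowptr0.
  rewrite (take_nth (Ordinal km)) ?size_enum_ord // map_rcons flatten_rcons size_cat IH ?(ltnW km) //.
  by rewrite (nth_ord_enum _ (Ordinal km)) (csr_rowptrS (Ordinal km)) /f size_map.
by apply; apply: ltnW.
Qed.

Lemma nth_csr_entries x0 (i : 'I_m) l : l < size (row_support A i) ->
  nth x0 csr_entries (csr_rowptr A i + l) =
  nth x0 [seq ((val i, val j), A i j) | j <- row_support A i] l.
Proof.
have [s1 [s2 [-> <-]]] := csr_entries_cat i => li.
by rewrite nth_cat ltnNge leq_addr /= addKn nth_cat size_map li.
Qed.

Lemma csr_index_lt (i : 'I_m) l : l < size (row_support A i) ->
  csr_rowptr A i + l < size csr_entries.
Proof.
have [s1 [s2 [-> <-]]] := csr_entries_cat i => li.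
by rewrite !size_cat size_map ltn_add2l ltn_addr.
Qed.

Lemma sum_csr_entries (i : 'I_m) (j : 'I_n) :
  (\sum_(x <- csr_entries | (x.1.1 == i :> nat) && (x.1.2 == j :> nat)) x.2 = A i j)%R.
Proof.
rewrite /csr_entries big_flatten big_map big_enum (bigD1 i) //= [X in (_ + X)%R]big1 ?addr0.
  rewrite big_map /row_support big_filter_cond big_enum_cond /=.
  rewrite (bigID (fun k => k == j)) /= [X in (_ + X)%R]big1 ?addr0.
    have [Aij|Aij] := eqVneq (A i j) 0%R.
      rewrite big1 ?Aij // => k /andP[/andP[Ak _] /eqP kj]; rewrite kj Aij eqxx in Ak.
      by [].
    rewrite (big_pred1 j) // => k; rewrite /= eqxx /=.
    by have [->|kj] := eqVneq k j; rewrite ?Aij ?eqxx ?andbT ?andbF.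
  by move=> k /andP[/and3P[_ _ /eqP/val_inj ->]]; rewrite eqxx.
move=> i' ni; rewrite big_map big1 // => k /andP[/eqP/val_inj E _].
by rewrite E eqxx in ni.
Qed.

End Csr.

Section CsrOutput.
Variables (R : realType) (m n : nat) (A : 'M[R]_(m, n)).
Variables (s : state R) (E : nat -> seq ((nat * nat) * R)).
Hypothesis E0 : E 0 = [::].
Hypothesis ES : forall i : 'I_m,
  E i.+1 = E i ++ [seq ((val i, val j), A i j) | j <- row_support A i].

Lemma emitted_csr : E m = csr_entries A /\ forall i, i <= m -> size (E i) = csr_rowptr A i.
Proof.
have H k : k <= m ->
   E k = flatten [seq [seq ((val i, val j), A i j) | j <- row_support A i] | i <- take k (enum 'I_m)]
   /\ size (E k) = csr_rowptr A k.
  elim: k => [|k IH] km; first by rewrite take0 E0 csr_rowptr0.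
  have [IH1 IH2] := IH (ltnW km).
  rewrite (take_nth (Ordinal km)) ?size_enum_ord // (nth_ord_enum _ (Ordinal km)).
  rewrite map_rcons flatten_rcons (ES (Ordinal km)) /= -IH1; split=> //.
  by rewrite size_cat IH2 size_map (csr_rowptrS A (Ordinal km)).
split=> [|i im]; last by have [] := H i im.
by have [-> _] := H m (leqnn m); rewrite take_oversize ?size_enum_ord.
Qed.

End CsrOutput.

(** * The classes found by the search are the components *)

Section Classes.
Variables (R : realType) (m n : nat) (B : 'M[R]_(m, n)) (I : {set 'I_m}).
Hypothesis B_sign : forall i j, B i j != 0%R -> (`|B i j| = 1)%R.
Hypothesis B_row : forall i, #|[set j | B i j != 0%R]| <= 2.

Local Notation D := (outer_rows B I).
Local Notation adj := (col_adj B I).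
Local Notation C0 := (zero_cols B I).

Definition signed_row (i : nat) : seq (nat * bool) :=
  if insub i is Some i' then [seq (val j, (0 <= B i' j)%R) | j <- row_support B i'] else [::].

Definition inner_row (i : nat) : bool := i \in [seq val r | r <- enum I].

Lemma signed_row_ord (i : 'I_m) :
  signed_row i = [seq (val j, (0 <= B i j)%R) | j <- row_support B i].
Proof. by rewrite /signed_row valK. Qed.

Lemma inner_row_ord (i : 'I_m) : inner_row i = (i \in I).
Proof. by rewrite /inner_row mem_map ?mem_enum //; apply: val_inj. Qed.

Lemma row_support_uniq i : uniq (row_support B i).
Proof. by rewrite filter_uniq ?enum_uniq. Qed.

Lemma mem_row_support i j : (j \in row_support B i) = (B i j != 0%R).
Proof. by rewrite mem_filter mem_enum andbT. Qed.

Lemma size_row_support i : size (row_support B i) <= 2.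
Proof.
apply: leq_trans (B_row i); rewrite -(card_uniqP (row_support_uniq i)).
by apply/eq_leq/eq_card => j; rewrite inE mem_row_support.
Qed.

Lemma size_signed_row i : i < m -> size (signed_row i) <= 2.
Proof. by move=> im; rewrite (signed_row_ord (Ordinal im)) size_map size_row_support. Qed.

Lemma row_support_pair i k l : k != l -> B i k != 0%R -> B i l != 0%R ->
  row_support B i = [:: k; l] \/ row_support B i = [:: l; k].
Proof.
move=> kl; rewrite -!mem_row_support.
case: (row_support B i) (size_row_support i) (row_support_uniq i) => [|x [|y [|//]]] //= _.
  by rewrite !inE => _ /eqP kx /eqP lx; rewrite kx lx eqxx in kl.
rewrite !inE => _ /orP[] /eqP kx /orP[] /eqP lx; subst; try (by left); try (by right);
  by rewrite eqxx in kl.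
Qed.

Local Notation arcs := (arcs_upto signed_row inner_row m).

Definition same_sign i k l : bool := ((0 <= B i k) == (0 <= B i l))%R.

Lemma arcsP a b x : (a, b, x) \in arcs -> exists i k l,
  [/\ i \notin I, k != l, B i k != 0%R & B i l != 0%R] /\
  [/\ a = val k, b = val l & x = same_sign i k l].
Proof.
move=> /flattenP[_ /mapP[i0 + ->]]; rewrite mem_iota /= add0n => im.
pose i := Ordinal im; rewrite -[i0]/(val i) /row_arcs inner_row_ord.
case: ifP => // /negbT iI; rewrite signed_row_ord.
have := row_support_uniq i; have := fun j => mem_row_support i j.
case: (row_support B i) => [|k [|l [|//]]] //= mem; rewrite andbT inE => kl.
have nk : B i k != 0%R by rewrite -mem !inE eqxx.
have nl : B i l != 0%R by rewrite -mem !inE eqxx orbT.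
rewrite !inE => /orP[] /eqP[-> -> ->]; first by exists i, k, l; do !split.
by exists i, l, k; rewrite /same_sign [(_ <= B i l)%R == _]eq_sym [l == k]eq_sym; do !split.
Qed.

Lemma mem_arcs (i : 'I_m) k l : i \notin I -> k != l -> B i k != 0%R -> B i l != 0%R ->
  (val k, val l, same_sign i k l) \in arcs.
Proof.
move=> iI kl nk nl; apply/flattenP; exists (row_arcs signed_row inner_row i).
  by apply/mapP; exists (val i) => //; rewrite mem_iota /= add0n.
rewrite /row_arcs inner_row_ord (negbTE iI) signed_row_ord /same_sign.
case: (row_support_pair kl nk nl) => -> /=; rewrite !inE ?eqxx //.
by rewrite [(_ <= B i l)%R == _]eq_sym eqxx orbT.
Qed.

Lemma arcs_sym a b x : (a, b, x) \in arcs -> (b, a, x) \in arcs.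
Proof.
case/arcsP => i [k [l [[iI kl nk nl] [-> -> ->]]]].
by rewrite /same_sign eq_sym; apply: mem_arcs => //; rewrite eq_sym.
Qed.

Lemma arcs_dst a b x : (a, b, x) \in arcs -> b < n.
Proof. by case/arcsP => i [k [l [_ [_ -> _]]]]; apply: ltn_ord. Qed.

Lemma outer_rowE (i : 'I_m) : i \notin I -> exists i', forall j, D i' j = B i j.
Proof.
move=> iI; have iI' : i \in ~: I by rewrite inE.
by exists (enum_rank_in iI' i) => j; rewrite mxE enum_rankK_in.
Qed.

Lemma outer_row_out (i' : 'I_#|~: I|) : enum_val i' \notin I.
Proof. by have := enum_valP i'; rewrite inE. Qed.

Lemma outer_colE (k : 'I_n) : outer_col signed_row inner_row m k = (k \notin C0).
Proof.
apply/hasP/idP => [[i0]|].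
  rewrite mem_iota /= add0n => im; pose i := Ordinal im; rewrite -[i0]/(val i).
  rewrite inner_row_ord signed_row_ord -map_comp => /andP[iI /mapP[j]].
  rewrite mem_row_support => nj /val_inj ->.
  have [i' Di] := outer_rowE iI; rewrite inE; apply/forallPn; exists i'.
  by rewrite Di.
rewrite inE => /forallPn[i']; rewrite mxE => nk.
exists (val (enum_val i')); first by rewrite mem_iota /= add0n.
rewrite inner_row_ord outer_row_out signed_row_ord -map_comp /=.
by apply/mapP; exists k => //; rewrite mem_row_support.
Qed.

Variables (c : nat) (comp root : nat -> nat) (sg : nat -> bool).
Hypothesis lab : labelling n arcs c comp root sg.

Lemma arc_connect (k l : 'I_n) x : (val k, val l, x) \in arcs -> adj k l.
Proof.
case/arcsP => i [k' [l' [[iI kl nk nl] [/val_inj -> /val_inj -> _]]]].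
have [i' Di] := outer_rowE iI.
by apply/existsP; exists i'; rewrite !Di nk.
Qed.

Lemma reach_connect (r : 'I_n) v x : reach arcs r v x ->
  exists2 k : 'I_n, v = val k & connect adj r k.
Proof.
elim=> [|a b {}x y _ [k -> rk] abA]; first by exists r; rewrite ?connect0.
exists (Ordinal (arcs_dst abA)) => //; apply: connect_trans rk (connect1 _).
exact: (@arc_connect _ (Ordinal (arcs_dst abA)) _ abA).
Qed.

(** Labels are constant along arcs, and a vertex is reached from the root of its
    class. *)
Lemma comp_connect (k l : 'I_n) : (comp k == comp l) = connect adj k l.
Proof.
have [_ hcomp hroot harc] := lab; apply/eqP/idP => [E|].
  have [ck rk] := hcomp k (ltn_ord k); have [cl rl] := hcomp l (ltn_ord l).
  have [rn _] := hroot _ ck.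
  have [k' /val_inj <- ck'] := @reach_connect (Ordinal rn) _ _ rk.
  rewrite -E in rl; have [l' /val_inj <- cl'] := @reach_connect (Ordinal rn) _ _ rl.
  by apply: connect_trans cl'; rewrite col_connect_sym.
case/connectP => p; elim: p k => [|x p IH] k /= => [_ -> //|/andP[kx px] lE].
rewrite -(IH x px lE); have [<- //|nkx] := eqVneq k x.
have /existsP[i' /andP[nk nx]] := kx; rewrite !mxE in nk nx.
exact: harc (mem_arcs (outer_row_out i') nkx nk nx).
Qed.

Definition class (l : nat) : {set 'I_n} := [set k : 'I_n | comp k == l].

Lemma classE (k : 'I_n) : class (comp k) = [set l | connect adj k l].
Proof. by apply/setP => l; rewrite !inE eq_sym comp_connect. Qed.

Lemma class_root l : 0 < l <= c -> exists k : 'I_n, comp k = l.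
Proof. by have [_ _ hroot _] := lab => /hroot[rn E]; exists (Ordinal rn). Qed.

Lemma comp_bound (k : 'I_n) : 0 < comp k <= c.
Proof. by have [_ h _ _] := lab; have [] := h k (ltn_ord k). Qed.

Lemma comp_zero (k l : 'I_n) : k \in C0 -> comp k = comp l -> k = l.
Proof.
move=> k0 /eqP; rewrite comp_connect => /connectP[[|x p]] /= => [_ -> //|].
by case/andP => /col_adj_nz; rewrite k0.
Qed.

(** No arc meets a zero column, so that it is the root of its class. *)
Lemma sign_zero (k : 'I_n) : k \in C0 -> sg k = false.
Proof.
move=> k0; have [_ h _ _] := lab; have [_] := h k (ltn_ord k).
move: (root _) => r H; have noarc a y : (a, nat_of_ord k, y) \notin arcs.
  apply/negP => /arcsP[i [k' [l' [[iI _ _ nl] [_ /val_inj E _]]]]].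
  have [i' Di] := outer_rowE iI; move: k0; rewrite inE => /forallP/(_ i').
  by rewrite Di E (negbTE nl).
case: _ _ / H noarc => // a b x y _ h1 no.
by have := no a y; rewrite h1.
Qed.

(** Labels of zero columns, in increasing order of the columns. *)
Definition zero_labels : seq nat :=
  [seq comp v | v <- iota 0 n & ~~ outer_col signed_row inner_row m v].

Lemma zero_labelsE : zero_labels = [seq comp (val k) | k <- enum C0].
Proof.
rewrite /zero_labels -val_enum_ord filter_map -map_comp; congr map.
rewrite enumT; apply: eq_filter => k /=.
by rewrite outer_colE negbK.
Qed.

Lemma zero_labelP (k : 'I_n) : (comp k \in zero_labels) = (k \in C0).
Proof.
rewrite zero_labelsE; apply/mapP/idP => [[l]|k0]; last by exists k; rewrite ?mem_enum.
by rewrite mem_enum => l0 /esym E; rewrite -(comp_zero l0 E).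
Qed.

Lemma zero_comp_inj :
  {in [pred v | (v < n) && ~~ outer_col signed_row inner_row m v] &, injective comp}.
Proof.
move=> u v; rewrite !inE => /andP[un hu] /andP[vn _] E.
have := @comp_zero (Ordinal un) (Ordinal vn); rewrite -[_ \in C0]negbK -outer_colE /=.
by move/(_ hu E)/(congr1 val).
Qed.

Lemma components_class C : reflect (exists2 l, 0 < l <= c & (l \notin zero_labels) /\ C = class l)
  (C \in components B I).
Proof.
apply: (iffP imsetP) => [[k]|[l lc [nz ->]]].
  rewrite inE => k0 ->; exists (comp k); first exact: comp_bound.
  by rewrite zero_labelP classE.
have [k kE] := class_root lc; exists k; last by rewrite -kE classE.
by rewrite inE -zero_labelP kE.
Qed.

Local Notation bad := (bad_upto signed_row inner_row comp sg m).

Definition signs : {ffun 'I_n -> bool} := [ffun k : 'I_n => sg k].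

Lemma sign_entry i j : B i j != 0%R -> (B i j = (-1) ^+ (~~ (0 <= B i j)))%R.
Proof.
move=> /B_sign; case: ger0P => _ h; first by rewrite h.
by rewrite expr1 -h opprK.
Qed.

(** Along a path of arcs, regulating signs change exactly as the signs of the
    search do. *)
Lemma signs_class (l : nat) (e : {ffun 'I_n -> bool}) : 0 < l <= c -> l \notin zero_labels ->
  regulates B I (class l) e -> exists d, forall k : 'I_n, k \in class l -> sg k = e k (+) d.
Proof.
move=> lc lz re; have [_ hcomp hroot harc] := lab.
have CC : class l \in components B I by apply/components_class; exists l.
have [rn rl] := hroot l lc; pose r := Ordinal rn.
suff H v x : reach arcs r v x -> exists2 k : 'I_n, v = val k & comp k = l /\ x = e k (+) e r.
  exists (e r) => k; rewrite inE => /eqP kl.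
  have [_] := hcomp k (ltn_ord k); rewrite kl => /H[k' /val_inj <-].
  by case.
elim=> [|a b {}x y _ [k -> [kl ->]] abA]; first by exists r; rewrite ?addbb.
have [b' bE] : exists b' : 'I_n, b = val b' by exists (Ordinal (arcs_dst abA)).
exists b' => //=; have bl : comp b = l by rewrite -(harc _ _ _ abA).
rewrite -[nat_of_ord b']/(val b') -bE.
split=> //; have [i [k' [l' [[iI kl' nk nl] [/val_inj Ek Eb ->]]]]] := arcsP abA.
have -> : b' = l' by apply: val_inj; rewrite -bE.
rewrite Ek in kl *; have [i' Di] := outer_rowE iI.
have kC : k' \in class l by rewrite inE kl.
have [|x' [xC kx nx]] := @regulates_pair _ _ _ B I B_row (class l) e i' k' CC re kC.
  by rewrite Di.
have -> : x' = l'.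
  have := @row_two _ _ _ B I B_row i' k' l' x' kl'; rewrite !Di in nx * => /(_ nk nl nx)[] // E.
  by rewrite E eqxx in kx.
rewrite !Di (sign_entry nk) (sign_entry nl) -!signr_addb => /eqP.
rewrite /same_sign; move: (0 <= B i k')%R (0 <= B i l')%R (e k') (e l') (e r) => [] [] [] [] [] //=;
  by rewrite ?expr0 ?expr1 -?opprD ?oppr_eq0 -mulr2n pnatr_eq0.
Qed.

Lemma not_bad_regulates l : 0 < l <= c -> l \notin zero_labels -> ~~ bad l ->
  regulates B I (class l) signs.
Proof.
move=> lc lz nb; have [_ _ _ harc] := lab.
apply/forallP => i'; apply/implyP => /exists_inP[k kC]; rewrite mxE.
set i := enum_val i' => nk; have iI : i \notin I := outer_row_out i'.
have Di j : D i' j = B i j by rewrite mxE.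
have {nb} : ~~ row_bad signed_row comp sg i l.
  apply: contra nb => h; apply/hasP; exists (val i); first by rewrite mem_iota /= add0n.
  by rewrite inner_row_ord iI.
have kl : comp k = l by move: kC; rewrite inE => /eqP.
rewrite /row_bad signed_row_ord.
have := mem_row_support i; have := row_support_uniq i.
case: (row_support B i) (size_row_support i) => [|a [|b [|//]]] _ /= uab mem.
- by have := mem k; rewrite nk.
- by have := mem k; rewrite nk inE => /eqP <-; rewrite kl eqxx.
have ab : a != b by move: uab; rewrite inE andbT.
have na : B i a != 0%R by rewrite -mem !inE eqxx.
have nb : B i b != 0%R by rewrite -mem !inE eqxx orbT.
have cab : comp a = comp b by apply: harc (mem_arcs iI ab na nb).
have al : comp a = l.
  by have := mem k; rewrite nk !inE => /orP[] /eqP E; [|rewrite cab]; rewrite -E.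
rewrite al eqxx andbT negbK => /eqP sab.
have aC : a \in class l by rewrite inE al.
have bC : b \in class l by rewrite inE -cab al.
have -> : [set k0 in class l | D i' k0 != 0%R] = [set a; b].
  apply/setP => x; rewrite !inE Di -mem !inE andb_idl // => /orP[] /eqP -> //.
    by rewrite al.
  by rewrite -cab al.
rewrite cards2 ab /=.
have val_of j : B i j != 0%R -> (D i' j * (-1) ^+ signs j = (-1) ^+ (~~ (0 <= B i j) (+) sg j))%R.
  by move=> nj; rewrite Di {1}(sign_entry nj) ffunE signr_addb.
have opp : ~~ (0 <= B i b)%R (+) sg b = ~~ (~~ (0 <= B i a)%R (+) sg a).
  by move: sab; move: (0 <= B i b)%R (0 <= B i a)%R (sg a) (sg b) => [] [] [] [].
case E : (~~ (0 <= B i a)%R (+) sg a) opp => opp; apply/andP; split; apply/exists_inP.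
- by exists b => //; rewrite val_of // opp.
- by exists a => //; rewrite val_of // E.
- by exists a => //; rewrite val_of // E.
- by exists b => //; rewrite val_of // opp.
Qed.

(** By [signs_class] regulating signs would satisfy the equation that the signs
    of the search violate. *)
Lemma bad_not_regulable l : 0 < l <= c -> l \notin zero_labels -> bad l ->
  ~~ regulable B I (class l).
Proof.
move=> lc lz /hasP[i0]; rewrite mem_iota /= add0n => im; pose i := Ordinal im.
rewrite -[i0]/(val i) inner_row_ord /row_bad signed_row_ord => /andP[iI bi].
apply/negP => /existsP[e re].
have CC : class l \in components B I by apply/components_class; exists l.
have [d dE] := signs_class lc lz re.
have [i' Di] := outer_rowE iI.
have := mem_row_support i; have := row_support_uniq i.
case: (row_support B i) bi => [|a [|b [|//]]] //= => [/eqP al _ mem|/andP[sab /eqP al] uab mem].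
  have na : B i a != 0%R by rewrite -mem inE eqxx.
  have aC : a \in class l by rewrite inE al.
  have [|b [bC ab nb] _] := @regulates_pair _ _ _ B I B_row (class l) e i' a CC re aC.
    by rewrite Di.
  by move: nb; rewrite Di -mem inE eq_sym (negbTE ab).
have ab : a != b by move: uab; rewrite inE andbT.
have na : B i a != 0%R by rewrite -mem !inE eqxx.
have nb : B i b != 0%R by rewrite -mem !inE eqxx orbT.
have aC : a \in class l by rewrite inE al.
have [_ _ _ harc] := lab.
have bC : b \in class l by rewrite inE -(harc _ _ _ (mem_arcs iI ab na nb)) al.
have [|x [xC ax nx]] := @regulates_pair _ _ _ B I B_row (class l) e i' a CC re aC.
  by rewrite Di.
have -> : x = b.
  by move: nx; rewrite Di -mem !inE eq_sym (negbTE ax) /= => /eqP.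
rewrite !Di (sign_entry na) (sign_entry nb) -!signr_addb => /eqP.
move: sab; rewrite !dE //.
move: (0 <= B i a)%R (0 <= B i b)%R (e a) (e b) d {dE} => [] [] [] [] [] //= _;
  by rewrite ?expr0 ?expr1 -?opprD ?oppr_eq0 -mulr2n pnatr_eq0.
Qed.

Definition regular_labels : seq nat := [seq l <- iota 1 c | ~~ bad l & l \notin zero_labels].

Definition regular_classes : seq {set 'I_n} := [seq class l | l <- regular_labels].

Lemma regular_labelP l :
  (l \in regular_labels) = [&& ~~ bad l, l \notin zero_labels & 0 < l <= c].
Proof. by rewrite mem_filter mem_iota add1n ltnS -andbA. Qed.

Lemma class_inj : {in regular_labels &, injective class}.
Proof.
move=> l l'; rewrite !regular_labelP => /and3P[_ _ lc] _ E.
have [k kl] := class_root lc; have : k \in class l' by rewrite -E inE kl.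
by rewrite inE kl => /eqP.
Qed.

Lemma regulation_classes : regulation B I regular_classes signs.
Proof.
split; last first.
  by move=> C /mapP[l]; rewrite regular_labelP => /and3P[nb lz lc] ->; apply: not_bad_regulates.
apply: uniq_perm; rewrite ?enum_uniq //.
  by rewrite map_inj_in_uniq ?filter_uniq ?iota_uniq //; apply: class_inj.
move=> C; rewrite mem_enum inE; apply/mapP/andP => [[l]|[]].
  rewrite regular_labelP => /and3P[nb lz lc] ->; split; first by apply/components_class; exists l.
  by apply/existsP; exists signs; apply: not_bad_regulates.
case/components_class => l lc [lz ->] re; exists l => //; rewrite regular_labelP lc lz !andbT.
by apply: contraL re; apply: bad_not_regulable.
Qed.

Definition column_labels : seq nat := zero_labels ++ regular_labels.

Lemma size_column_labels : size column_labels = #|C0| + size regular_classes.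
Proof. by rewrite size_cat zero_labelsE !size_map -cardE. Qed.

Lemma uniq_column_labels : uniq column_labels.
Proof.
rewrite cat_uniq filter_uniq ?iota_uniq // andbT; apply/andP; split.
  rewrite zero_labelsE map_inj_in_uniq ?enum_uniq // => k l.
  by rewrite mem_enum => k0 _; apply: comp_zero.
by apply/hasPn => l; rewrite regular_labelP => /and3P[].
Qed.

(** The 1-based column of M that a class contributes to, and 0 if the class is
    not regulable. *)
Definition label_column (l : nat) : nat :=
  if l \in column_labels then (index l column_labels).+1 else 0.

Local Notation block := (column_block (B := B) (I := I) (Cs := regular_classes)).

Lemma column_blockE (k : 'I_n) j :
  (k \in block j) = (label_column (comp k) == j.+1).
Proof.
have jX : j < size column_labels by rewrite size_column_labels.
have -> : (label_column (comp k) == j.+1) = (comp k == nth 0 column_labels j).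
  rewrite /label_column; case: ifP => [kX|kX].
    rewrite eqSS; apply/eqP/eqP => [<-|->]; first by rewrite nth_index.
    by rewrite index_uniq // uniq_column_labels.
  by apply/esym/negbTE; apply: contraFneq kX => ->; apply: mem_nth.
rewrite /column_block /column_labels nth_cat.
have sz : size zero_labels = #|C0| by rewrite zero_labelsE size_map -cardE.
case: (splitP j) => a ->; rewrite sz.
  rewrite ltn_ord inE zero_labelsE (nth_map k) -?cardE // -enum_val_nth.
  apply/eqP/eqP => [->//|E]; apply/esym/comp_zero => //; exact: enum_valP.
rewrite ltnNge leq_addr /= addKn /component (tnth_nth set0) /= (nth_map 0) ?inE //.
by rewrite -(size_map class).
Qed.

Lemma column_sign_signs k j : k \in block j ->
  (column_sign B I signs k = (-1) ^+ sg k)%R.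
Proof.
rewrite /column_sign; case: ifP => [k0|]; first by rewrite sign_zero.
by rewrite ffunE.
Qed.

End Classes.

(** * The emitted rows are the rows of M *)

Section RowEmission.
Variables (R : realType) (wqr S : nat -> R) (ent : nat -> seq (nat * R)) (N r : nat).
Hypothesis ent_le2 : size (ent r) <= 2.
Hypothesis ent_leN : forall x, x \in ent r -> x.1 <= N.

Let G c : R := (\sum_(x <- ent r | x.1 == c) x.2)%R.
Let V c : R := (G c / Num.sqrt (wqr r) * Num.sqrt (1 / S c))%R.
Let cols := [seq x.1.2 | x <- row_emission wqr S ent r].

Lemma row_emission_spec :
  [/\ row_emission wqr S ent r = [seq ((r, j), V j.+1) | j <- cols], sorted ltn cols
    & forall j, (j \in cols) = (j < N) && (G j.+1 != 0%R)].
Proof.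
have emE c v : G c = v -> emission wqr S r (c, v) =
    [seq ((r, j), V j.+1) | j <- if (c == 0) || (v == 0%R) then [::] else [:: c.-1]].
  by rewrite /emission /V /=; case: eqP => //= /eqP; rewrite -lt0n => c0 <-; case: eqP => //= _; rewrite prednK.
suff [L [LE Ls Lm]] : exists L, [/\ row_emission wqr S ent r = [seq ((r, j), V j.+1) | j <- L],
    sorted ltn L & forall j, (j \in L) = (j < N) && (G j.+1 != 0%R)].
  have -> : cols = L by rewrite /cols LE -map_comp map_id_in.
  by [].
rewrite /row_emission; move: emE ent_le2 ent_leN; rewrite /V /G.
case: (ent r) => [|[c v] [|[c' v'] [|//]]] emE _ leN /=.
- exists [::]; split=> //; rewrite ?addr0 ?emE //= ?big_nil // => j.
  by rewrite big_nil eqxx andbF.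
- have cN : c <= N by apply: (leN (c, v)); rewrite inE eqxx.
  have [c0|c0] := eqVneq c 0.
    exists [::]; split=> [||j] //; first by rewrite c0 /emission.
    by rewrite big_cons big_nil c0 /= eqxx andbF.
  rewrite leqn0 (negbTE c0) emE ?big_cons ?big_nil ?eqxx ?addr0 //.
  exists (if v == 0%R then [::] else [:: c.-1]); rewrite (negbTE c0); split=> [//||j]; first by case: (v == 0%R).
  rewrite big_cons big_nil /=; have [vz|vz] := eqVneq v 0%R.
    by rewrite vz; case: ifP; rewrite ?addr0 eqxx andbF.
  rewrite inE; have [cj|jc] := eqVneq c j.+1.
    by move: cN; rewrite cj /= ?eqxx ?addr0 ?vz ?andbT => ->.
  by rewrite eqxx andbF; apply/negbTE; lia.
have cN : c <= N by apply: (leN (c, v)); rewrite inE eqxx.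
have cN' : c' <= N by apply: (leN (c', v')); rewrite !inE eqxx orbT.
have [cc|cc] := eqVneq c c'.
  subst c'; rewrite emE ?big_cons ?big_nil ?eqxx ?addr0 //.
  exists (if (c == 0) || ((v + v')%R == 0%R) then [::] else [:: c.-1]).
  split=> [//||j]; first by case: (_ || _).
  rewrite !big_cons big_nil /=; have [c0|c0] := eqVneq c 0.
    by rewrite c0 /= eqxx andbF.
  have [vz|vz] := eqVneq (v + v')%R 0%R.
    by rewrite ?orbT in_nil; case: (c == j.+1); rewrite ?addr0 ?vz ?eqxx ?andbF.
  rewrite inE; have [cj|jc] := eqVneq c j.+1.
    by move: cN; rewrite cj /= ?eqxx ?addr0 ?vz ?andbT => ->.
  by rewrite eqxx andbF; apply/negbTE; lia.
have cc' : (c' == c) = false by rewrite eq_sym (negbTE cc).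
rewrite !emE ?big_cons ?big_nil /= ?eqxx ?(negbTE cc) ?cc' ?addr0 //.
rewrite -!map_cat -fun_if.
set L1 := (if (c == 0) || _ then _ else _); set L2 := (if (c' == 0) || _ then _ else _).
exists (if c <= c' then L1 ++ L2 else L2 ++ L1); split=> //; rewrite /L1 /L2.
  case: leqP => ccl; case: ifP => //= h1; case: ifP => //= h2; lia.
move=> j; rewrite !big_cons big_nil /=.
have -> : (j \in (if c <= c' then (if (c == 0) || (v == 0%R) then [::] else [:: c.-1]) ++
     (if (c' == 0) || (v' == 0%R) then [::] else [:: c'.-1])
    else (if (c' == 0) || (v' == 0%R) then [::] else [:: c'.-1]) ++
     (if (c == 0) || (v == 0%R) then [::] else [:: c.-1]))) =
   ((c == j.+1) && (v != 0%R)) || ((c' == j.+1) && (v' != 0%R)).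
  case: leqP => _; rewrite mem_cat; case: (v == 0%R); case: (v' == 0%R);
    rewrite ?orbT ?orbF ?andbF ?andbT /=; case: (c =P 0) => ?; case: (c' =P 0) => ?;
    rewrite ?inE ?in_nil /=; lia.
have [cj|jc] := eqVneq c j.+1.
  have cj' : (c' == j.+1) = false by rewrite -cj cc'.
  by rewrite cj' /= orbF addr0; case: (v != 0%R); rewrite ?andbF ?andbT //; lia.
have [cj'|jc'] := eqVneq c' j.+1; last by rewrite /= eqxx andbF.
by rewrite addr0 /=; case: (v' != 0%R); rewrite ?andbF ?andbT //; lia.
Qed.

(** Both lists are sorted by column and contain the same columns. *)
Lemma row_emission_support (F : 'I_N -> R) :
  (Num.sqrt (wqr r) != 0)%R -> (forall j : 'I_N, Num.sqrt (1 / S j.+1) != 0)%R ->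
  (forall j : 'I_N, F j = (\sum_(x <- ent r | x.1 == j.+1) x.2) /
     Num.sqrt (wqr r) * Num.sqrt (1 / S j.+1))%R ->
  row_emission wqr S ent r =
  [seq ((r, val j), F j) | j <- [seq j <- enum 'I_N | F j != 0%R]].
Proof.
move=> wn Sn FE; have [-> cs cm] := row_emission_spec.
have Fnz (j : 'I_N) : (F j != 0%R) = (G j.+1 != 0%R).
  by rewrite FE !mulf_eq0 invr_eq0 (negbTE wn) (negbTE (Sn j)) !orbF.
have -> : cols = [seq val j | j <- [seq j <- enum 'I_N | F j != 0%R]].
  apply: (irr_sorted_eq ltn_trans ltnn cs).
    apply: (subseq_sorted ltn_trans) (iota_ltn_sorted 0 N).
    by rewrite -val_enum_ord map_subseq // filter_subseq.
  move=> j; rewrite cm; apply/andP/mapP => [[jN gj]|[j']].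
    by exists (Ordinal jN) => //; rewrite mem_filter mem_enum Fnz gj.
  by rewrite mem_filter Fnz => /andP[gj _] ->; rewrite ltn_ord.
by rewrite -map_comp; apply: eq_map => j /=; rewrite FE.
Qed.

End RowEmission.

Definition copy_coordinates (a b : nat) : cmd :=
  For x_i (nvar x_nnz) (NSet a (nvar x_i) (NGet a_outrow (nvar x_i));; NSet b (nvar x_i) (NGet a_outcol (nvar x_i))).

(** With the coordinates exchanged, the same iteration runs on the transpose. *)
Definition orient : cmd :=
  NSet a_outdims (NConst 0) dim_inner;;
  NSet a_outdims (NConst 1) (nvar x_columns);;
  If (nlt dim_inner (nvar x_columns))
    (nassign x_height (nvar x_columns);; nassign x_width dim_inner;; copy_coordinates a_tallcol a_tallrow)
    (nassign x_height dim_inner;; nassign x_width (nvar x_columns);; copy_coordinates a_tallrow a_tallcol).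

Section Orient.
Variable R : realType.
Implicit Types s : state R.

Lemma copy_coordinatesP s a b nnz : (a, b) = (a_tallrow, a_tallcol) \/ (a, b) = (a_tallcol, a_tallrow) ->
  nmem s x_nnz 0 = nnz ->
  wp (copy_coordinates a b) s (fun t s' =>
    (forall e, e < nnz -> nmem s' a e = nmem s a_outrow e /\ nmem s' b e = nmem s a_outcol e) /\
    t <= for_cost (nvar x_nnz) nnz 40).
Proof.
move=> ab h49; apply: (wp_for (N := nnz) (C := 40) (P := fun i s' =>
   forall e, e < i -> nmem s' a e = nmem s a_outrow e /\ nmem s' b e = nmem s a_outcol e)) => //.
- by case: ab => -[-> ->].
- by case: ab => -[-> ->] s1 [ag _]; rewrite /= ag.
- case: ab => -[-> ->] i s1 iN [ag _] xi h; apply: wp_run => // t tC;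
  (split; first exact: leq_trans tC _) => e; rewrite ltnS leq_eqVlt !run_simp /= xi;
  by rewrite (ag 19) // (ag 6) //; case: eqP => [->//|_ /=]; apply: h.
Qed.

Lemma copy_lanczosP s a b p q nnz k (A : 'M[R]_(p, q)) (v1 : nat -> R) :
  (a, b) = (a_tallrow, a_tallcol) \/ (a, b) = (a_tallcol, a_tallrow) ->
  nmem s a_dims 3 = k -> nmem s x_nnz 0 = nnz -> nmem s x_height 0 = p -> nmem s x_width 0 = q ->
  let da := if a == a_tallrow then a_outrow else a_outcol in let sa := if a == a_tallrow then a_outcol else a_outrow in
  stores_entries_of s da sa nnz A -> (forall e, e < nnz -> nmem s da e < p) ->
  (forall i, rmem s r_v i = v1 i) -> (forall i, rmem s r_u i = 0%R) ->
  rmem s r_betaj 0 = 0%R ->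
  wp (copy_coordinates a b) s (fun t s' => wp lanczos s' (fun t' s'' =>
    [/\ nmem s'' a_outdims = nmem s a_outdims,
        forall i, i < k -> rmem s'' r_alpha i = gkl_a (gkl A (start_vec v1 q) i.+1),
        forall i, i < k -> rmem s'' r_beta i = gkl_b (gkl A (start_vec v1 q) i.+1)
      & t + t' <= for_cost (nvar x_nnz) nnz 40 +
          for_cost dim_steps k (half_cost p nnz + half_cost q nnz + 20)])).
Proof.
move=> ab hk hnnz hp hq da sa [hlt hA] hlt' hv hu hb.
apply: (wp_conseq _ (copy_coordinatesP ab hnnz)) => t s' ag [h T].
have {}h e : e < nnz -> nmem s' a_tallrow e = nmem s da e /\ nmem s' a_tallcol e = nmem s sa e.
  by move=> /h; rewrite /da /sa; case: ab => -[-> ->] [-> ->].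
have {ag} [agn agr] : agree [:: 30; 50; 51] [::] s s'.
  by apply: agree_sub ag => // x; case: ab => -[-> ->]; rewrite /= !inE => /or4P[] ->; rewrite ?orbT.
apply: (wp_conseq _ (@lanczosP _ s' p q nnz k A v1 _ _ _ _ _ _ _ _ _)).
- move=> t' s'' [ag' _] [h5 h6 T']; split=> //; first by rewrite ag' // agn.
  exact: leq_add.
- by rewrite agn.
- by rewrite agn.
- by rewrite agn.
- by rewrite agn.
- split=> [e en|i j]; first by have [_ ->] := h e en; apply: hlt.
  rewrite hA big_seq_cond [RHS]big_seq_cond agr //; apply: eq_bigl => e.
  rewrite mem_iota /= add0n; case: (ltnP e nnz) => //= en.
  by have [-> ->] := h e en.
- by move=> e en; have [-> _] := h e en; apply: hlt'.
- by move=> i _; rewrite agr.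
- by move=> i; rewrite agr.
- by rewrite agr.
Qed.

Lemma orient_lanczosP s p q nnz k (M : 'M[R]_(p, q)) (v1 : nat -> R) :
  nmem s a_dims 2 = p -> nmem s x_columns 0 = q -> nmem s a_dims 3 = k -> nmem s x_nnz 0 = nnz ->
  stores_entries_of s a_outrow a_outcol nnz M -> (forall e, e < nnz -> nmem s a_outrow e < p) ->
  (forall i, rmem s r_v i = v1 i) -> (forall i, rmem s r_u i = 0%R) ->
  rmem s r_betaj 0 = 0%R ->
  wp (orient;; lanczos) s (fun t s' =>
    [/\ nmem s' a_outdims 0 = p /\ nmem s' a_outdims 1 = q,
        forall i, i < k -> rmem s' r_alpha i = gkl_alpha v1 M i.+1,
        forall i, i < k -> rmem s' r_beta i = gkl_beta v1 M i.+1
      & t <= 60 * (nnz + 1) + for_cost dim_steps k (half_cost p nnz + half_cost q nnz + 20)]).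
Proof.
move=> hp hq hk hnnz hM hlt hv hu hb.
apply: wp_seq; rewrite /orient; apply: wp_seq; apply: wp_run => // t1 T1.
apply: wp_seq; apply: wp_run => // t2 T2; rewrite !run_nset.
set s2 := nset _ _ _ _.
have e4 : nmem s2 a_outdims 0 = p /\ nmem s2 a_outdims 1 = q by rewrite /= hp hq.
have E a : a != 4 -> nmem s2 a = nmem s a by move=> /negbTE h; rewrite /s2 /nset /= h.
have Er : rmem s2 = rmem s by [].
clearbody s2.
have alphaE j : gkl_alpha v1 M j = if p < q then gkl_a (gkl M^T (start_vec v1 p) j)
   else gkl_a (gkl M (start_vec v1 q) j) by [].
have betaE j : gkl_beta v1 M j = if p < q then gkl_b (gkl M^T (start_vec v1 p) j)
   else gkl_b (gkl M (start_vec v1 q) j) by [].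
have F x y : let s3 := nset (nset s2 52 0 x) 53 0 y in
    [/\ forall a, a != 52 -> a != 53 -> nmem s3 a = nmem s2 a, rmem s3 = rmem s2,
        nmem s3 x_height 0 = x & nmem s3 x_width 0 = y].
  by split=> // a /negbTE h1 /negbTE h2; rewrite /nset /= h1 h2.
apply: wp_if; rewrite /= !E // hp hq -ltnNge => pq; apply: wp_seq; apply: wp_run => // t3 T3;
  apply: wp_seq; apply: wp_run => // t4 T4; rewrite !run_nset.
  set s3 := nset _ _ _ _.
  have [Es Ers f52 f53] : [/\ forall a, a != 52 -> a != 53 -> nmem s3 a = nmem s2 a,
    rmem s3 = rmem s2, nmem s3 x_height 0 = nmem s2 x_columns 0 & nmem s3 x_width 0 = nmem s2 a_dims 2] := F _ _.
  rewrite E // hq in f52; rewrite E // hp in f53.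
  rewrite Er in Ers; clearbody s3.
  have hMT : stores_entries_of s3 a_outcol a_outrow nnz M^T.
    rewrite /stores_entries_of !Es // !E // Ers; split=> // i j.
    by rewrite mxE (proj2 hM); apply: eq_bigl => e; apply: andbC.
  have g3 : nmem s3 a_dims 3 = k by rewrite Es // E.
  have g49 : nmem s3 x_nnz 0 = nnz by rewrite Es // E.
  have gv i : rmem s3 r_v i = v1 i by rewrite Ers.
  have gu i : rmem s3 r_u i = 0%R by rewrite Ers.
  have gb : rmem s3 r_betaj 0 = 0%R by rewrite Ers.
  have e4' : nmem s3 a_outdims = nmem s2 a_outdims by rewrite Es.
  apply: (wp_conseq _ (@copy_lanczosP s3 51 50 q p nnz k M^T v1
    (or_intror erefl) g3 g49 f52 f53 hMT _ gv gu gb)); last first.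
    by move=> e en; rewrite /= Es // E //; apply: (proj1 hM).
  move=> t5 s5 _; apply: wp_conseq => t6 s6 _ [h4 h5 h6 T5]; split.
  - by rewrite h4 e4'.
  - by move=> i ik; rewrite alphaE pq h5.
  - by move=> i ik; rewrite betaE pq h6.
  by move: T1 T2 T3 T4 T5; rewrite [half_cost p _ + _]addnC /for_cost /=; lia.
rewrite -leqNgt leqNgt in pq.
set s3 := nset _ _ _ _.
have [Es Ers f52 f53] : [/\ forall a, a != 52 -> a != 53 -> nmem s3 a = nmem s2 a,
  rmem s3 = rmem s2, nmem s3 x_height 0 = nmem s2 a_dims 2 & nmem s3 x_width 0 = nmem s2 x_columns 0] := F _ _.
rewrite E // hp in f52; rewrite E // hq in f53.
rewrite Er in Ers; clearbody s3.
have g3 : nmem s3 a_dims 3 = k by rewrite Es // E.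
have g49 : nmem s3 x_nnz 0 = nnz by rewrite Es // E.
have gv i : rmem s3 r_v i = v1 i by rewrite Ers.
have gu i : rmem s3 r_u i = 0%R by rewrite Ers.
have gb : rmem s3 r_betaj 0 = 0%R by rewrite Ers.
have e4' : nmem s3 a_outdims = nmem s2 a_outdims by rewrite Es.
have hM3 : stores_entries_of s3 a_outrow a_outcol nnz M by rewrite /stores_entries_of !Es // !E // Ers.
apply: (wp_conseq _ (@copy_lanczosP s3 50 51 p q nnz k M v1
  (or_introl erefl) g3 g49 f52 f53 hM3 _ gv gu gb)); last first.
  by move=> e en; rewrite /= Es // E //; apply: hlt.
move=> t5 s5 _; apply: wp_conseq => t6 s6 _ [h4 h5 h6 T5]; split.
- by rewrite h4 e4'.
- by move=> i ik; rewrite alphaE (negbTE pq) h5.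
- by move=> i ik; rewrite betaE (negbTE pq) h6.
by move: T1 T2 T3 T4 T5; rewrite /for_cost /=; lia.
Qed.

End Orient.

(** * The whole program *)

Definition persistent_lanczos : cmd :=
  mark_inner;; scan_rows;; search;; check_rows;;
  number_zero;; number_classes;; sum_weights;; emit_rows;;
  (orient;; lanczos);; square_singular_values.

Lemma size_arcs_upto rowE inner i : size (arcs_upto rowE inner i) <= 2 * i.
Proof.
elim: i => // i IH; rewrite arcs_uptoS size_cat mulnS addnC leq_add //.
by rewrite /row_arcs; case: ifP => // _; case: (rowE i) => [|[a x] [|[b y] []]].
Qed.

Lemma for_cost_leq e n c c' : c <= c' -> for_cost e n c <= for_cost e n c'.
Proof. by move=> h; rewrite /for_cost !leq_add2r leq_mul2l !leq_add2r h orbT. Qed.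

Lemma size_emissions (R : realType) (wqr S : nat -> R) ent i :
  size (emissions wqr S ent i) <= 2 * i.
Proof.
elim: i => // i IH; rewrite emissionsS size_cat mulnS addnC leq_add //.
have em r cv : size (emission wqr S r cv) <= 1 by rewrite /emission; case: ifP.
rewrite /row_emission; case: ifP => _; first exact: leq_trans (em _ _) _.
by case: ifP => _; rewrite size_cat; apply: (@leq_add _ _ 1 1).
Qed.

Lemma sum_iota (R : realType) (F : nat -> R) (p : pred nat) n :
  (\sum_(i <- iota 0 n | p i) F i = \sum_(i < n | p i) F i)%R.
Proof.
rewrite (_ : iota 0 n = index_iota 0 n); last by rewrite /index_iota subn0.
by rewrite big_mkord.
Qed.

Lemma csr_entries_bound (R : realType) m n (A : 'M[R]_(m, n)) x :
  x \in csr_entries A -> (x.1.1 < m) && (x.1.2 < n).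
Proof. by case/flattenP => _ /mapP[i _ ->] /mapP[j _ ->] /=; rewrite !ltn_ord. Qed.

(** Moves a query about the memory back to the first state where the array has
    its present content. *)
Ltac frame := repeat match goal with
  | H : forall a, is_true (a \notin _) -> nmem ?s a = _ |- context [nmem ?s] => rewrite H; [|done]
  | H : forall a, is_true (a \notin _) -> rmem ?s a = _ |- context [rmem ?s] => rewrite H; [|done]
  end.

Section Correctness.
Variables (R : realType) (m n : nat) (B : 'M[R]_(m, n)) (I : {set 'I_m}).
Variables (wq : 'I_#|I| -> R) (w : 'I_n -> R) (k : nat) (v1 : nat -> R).
Hypothesis B_sign : forall i j, B i j != 0%R -> (`|B i j| = 1)%R.
Hypothesis B_row : forall i, #|[set j | B i j != 0%R]| <= 2.
Hypothesis wq_gt0 : forall i, (0 < wq i)%R.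
Hypothesis w_gt0 : forall j, (0 < w j)%R.

Local Notation s0 := (input_state B wq w k v1).
Local Notation C0 := (zero_cols B I).

Definition row_triples (i : 'I_m) : seq ((nat * nat) * R) :=
  [seq ((val i, val j), B i j) | j <- row_support B i].

Lemma input_rowptr i : i <= m -> nmem s0 a_rowptr i = csr_rowptr B i.
Proof. by move=> im; rewrite /= nth_mkseq. Qed.

Lemma input_entry (i : 'I_m) l : l < size (row_support B i) ->
  nmem s0 a_colidx (csr_rowptr B i + l) = (nth (coo0 R) (row_triples i) l).1.2 /\
  rmem s0 r_val (csr_rowptr B i + l) = (nth (coo0 R) (row_triples i) l).2.
Proof.
move=> li; rewrite /= csr_colidxE csr_valuesE.
by rewrite !(nth_map (coo0 R)) ?csr_index_lt // nth_csr_entries.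
Qed.

Lemma input_rows : stores_rows m n (signed_row B) s0.
Proof.
split=> // i im; rewrite (signed_row_ord _ (Ordinal im)) size_map.
rewrite !input_rowptr ?(ltnW im) // (csr_rowptrS B (Ordinal im)); split=> // l li.
have [-> ->] := input_entry li.
have -> : [seq (val j, (0 <= B (Ordinal im) j)%R) | j <- row_support B (Ordinal im)] =
   [seq (x.1.2, (0 <= x.2)%R) | x <- row_triples (Ordinal im)] by rewrite -map_comp.
by rewrite (nth_map (coo0 R)) // size_map.
Qed.

Section Labelled.
Variables (c : nat) (comp root : nat -> nat) (sg : nat -> bool).
Hypothesis lab : labelling n (arcs_upto (signed_row B) (inner_row I) m) c comp root sg.

Local Notation Cs := (regular_classes B I c comp sg).
Local Notation N := (#|C0| + size Cs).
Local Notation M := (pers_mx B wq w Cs (signs n sg)).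
Local Notation tgt v := (label_column B I c comp sg (comp v)).

Definition entries (r : nat) : seq (nat * R) :=
  if (insub r : option 'I_#|I|) is Some r' then
    [seq (tgt (val j), (-1) ^+ sg (val j) * B (enum_val r') j)%R
       | j : 'I_n <- row_support B (enum_val r')]
  else [::].

Definition class_weight (c : nat) : R :=
  (\sum_(v <- iota 0 n | tgt v == c) (nth 0 (codom w) v)^-1)%R.

Definition inner_weight (r : nat) : R := nth 0%R (codom wq) r.

Lemma entries_ord (r : 'I_#|I|) : entries r =
  [seq (tgt (val j), (-1) ^+ sg (val j) * B (enum_val r) j)%R
     | j : 'I_n <- row_support B (enum_val r)].
Proof. by rewrite /entries valK. Qed.

Lemma label_column_le l : label_column B I c comp sg l <= N.
Proof.
rewrite -(size_column_labels B I c comp sg) /label_column; case: ifP => // lX.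
by rewrite index_mem.
Qed.

Lemma nth_codom_ord (p : nat) (f : 'I_p -> R) (i : 'I_p) : nth 0%R (codom f) i = f i.
Proof. by rewrite /codom /image_mem (nth_map i) ?size_enum_ord // nth_ord_enum. Qed.

Let reg := regulation_classes B_sign B_row lab.

(** Every class is treated alike, hence the weight of a zero column is inverted
    twice. *)
Lemma class_weightE (j : 'I_N) : (1 / class_weight j.+1 = pers_weights B I w Cs 0 j)%R.
Proof.
rewrite pers_weightsE div1r; congr (_^-1)%R.
rewrite /class_weight sum_iota; apply: eq_big => [v|v _]; last by rewrite nth_codom_ord.
by rewrite (column_blockE B_row lab).
Qed.

Lemma entries_sum (r : 'I_#|I|) (j : 'I_N) :
  (\sum_(x <- entries r | x.1 == j.+1) x.2 = pers_boundary_mx B I Cs (signs n sg) r j)%R.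
Proof.
rewrite (pers_boundary_mxE reg) entries_ord big_map big_filter_cond big_enum_cond /=.
rewrite (bigID (fun v => B (enum_val r) v != 0%R)) [RHS](bigID (fun v => B (enum_val r) v != 0%R)) /=.
congr (_ + _)%R; last first.
  rewrite big1 => [|v]; last by case/andP => /andP[-> _].
  rewrite big1 // => v /andP[_]; rewrite mxE negbK => /eqP ->.
  by rewrite mul0r.
apply: eq_big => [v|v].
  by rewrite (column_blockE B_row lab); case: (B _ v == 0%R); rewrite ?andbF ?andbT //=.
case/andP => /andP[_ vj] _; rewrite -(column_blockE B_row lab) in vj.
by rewrite (column_sign_signs lab vj) mxE mulrC.
Qed.

Lemma pers_mxE (r : 'I_#|I|) (j : 'I_N) :
  (M r j = (\sum_(x <- entries r | x.1 == j.+1) x.2) / Num.sqrt (inner_weight r) *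
     Num.sqrt (1 / class_weight j.+1))%R.
Proof.
rewrite entries_sum class_weightE /inner_weight nth_codom_ord /pers_mx.
set Bp := pers_boundary_mx _ _ _ _; set pw := pers_weights _ _ _ _.
rewrite mul_mx_diag [LHS]mxE mul_diag_mx [in LHS]mxE; move: Bp pw => Bp pw.
by rewrite !mxE [(_^-1 * _)%R]mulrC.
Qed.

Lemma row_emission_pers (r : 'I_#|I|) :
  row_emission inner_weight class_weight entries r =
  [seq ((val r, val j), M r j) | j <- row_support M r].
Proof.
apply: (@row_emission_support R inner_weight class_weight entries N r _ _ (M r)).
- by rewrite entries_ord size_map size_row_support.
- by move=> x; rewrite entries_ord => /mapP[j _ ->] /=; apply: label_column_le.
- by rewrite /inner_weight nth_codom_ord gt_eqF // sqrtr_gt0.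
- move=> j; rewrite class_weightE gt_eqF // sqrtr_gt0.
  exact: (pers_weights_gt0 w_gt0 reg).
exact: pers_mxE.
Qed.

Local Notation E := (emissions inner_weight class_weight entries).

Lemma emissions_csr : E #|I| = csr_entries M /\
  forall r, r <= #|I| -> size (E r) = csr_rowptr M r.
Proof.
by apply: emitted_csr => // r; rewrite emissionsS row_emission_pers.
Qed.

Lemma stores_coo_csr s : stores_coo s (E #|I|) ->
  (forall r, r <= #|I| -> nmem s a_outptr r = size (E r)) ->
  [/\ stores_csr s a_outptr a_outcol r_outval M, stores_entries_of s a_outrow a_outcol (size (E #|I|)) M &
      forall e, e < size (E #|I|) -> nmem s a_outrow e < #|I| ].
Proof.
have [-> sizeE] := emissions_csr => -[_ hE] h5.
have bound e : e < size (csr_entries M) ->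
  ((nth (coo0 R) (csr_entries M) e).1.1 < #|I|) && ((nth (coo0 R) (csr_entries M) e).1.2 < N).
  by move=> eE; apply/csr_entries_bound/mem_nth.
split.
- split=> [r rI|e]; first by rewrite h5 // sizeE.
  rewrite csr_colidxE csr_valuesE size_map => eE.
  by rewrite !(nth_map (coo0 R)) //; have [_ -> ->] := hE e eE.
- split=> [e eE|i j]; first by have [_ -> _] := hE e eE; case/andP: (bound e eE).
  rewrite -sum_csr_entries (big_nth (coo0 R)) /index_iota subn0.
  rewrite big_seq_cond [RHS]big_seq_cond; apply: eq_big => e; rewrite mem_iota /= add0n.
    by case: ltnP => //= eE; have [-> -> _] := hE e eE.
  by case/andP => eE _; have [_ _ ->] := hE e eE.
by move=> e eE; have [-> _ _] := hE e eE; case/andP: (bound e eE).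
Qed.

End Labelled.

Definition program_constant : nat := 2000.

(** M has at most two entries in a row and at most as many columns as B, so that
    a Lanczos step costs O(|I| + n); the other phases cost O(m + n). *)
Theorem persistent_lanczosP :
  exists Cs eps, regulation B I Cs eps /\
    wp persistent_lanczos s0 (fun t s =>
      output_state s (pers_mx B wq w Cs eps) k v1 /\
      t <= program_constant * (m + n + #|I| + 1) +
           k * (program_constant * (#|I| + n + 1)) + k ^ 2).
Proof.
have sizeI : size [seq val r | r <- enum I] = #|I| by rewrite size_map -cardE.
have W1 := @mark_innerP R s0 m [seq val r | r <- enum I] (inner_row I) (esym sizeI)
   (fun r _ => erefl) (fun i => erefl) (fun i => erefl).
case: W1 => t1 [s1 [X1 [inner1 T1]]]; have [ag1 rg1] := exec_agree X1.
have rows1 : stores_rows m n (signed_row B) s1.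
  by rewrite /stores_rows !ag1 // rg1 //; apply: input_rows.
have le2 := size_signed_row B_row.
have arcs1 : stores_arcs s1 [::] by split; rewrite ?ag1.
have nz1 i : nmem s1 a_nonzero i = 0 by frame.
case: (scan_rowsP le2 rows1 inner1 nz1 arcs1) => t2 [s2 [X2 [arcs2 nz2 T2]]].
have [ag2 rg2] := exec_agree X2.
have n2 : nmem s2 a_dims 1 = n by frame.
have zero2 a : a \in [:: 13; 14; 15; 37; 38; 39; 40; 41] -> forall i, nmem s2 a i = 0.
  rewrite !inE => H i; move: H.
  by do 7 (case/orP => [/eqP ->|]; first by frame); move/eqP ->; frame.
case: (searchP (arcs_sym B_row) (@arcs_dst R m n B I) n2 arcs2 zero2)
  => t3 [s3 [X3 [[root [sg sg3 lab]] T3]]].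
have [ag3 rg3] := exec_agree X3.
set c := nmem s3 x_labels 0 in lab; set comp := nmem s3 a_label in lab.
exists (regular_classes B I c comp sg), (signs n sg); split; first exact: (regulation_classes B_sign B_row lab).
have rows3 : stores_rows m n (signed_row B) s3.
  by rewrite /stores_rows !ag3 // !ag2 // rg3 // rg2 //.
have inner3 : stores_inner m (inner_row I) s3 by rewrite /stores_inner ag3 // ag2.
have bad3 i : nmem s3 a_bad i = 0 by frame.
case: (check_rowsP le2 rows3 inner3 (comp := comp) (sg := sg) (fun v => erefl) sg3 bad3)
  => t4 [s4 [X4 [bad4 T4]]].
have [ag4 rg4] := exec_agree X4.
have n4 : nmem s4 a_dims 1 = n by frame.
have comp4 v : nmem s4 a_label v = comp v by frame.
have nz4 v : nmem s4 a_nonzero v = outer_col (signed_row B) (inner_row I) m v by frame.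
have cols4 : stores_columns s4 [::].
  by split=> [|l]; rewrite ?in_nil ag4 // ag3 // ag2 // ag1.
case: (number_zeroP n4 comp4 nz4 (zero_comp_inj B_row lab) cols4) => t5 [s5 [X5 [cols5 T5]]].
have [ag5 rg5] := exec_agree X5.
have c5 : nmem s5 x_labels 0 = c by frame.
have bad5 l : nmem s5 a_bad l = bad_upto (signed_row B) (inner_row I) comp sg m l.
  by rewrite ag5 // bad4.
case: (number_classesP c5 bad5 cols5) => t6 [s6 [X6 [cols6 T6]]].
have [ag6 rg6] := exec_agree X6.
have n6 : nmem s6 a_dims 1 = n by frame.
have tgt6 v : v < n -> nmem s6 a_column (nmem s6 a_label v) = label_column B I c comp sg (comp v).
  by move=> _; rewrite (proj2 cols6) ag6 // ag5 // ag4.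
have w6 v : v < n -> rmem s6 r_w v = nth 0%R (codom w) v.
  by move=> _; rewrite rg6 // rg5 // rg4 // rg3 // rg2 // rg1.
have S6 l : rmem s6 r_classwt l = 0%R by frame.
case: (sum_weightsP n6 tgt6 w6 S6) => t7 [s7 [X7 [S7 T7]]].
have [ag7 rg7] := exec_agree X7.
have N17 a : a \in [:: 0; 1; 2; 3] -> nmem s7 a = nmem s0 a.
  rewrite !inE => H; rewrite ag7; last by move: H; do 3 (case/orP => [/eqP -> //|]); move/eqP ->.
  by move: H; do 3 (case/orP => [/eqP ->|]; first by frame);
     move/eqP ->; frame.
have R7 a : a \in [:: 0; 1; 3] -> rmem s7 a = rmem s0 a.
  rewrite !inE; do 2 (case/orP => [/eqP ->|]; first by frame).
  by move/eqP ->; frame.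
have ent7 : stores_entries (entries c comp sg) s7 #|I|.
  move=> r rI; pose r' := Ordinal rI. rewrite (N17 3) // (N17 1) // (N17 2) // (R7 0) //.
  have -> : nmem s0 a_inner r = val (enum_val r').
    by rewrite /= (nth_map (enum_val r')) -?cardE //; congr val; apply/esym/(enum_val_nth _ r').
  cbv zeta; rewrite (entries_ord c comp sg r') size_map !input_rowptr ?ltn_ord ?(ltnW (ltn_ord _)) //.
  split; first exact: size_row_support.
    by rewrite csr_rowptrS.
  move=> l li; have [-> ->] := input_entry li.
  have -> : [seq (label_column B I c comp sg (comp (val j)), ((-1) ^+ sg (val j) * B (enum_val r') j)%R)
      | j : 'I_n <- row_support B (enum_val r')] =
    [seq (label_column B I c comp sg (comp x.1.2), ((-1) ^+ sg x.1.2 * x.2)%R)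
      | x <- row_triples (enum_val r')] by rewrite -map_comp.
  rewrite (nth_map (coo0 R)) ?size_map //=; set x := nth _ _ _.
  have xn : x.1.2 < n.
    have /mapP[j _ ->] : x \in row_triples (enum_val r') by apply: mem_nth; rewrite size_map.
    exact: ltn_ord.
  rewrite (_ : nmem s7 a_column (nmem s7 a_label x.1.2) = nmem s6 a_column (nmem s6 a_label x.1.2)); last by rewrite !ag7.
  rewrite tgt6 //; split=> //.
  have -> : nmem s7 a_sign x.1.2 = sg x.1.2 by frame.
  by case: (sg _); rewrite /= ?expr1 ?mulN1r ?sub0r ?expr0 ?mul1r.
have n7 : nmem s7 a_dims 2 = #|I| by rewrite N17.
have q7 r : r < #|I| -> rmem s7 r_wq r = inner_weight r by rewrite R7.
have z49 : nmem s7 x_nnz 0 = 0.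
  by frame.
have z5 : nmem s7 a_outptr 0 = 0.
  by frame.
case: (emit_rowsP (S := class_weight c comp sg) n7 ent7 q7 S7 z49 z5)
  => t8 [s8 [X8 [coo8 ptr8 T8]]].
have [ag8 rg8] := exec_agree X8.
have [csr8 ent8 in8] := stores_coo_csr lab coo8 ptr8.
have nnz8 : nmem s8 x_nnz 0 = size (emissions inner_weight (class_weight c comp sg)
     (entries c comp sg) #|I|) by case: coo8.
have size_nnz := size_emissions inner_weight (class_weight c comp sg)
     (entries c comp sg) #|I|.
move: (size _) nnz8 ent8 in8 size_nnz => nnz nnz8 ent8 in8 size_nnz.
have nI8 : nmem s8 a_dims 2 = #|I| by frame.
have N8 : nmem s8 x_columns 0 = #|C0| + size (regular_classes B I c comp sg).
  by rewrite ag8 // ag7 // (proj1 cols6) (size_column_labels B I c comp sg).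
have k8 : nmem s8 a_dims 3 = k by rewrite ag8 // N17.
have v8 i : rmem s8 r_v i = v1 i by rewrite rg8 // R7.
have u8 i : rmem s8 r_u i = 0%R.
  by frame.
have b8 : rmem s8 r_betaj 0 = 0%R.
  by frame.
case: (orient_lanczosP nI8 N8 k8 nnz8 ent8 in8 v8 u8 b8) => t9 [s9 [X9 [dim9 al9 be9 T9]]].
have [ag9 rg9] := exec_agree X9.
have k9 : nmem s9 a_dims 3 = k by frame.
case: (square_singular_valuesP (e := fun i => gkl_beta v1 (pers_mx B wq w (regular_classes B I c comp sg) (signs n sg)) i.+1) k9 al9
   (fun i ik => be9 i (ltnW ik))) => t10 [s10 [X10 [[theta [sv th]] T10]]].
have [ag10 rg10] := exec_agree X10.
exists (t1 + (t2 + (t3 + (t4 + (t5 + (t6 + (t7 + (t8 + (t9 + t10))))))))), s10.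
split; first by do 9 (econstructor; eauto).
split.
  split.
  - by frame.
  - by move: csr8; rewrite /stores_csr !ag10 // rg10 // !ag9 // rg9.
  - by move=> i ik; rewrite rg10 // al9.
  - by move=> i ik; rewrite rg10 // be9 // ltnW.
  - by exists theta.
have cn : c <= n by case: lab.
(* the columns of M have distinct labels, and labels are at most n *)
have Nn : #|C0| + size (regular_classes B I c comp sg) <= n.
  apply: leq_trans cn; rewrite -(size_column_labels B I c comp sg) -[X in _ <= X](size_iota 1).
  apply: uniq_leq_size (uniq_column_labels B_row lab) _ => l.
  rewrite mem_cat mem_iota add1n ltnS => /orP[|]; last first.
    by rewrite regular_labelP => /and3P[].
  by rewrite zero_labelsE => /mapP[v _ ->]; apply: comp_bound lab v.
have T3' := leq_trans T3 (leq_mul (_ : search_unit <= 300)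
  (leq_add (leq_add (leqnn _) (size_arcs_upto (signed_row B) (inner_row I) m)) (leqnn 1))).
have {}T2 := leq_trans T2 (for_cost_leq dim_rows m (_ : max_cost scan_row <= 300)).
have {}T4 := leq_trans T4 (for_cost_leq dim_rows m (_ : max_cost check_row <= 300)).
have {}T8 := leq_trans T8 (for_cost_leq dim_inner #|I| (_ : max_cost emit_row <= 300)).
(* a step is linear in |I| + n, because M has at most 2 |I| entries *)
have kc : for_cost dim_steps k (half_cost #|I| nnz +
     half_cost (#|C0| + size (regular_classes B I c comp sg)) nnz + 20) <=
     k * (1000 * (#|I| + n + 1)) + 10.
  rewrite /for_cost [ncost _]/= -addnA leq_add // leq_mul2l; apply/orP; right.
  by rewrite /half_cost; lia.
have {}T9 := leq_trans T9 (leq_add (leqnn _) kc).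
have kX : k * 60 <= k * (1000 * (#|I| + n + 1)) by rewrite leq_mul2l; apply/orP; right; lia.
move: (T2 isT) (T4 isT) (T8 isT) (T3' isT) T1 T5 T6 T7 T10 T9 => {T2 T4 T8 T3 T3' kc}.
rewrite sizeI /for_cost /program_constant ![ncost _]/= -[2000]/(1000 + 1000).
rewrite mulnDl [k * (_ + _)]mulnDr.
move: (k * (1000 * _)) kX (k ^ 2) => kb kX kk.
lia.
Qed.

End Correctness.

(** * Boundary matrices of simplicial complexes *)

Section Incidence.
Variables (R : realType) (V : finType) (flip : {set V} -> bool).
Implicit Types s t : {set V}.

(** Only one vertex can be removed from a simplex to give a facet, so that the
    sum has at most one term. *)
Lemma incidence_neq0 t s : incidence R flip t s != 0%R ->
  t \subset s /\ (`|incidence R flip t s| = 1)%R.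
Proof.
rewrite /incidence; have [v /andP[vs /eqP vt]|no] := pickP [pred v | (v \in s) && (s :\ v == t)].
  rewrite (big_pred1 v) => [_|u].
    by split; [rewrite -vt subD1set | rewrite !normrM !normr_sign !mulr1].
  apply/andP/eqP => [[us /eqP ut]|->]; last by rewrite vs vt.
  apply/eqP; apply: contraT => uv; have : u \in s :\ v by rewrite !inE uv.
  by rewrite vt -ut !inE eqxx.
by rewrite big_pred0 ?mulr0 ?eqxx // => v; apply: no.
Qed.

End Incidence.

Section Simplices.
Variables (V : finType) (K L : {set {set V}}) (q : nat) (ord : seq {set V}).
Hypothesis KL : K \subset L.
Hypothesis ordL : perm_eq ord (enum L).

Lemma size_ordered_simplices p : size (ordered_simplices ord p) = nb_simplices L p.
Proof.
rewrite size_filter (permP ordL) -size_filter /nb_simplices cardE; apply/perm_size/uniq_perm.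
- by rewrite filter_uniq ?enum_uniq.
- exact: enum_uniq.
- by move=> s; rewrite mem_filter !mem_enum inE andbC.
Qed.

Lemma simplexP p (i : 'I_(size (ordered_simplices ord p))) :
  (simplex i \in L) && (#|simplex i| == p.+1).
Proof.
have := mem_tnth i (in_tuple (ordered_simplices ord p)).
by rewrite /= mem_filter (perm_mem ordL) mem_enum andbC.
Qed.

Lemma simplex_inj p : injective (@simplex V ord p).
Proof.
move=> i j; rewrite /simplex !(tnth_nth set0) /= => /eqP.
rewrite nth_uniq // => [/eqP/val_inj //|].
by rewrite filter_uniq // (perm_uniq ordL) enum_uniq.
Qed.

Lemma card_row_indices : #|row_indices ord K q| = nb_simplices K q.
Proof.
rewrite -(card_imset _ (@simplex_inj q)); apply: eq_card => s.
apply/imsetP/idP => [[i iK ->]|]; rewrite inE.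
  by have /andP[_ ->] := simplexP i; move: iK; rewrite inE => ->.
case/andP => sK sq.
have sord : s \in ordered_simplices ord q.
  by rewrite mem_filter sq (perm_mem ordL) mem_enum (subsetP KL).
have si : index s (ordered_simplices ord q) < size (ordered_simplices ord q) by rewrite index_mem.
have sE : simplex (Ordinal si) = s by rewrite /simplex (tnth_nth set0) /= nth_index.
by exists (Ordinal si); rewrite // inE sE.
Qed.

Lemma nb_simplices_sub : nb_simplices K q <= nb_simplices L q.
Proof.
apply: subset_leq_card; apply/subsetP => s; rewrite !inE => /andP[sK ->].
by rewrite (subsetP KL).
Qed.

(** The columns with a nonzero entry in a row are distinct cofaces of the simplex
    of that row. *)
Lemma boundary_row (R : realType) flip (i : 'I_(size (ordered_simplices ord q))) :
  non_branching L q -> #|[set j | boundary_mx R flip ord q i j != 0%R]| <= 2.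
Proof.
have /andP[iL iq] := simplexP i.
move=> /forall_inP/(_ (simplex i)); rewrite inE iL iq => /(_ isT); apply: leq_trans.
rewrite -(card_imset _ (@simplex_inj q.+1)); apply: subset_leq_card.
apply/subsetP => _ /imsetP[j + ->]; rewrite inE mxE => /incidence_neq0[sub _].
by rewrite !inE sub andbT; apply: simplexP.
Qed.

End Simplices.

Lemma inv_ackermann_gt0 n : 0 < inv_ackermann n.
Proof. by rewrite /inv_ackermann; case: ex_minnP => p /andP[]. Qed.

Local Open Scope ring_scope.

Theorem proposition5p1 :
  exists (prog : cmd) (c : nat),
  forall (R : realType) (V : finType) (K L : {set {set V}}) (q : nat)
    (ord : seq {set V}) (flip : {set V} -> bool) (wK wL : {set V} -> R),
  simplicial_complex K -> simplicial_complex L -> K \subset L ->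
  non_branching L q ->
  perm_eq ord (enum L) ->
  (forall s, s \in K -> 0 < wK s) -> (forall s, s \in L -> 0 < wL s) ->
  let B := boundary_mx R flip ord q in
  let I := row_indices ord K q in
  let wq := fun i : 'I_#|I| => wK (simplex (enum_val i)) in
  let w := fun j : 'I_(size (ordered_simplices ord q.+1)) => wL (simplex j) in
  let N := minn #|I| (#|zero_cols B I| + #|regulable_components B I|) in
  forall (k : nat) (v1 : nat -> R),
  (0 < k <= N)%N -> \sum_(i < N) v1 i ^+ 2 = 1 ->
  (forall Cs eps, regulation B I Cs eps ->
     gkl_approximates_eigenvalues v1 (pers_mx B wq w Cs eps)
       (up_pers_laplacian B wq w) k) /\
  (exists Cs eps (t : nat) (s : state R),
     [/\ regulation B I Cs eps,
         exec prog (input_state B wq w k v1) t s,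
         output_state s (pers_mx B wq w Cs eps) k v1
       & (t <= c * ((nb_simplices L q - nb_simplices K q)
                      * inv_ackermann (nb_simplices L q.+1)
                    + k * (nb_simplices L q.+1 + nb_simplices K q) + k ^ 2))%N]).
Proof.
exists persistent_lanczos, (5 * program_constant)%N.
move=> R V K L q ord flip wK wL _ _ KL nb ordL wK0 wL0 B I wq w N k v1 /andP[k0 kN] v1u.
have B_row i : (#|[set j | B i j != 0%R]| <= 2)%N by apply: boundary_row ordL R flip i nb.
have B_sign i j : B i j != 0 -> `|B i j| = 1 by rewrite mxE => /incidence_neq0[].
have wq_gt0 i : 0 < wq i by apply: wK0; have := enum_valP i; rewrite inE.
have w_gt0 j : 0 < w j by apply: wL0; have /andP[] := simplexP ordL j.
split=> [Cs eps reg|].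
  have sizeCs : size Cs = #|regulable_components B I|.
    by case: reg => /perm_size ->; rewrite -cardE.
  apply: gkl_approximates => //; last by rewrite sizeCs.
  exact: (char_poly_up_pers_laplacian B_sign B_row wq_gt0 w_gt0 reg).
have [Cs [eps [reg [t [s [ex [out tb]]]]]]] :=
  persistent_lanczosP k v1 B_sign B_row wq_gt0 w_gt0.
exists Cs, eps, t, s; split=> //; apply: leq_trans tb _.
(* as k and |I| are positive, k (n + |I|) absorbs the constants and n + |I| *)
have nI0 : (0 < #|I|)%N by apply: leq_trans k0 (leq_trans kN (geq_minl _ _)).
rewrite (card_row_indices q KL ordL) in nI0 *; rewrite !(size_ordered_simplices ordL).
have := nb_simplices_sub q KL; have a0 := inv_ackermann_gt0 (nb_simplices L q.+1).
move: (nb_simplices K q) (nb_simplices L q) (nb_simplices L q.+1) a0 nI0 => x y z.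
move: (inv_ackermann z) => a a0 x0 xy {B_row B_sign wq_gt0 w_gt0}.
have da : (y - x <= (y - x) * a)%N by rewrite leq_pmulr.
have kz : (z + x <= k * (z + x))%N by rewrite leq_pmull.
have kz' : (k * (x + z + 1) <= k * (z + x) + k * (z + x))%N.
  by rewrite -mulnDr leq_mul2l; apply/orP; right; lia.
rewrite mulnCA; have : (0 < program_constant)%N by [].
move: ((y - x) * a)%N (k * (z + x))%N (k * (x + z + 1))%N da kz kz' (k ^ 2)%N => d e f da kz kz' kk.
move: program_constant => C C0.
have -> : (5 * C * (d + e + kk) = C * (5 * (d + e)) + C * (5 * kk))%N.
  by rewrite -mulnDr -mulnDr mulnCA mulnA.
apply: leq_add.
  by rewrite -mulnDr leq_mul2l; apply/orP; right; lia.
by rewrite mulnCA (leq_trans (leq_pmull kk C0)) // leq_pmull.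
Qed.
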